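(* Let $d\ge 1$ and let $(S_t)_{t\in\mathbb{N}}$, $S_t\subseteq\mathbb{N}^d$, be a parametric Presburger family such that either (a) $S_t$ is defined without using any quantifiers, or (b) the only inequalities used to define $S_t$ are of the form $\mathbf{a}\cdot\mathbf{x}\le b(t)$, where $b(t)$ is a polynomial and $\mathbf{a}$ is a fixed integer vector not depending on $t$ (quantifiers being allowed). Then Properties 1, 2, 3, 3a, 3b and 4, as defined in the context, all hold for $(S_t)$.
   Context: $\mathbb{N}=\{0,1,2,\dots\}$. A function $g:\mathbb{N}\to\mathbb{Q}$ is a quasi-polynomial if there exist a period $m\ge 1$ and polynomials $p_0,\dots,p_{m-1}\in\mathbb{Q}[t]$ with $g(t)=p_i(t)$ whenever $t\equiv i \bmod m$. A function on $\mathbb{N}$ is eventually a quasi-polynomial if there is $T$ such that it agrees with a quasi-polynomial for all $t\ge T$. A set $A\subseteq\mathbb{N}$ is eventually periodic if there exist $T$ and $m\ge1$ such that for all $t\ge T$, $t\in A\iff t+m\in A$. A vector in $\mathbb{Z}^d$ is lexicographically positive if it is nonzero and its first nonzero entry is positive. For $\mathbf{x}=(x_1,\dots,x_d)$ and $\mathbf{s}\in\mathbb{Z}^d$, $\mathbf{x}^{\mathbf{s}}=x_1^{s_1}\cdots x_d^{s_d}$. A family $(S_t)_{t\in\mathbb{N}}$ of subsets of $\mathbb{N}^d$ is a parametric Presburger family if the sets $S_t$ can be defined over the natural numbers (all variables, free and quantified, range over $\mathbb{N}$) by one formula, the same for all $t$, built with quantifiers ($\exists,\forall$), boolean operations (and,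 or, not), and inequalities of the form $\mathbf{a}(t)\cdot\mathbf{x}\le b(t)$, where $\mathbf{x}$ is the vector of variables (free and quantified), $b\in\mathbb{Z}[t]$, and $\mathbf{a}$ is a vector of polynomials in $\mathbb{Z}[t]$; $t$ is a parameter and is not quantified. The free variables of the formula are the $d$ coordinates of the elements of $S_t$. For a family $(S_t)_{t\in\mathbb{N}}$ of subsets of $\mathbb{N}^d$: Property 1: The set of $t$ such that $S_t$ is nonempty is eventually periodic. Property 2: There exists a function $g:\mathbb{N}\to\mathbb{N}$ such that $g(t)=|S_t|$ whenever $S_t$ has finite cardinality, and $g$ is eventually a quasi-polynomial. Moreover, the set of $t$ such that $S_t$ has finite cardinality is eventually periodic. Property 3: There exists a function $\mathbf{x}:\mathbb{N}\to\mathbb{N}^d$ such that, if $S_t$ is nonempty, then $\mathbf{x}(t)\in S_t$, and the coordinate functions of $\mathbf{x}$ are eventually quasi-polynomials. Moreover, the set of $t$ such that $S_t$ is nonempty is eventually periodic. Property 3a: For every $\mathbf{c}\in\mathbb{Z}^d\setminus\{0\}$, there exists a function $\mathbf{x}:\mathbb{N}\to\mathbb{N}^d$ such that, if $\max_{\mathbf{y}\in S_t}\mathbf{c}\cdot\mathbf{y}$ exists, then it is attained at $\mathbf{x}(t)\in S_t$, and the coordinate functions of $\mathbf{x}$ are eventually quasi-polynomials. Moreover, the set of $t$ such that the maximum exists is eventually periodic. Property 3b: For every $k\in\mathbb{N}$, there exist functions $\mathbf{x}_1,\dots,\mathbf{x}_k:\mathbb{N}\to\mathbb{N}^d$ such that,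 if $|S_t|\ge k$, then $\mathbf{x}_1(t),\dots,\mathbf{x}_k(t)$ are distinct elements of $S_t$, and the coordinate functions of the $\mathbf{x}_i$ are eventually quasi-polynomials. Moreover, the set of $t$ such that $|S_t|\ge k$ is eventually periodic. Property 4: There exists a period $m\ge 1$ such that, for each residue $i$ modulo $m$ and all sufficiently large $t\equiv i\bmod m$, $$\sum_{\mathbf{s}\in S_t}\mathbf{x}^{\mathbf{s}}=\frac{\sum_{j=1}^{n_i}\alpha_{ij}\mathbf{x}^{\mathbf{q}_{ij}(t)}}{(1-\mathbf{x}^{\mathbf{b}_{i1}(t)})\cdots(1-\mathbf{x}^{\mathbf{b}_{ik_i}(t)})},$$ where $n_i,k_i\in\mathbb{N}$ and $\alpha_{ij}\in\mathbb{Q}$ do not depend on $t$, the coordinates of $\mathbf{q}_{ij}$ and $\mathbf{b}_{ij}$ are polynomials in $\mathbb{Q}[t]$ with $\mathbf{q}_{ij}(t),\mathbf{b}_{ij}(t)\in\mathbb{Z}^d$ for such $t$, and the $\mathbf{b}_{ij}(t)$ are lexicographically positive. Here a rational function is identified with the Laurent series obtained by expanding each factor $1/(1-\mathbf{x}^{\mathbf{b}})$ as $1+\mathbf{x}^{\mathbf{b}}+\mathbf{x}^{2\mathbf{b}}+\cdots$, which converges near $(e^{-\varepsilon},e^{-\varepsilon^2},\dots,e^{-\varepsilon^d})$ for sufficiently small $\varepsilon>0$. *)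

(* Defs.v *)
From HB Require Import structures.
From mathcomp Require Import all_boot all_order all_algebra.
From mathcomp Require Import boolp classical_sets cardinality fsbigop.

Set Implicit Arguments.
Unset Strict Implicit.
Unset Printing Implicit Defensive.

Import Order.TTheory GRing.Theory Num.Theory.
Local Open Scope classical_set_scope.
Local Open Scope card_scope.
Local Open Scope ring_scope.

Definition dot (n : nat) (c : 'rV[int]_n) (x : 'rV[nat]_n) : int :=
  \sum_(i < n) c 0 i * (x 0 i)%:Z.

Definition natZ (n : nat) (x : 'rV[nat]_n) : 'rV[int]_n := map_mx Posz x.

(* [formula n]: well-scoped formulas with n free variables.  A quantifier binds
   variable 0 of its body; the variables of the context are shifted by 1. *)
Inductive formula : nat -> Type :=
| Le (n : nat) (a : 'rV[{poly int}]_n) (b : {poly int}) : formula n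
| Not (n : nat) (f : formula n) : formula n
| And (n : nat) (f g : formula n) : formula n
| Or (n : nat) (f g : formula n) : formula n
| Ex (n : nat) (f : formula (1 + n)) : formula n
| All (n : nat) (f : formula (1 + n)) : formula n.

Fixpoint holds (t : nat) (n : nat) (f : formula n) : 'rV[nat]_n -> Prop :=
  match f in formula n return 'rV[nat]_n -> Prop with
  | Le _ a b => fun x => dot (map_mx (fun p => p.[t%:Z]) a) x <= b.[t%:Z]
  | Not _ f => fun x => ~ holds t f x
  | And _ f g => fun x => holds t f x /\ holds t g x
  | Or _ f g => fun x => holds t f x \/ holds t g x
  | Ex _ f => fun x => exists y : nat, holds t f (row_mx (const_mx y) x)
  | All _ f => fun x => forall y : nat, holds t f (row_mx (const_mx y) x)
  end.

Definition defines (d : nat) (f : formula d) (S : nat -> set 'rV[nat]_d) : Prop :=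
  forall (t : nat) (x : 'rV[nat]_d), S t x <-> holds t f x.

Fixpoint quantifier_free (n : nat) (f : formula n) : bool :=
  match f with
  | Le _ _ _ => true
  | Not _ f => quantifier_free f
  | And _ f g | Or _ f g => quantifier_free f && quantifier_free g
  | Ex _ _ | All _ _ => false
  end.

Fixpoint constant_coefficients (n : nat) (f : formula n) : Prop :=
  match f with
  | Le n a _ => exists c : 'rV[int]_n, a = map_mx polyC c
  | Not _ f | Ex _ f | All _ f => constant_coefficients f
  | And _ f g | Or _ f g => constant_coefficients f /\ constant_coefficients g
  end.

Definition quasi_polynomial (g : nat -> rat) : Prop :=
  exists2 m : nat, (0 < m)%N &
    exists p : 'I_m -> {poly rat},
      forall (i : 'I_m) (t : nat), t = i %[mod m] -> g t = (p i).[t%:R].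

Definition eventually_quasi_polynomial (g : nat -> nat) : Prop :=
  exists2 h : nat -> rat, quasi_polynomial h &
    exists T : nat, forall t : nat, (T <= t)%N -> (g t)%:R = h t.

Definition eventually_periodic (A : set nat) : Prop :=
  exists T m : nat, (0 < m)%N /\
    forall t : nat, (T <= t)%N -> (A t <-> A (t + m)%N).

Definition lex_positive (d : nat) (v : 'rV[int]_d) : Prop :=
  exists2 i : 'I_d, 0 < v 0 i & forall j : 'I_d, (j < i)%N -> v 0 j = 0.

Definition is_max_at (d : nat) (c : 'rV[int]_d) (A : set 'rV[nat]_d)
    (x : 'rV[nat]_d) : Prop :=
  A x /\ forall y : 'rV[nat]_d, A y -> dot c y <= dot c x.

(* Formal Laurent series, given by their coefficients; [F s] is the coefficient
   of x^s.  The finitely supported sums below take the value 0 on an infinite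
   support, which does not occur for lexicographically positive exponents:
   those lie in an open half-space, so every coefficient is a finite sum. *)
Definition laurent (d : nat) : Type := 'rV[int]_d -> rat.

Definition monomial (d : nat) (q : 'rV[int]_d) : laurent d :=
  fun s => (s == q)%:R.

Definition laurent_mul (d : nat) (F G : laurent d) : laurent d :=
  fun s => \sum_(u \in [set: 'rV[int]_d]) F u * G (s - u).

(* 1 + x^b + x^(2b) + ... *)
Definition geometric (d : nat) (b : 'rV[int]_d) : laurent d :=
  fun s => \sum_(n \in [set: nat]) monomial (b *+ n) s.

Definition generating_function (d : nat) (A : set 'rV[nat]_d) : laurent d :=
  fun s => \sum_(y \in A) monomial (natZ y) s.

(* Expansion of (\sum_j alpha_j x^(q_j)) / \prod_l (1 - x^(b_l)). *)
Definition rational_expansion (d n k : nat) (alpha : 'I_n -> rat)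
    (q : 'I_n -> 'rV[int]_d) (b : 'I_k -> 'rV[int]_d) : laurent d :=
  laurent_mul (fun s => \sum_(j < n) alpha j * monomial (q j) s)
              (\big[@laurent_mul d/monomial 0]_(l < k) geometric (b l)).

(* The value at t of a vector of rational polynomials is the integer vector v;
   in particular that value is integral. *)
Definition has_value (d : nat) (p : 'rV[{poly rat}]_d) (t : nat)
    (v : 'rV[int]_d) : Prop :=
  map_mx (fun r : {poly rat} => r.[t%:R]) p = map_mx intr v.

Definition property1 (d : nat) (S : nat -> set 'rV[nat]_d) : Prop :=
  eventually_periodic [set t | S t !=set0].

Definition property2 (d : nat) (S : nat -> set 'rV[nat]_d) : Prop :=
  (exists2 g : nat -> nat,
     forall t : nat, finite_set (S t) -> S t #= `I_(g t) &
     eventually_quasi_polynomial g) /\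
  eventually_periodic [set t | finite_set (S t)].

Definition property3 (d : nat) (S : nat -> set 'rV[nat]_d) : Prop :=
  (exists2 x : nat -> 'rV[nat]_d,
     forall t : nat, S t !=set0 -> S t (x t) &
     forall j : 'I_d, eventually_quasi_polynomial (fun t => x t 0 j)) /\
  eventually_periodic [set t | S t !=set0].

Definition property3a (d : nat) (S : nat -> set 'rV[nat]_d) : Prop :=
  forall c : 'rV[int]_d, c != 0 ->
  (exists2 x : nat -> 'rV[nat]_d,
     forall t : nat, (exists y, is_max_at c (S t) y) -> is_max_at c (S t) (x t) &
     forall j : 'I_d, eventually_quasi_polynomial (fun t => x t 0 j)) /\
  eventually_periodic [set t | exists y, is_max_at c (S t) y].

Definition property3b (d : nat) (S : nat -> set 'rV[nat]_d) : Prop :=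
  forall k : nat,
  (exists2 x : 'I_k -> nat -> 'rV[nat]_d,
     forall t : nat, `I_k #<= S t ->
       injective (fun i => x i t) /\ forall i : 'I_k, S t (x i t) &
     forall (i : 'I_k) (j : 'I_d),
       eventually_quasi_polynomial (fun t => x i t 0 j)) /\
  eventually_periodic [set t | `I_k #<= S t].

Definition property4 (d : nat) (S : nat -> set 'rV[nat]_d) : Prop :=
  exists2 m : nat, (0 < m)%N &
  forall i : 'I_m,
  exists (n k : nat) (alpha : 'I_n -> rat)
    (q : 'I_n -> 'rV[{poly rat}]_d) (b : 'I_k -> 'rV[{poly rat}]_d) (T : nat),
  forall t : nat, (T <= t)%N -> t = i %[mod m] ->
  exists (qt : 'I_n -> 'rV[int]_d) (bt : 'I_k -> 'rV[int]_d),
    [/\ forall j : 'I_n, has_value (q j) t (qt j),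
        forall l : 'I_k, has_value (b l) t (bt l),
        forall l : 'I_k, lex_positive (bt l) &
        generating_function (S t) =1 rational_expansion alpha qt bt].

(* Main.v *)
Require Import Defs.
From HB Require Import structures.
From mathcomp Require Import all_boot all_order all_algebra.
From mathcomp Require Import boolp classical_sets functions cardinality fsbigop.
From mathcomp Require Import zify ring.

(** Idea. A family satisfying (a) or (b) is shown to be, on each residue class
    [t = V s + c] and for large [s], a finite disjoint union of pieces
    [{q + sum_i m_i w_i + sum_l n_l v_l | sum_i m_i = M}], injectively
    parametrised by naturals [m_i, n_l], where [q, w_i, v_l, M] are integer
    polynomials in [s] and [M] is unbounded (predicate [NF]); all six
    properties can be read off such a normal form.

    In case (b), quantifiers are removed by Cooper's elimination, which only
    creates congruences with constant moduli.  A boolean combination of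
    inequalities and congruences splits, with slack variables, into systems
    [x >= 0, x A(t) = b(t)].  Gordan's alternative over the germs at infinity of
    integer polynomials gives either a polynomial bound on the unbounded
    coordinates or a polynomial direction [g >= 0] with [g A = 0]; in the second
    case each solution is uniquely a multiple of [g] plus a solution not above
    [g], and those have one more bounded coordinate.  Polynomially bounded
    solutions are written in base [t]: the carries take finitely many values, so
    the digits form the fibre over [t] of a system with constant coefficients.
    Such a system is a finite disjoint union of freely generated cones, by the
    same induction, and its fibres are dilated simplices.

    For Property 4, [(x^w - x^w') h_M] is a difference of two complete
    homogeneous sums in fewer variables, so finitely many operators [1 - x^b]
    turn the series of a piece into a Laurent polynomial; a linear form positive
    on all the [b] makes these operators injective. *)

Set Implicit Arguments.
Unset Strict Implicit.
Unset Printing Implicit Defensive.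

Import Order.TTheory GRing.Theory Num.Theory.
Local Open Scope classical_set_scope.
Local Open Scope card_scope.
Local Open Scope ring_scope.

(** * Eventual positivity and Gordan's alternative *)

(** Since [M] tends to infinity, for large [s] every piece is inhabited, has several points exactly
    when it has a free generator or a second simplex generator, and is infinite exactly when it has
    a free generator. Hence nonemptiness, finiteness and lower bounds on the cardinality are
    eventually constant on each residue class.

    Periods arise at one place: once the generators of a cone are scaled to a common weight [V], the
    cone meets the height [t] only for [t] in one class modulo [V].

    Constant coefficients matter in case (b) because an eliminated quantifier becomes a disjunction
    whose length is proportional to the coefficient of the bound variable; a coefficient growing
    with [t] would leave no single finite formula.

    Writing solutions in base [t] presupposes a polynomial bound on every coordinate, so the
    unbounded directions have to be split off before. Germs of integer polynomials form an ordered
    ring without division, and the alternative is proved inside that ring so that the direction [g]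
    is integral at every [t]. *)

Definition ev (P : nat -> Prop) : Prop :=
  exists T : nat, forall t : nat, (T <= t)%N -> P t.

Lemma evT (P : nat -> Prop) : (forall t, P t) -> ev P.
Proof. by move=> h; exists 0%N. Qed.

Lemma ev_mono (P Q : nat -> Prop) : (forall t, P t -> Q t) -> ev P -> ev Q.
Proof. by move=> h [T hT]; exists T => t /hT /h. Qed.

Lemma ev_and (P Q : nat -> Prop) : ev P -> ev Q -> ev (fun t => P t /\ Q t).
Proof.
move=> [T1 h1] [T2 h2]; exists (maxn T1 T2) => t; rewrite geq_max.
by case/andP=> /h1 ? /h2.
Qed.

Lemma ev2 (P Q R : nat -> Prop) :
  (forall t, P t -> Q t -> R t) -> ev P -> ev Q -> ev R.
Proof. by move=> h hP hQ; apply: ev_mono (ev_and hP hQ) => t [/h]. Qed.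

Lemma ev_all (I : eqType) (r : seq I) (P : I -> nat -> Prop) :
  (forall i, i \in r -> ev (P i)) ->
  ev (fun t => forall i, i \in r -> P i t).
Proof.
elim: r => [|i r IH] h; first exact: evT.
have hi : ev (P i) by apply: h; rewrite inE eqxx.
have hr : ev (fun t => forall i, i \in r -> P i t).
  by apply: IH => j jr; apply: h; rewrite inE jr orbT.
apply: ev2 hi hr => t hi hr j; rewrite inE => /orP[/eqP->//|]; exact: hr.
Qed.

Lemma ev_forall (I : finType) (P : I -> nat -> Prop) :
  (forall i, ev (P i)) -> ev (fun t => forall i, P i t).
Proof.
move=> h; have := @ev_all I (enum I) P (fun i _ => h i).
by apply: ev_mono => t ht i; apply: ht; rewrite mem_enum.
Qed.

Lemma ev_ge (C : nat) : ev (fun t => (C <= t)%N).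
Proof. by exists C. Qed.

Lemma ev_affine (a b : nat) (P : nat -> Prop) :
  (0 < a)%N -> ev P -> ev (fun s => P (a * s + b)%N).
Proof.
move=> a0 [T hT]; exists T => s Ts; apply: hT.
by rewrite (leq_trans Ts) // (leq_trans _ (leq_addr _ _)) // leq_pmull.
Qed.

Definition pos (p : {poly int}) : Prop := ev (fun t => 0 < p.[t%:Z]).
Definition nonneg (p : {poly int}) : Prop := ev (fun t => 0 <= p.[t%:Z]).

(** Horner induction on [q * 'X + c]: once [q] takes a positive integer value and [t] exceeds the
    absolute value of [c], the product outweighs [c]. *)
Lemma lead_pos (p : {poly int}) : 0 < lead_coef p -> pos p.
Proof.
elim/poly_ind: p => [|q c IH]; first by rewrite lead_coef0 ltxx.
have [->|q0] := eqVneq q 0.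
  by rewrite mul0r add0r lead_coefC => c0; apply: evT => t; rewrite hornerC.
rewrite lead_coefDl; last first.
  rewrite size_mulX // (leq_ltn_trans (size_polyC_leq1 _)) //.
  by rewrite ltnS size_poly_gt0.
rewrite lead_coefMX => /IH hq.
apply: ev2 hq (ev_ge `|c|.+1) => t hq ht.
rewrite hornerMXaddC; nia.
Qed.

Lemma pos_trichotomy (p : {poly int}) : [\/ pos p, p = 0 | pos (- p)].
Proof.
case: (ltrgt0P (lead_coef p)) => [/lead_pos|h|/eqP].
- by constructor 1.
- by constructor 3; apply: lead_pos; rewrite lead_coefN oppr_gt0.
by rewrite lead_coef_eq0 => /eqP; constructor 2.
Qed.

Lemma pos_nonneg (p : {poly int}) : pos p -> nonneg p.
Proof. by apply: ev_mono => t /ltW. Qed.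

Lemma nonneg0 : nonneg 0.
Proof. by apply: evT => t; rewrite horner0. Qed.

Lemma nonnegD (p q : {poly int}) : nonneg p -> nonneg q -> nonneg (p + q).
Proof. by apply: ev2 => t; rewrite hornerD; exact: addr_ge0. Qed.

Lemma nonnegM (p q : {poly int}) : nonneg p -> nonneg q -> nonneg (p * q).
Proof. by apply: ev2 => t; rewrite hornerM; exact: mulr_ge0. Qed.

Lemma posM (p q : {poly int}) : pos p -> pos q -> pos (p * q).
Proof. by apply: ev2 => t; rewrite hornerM; exact: mulr_gt0. Qed.

Lemma posD_nonneg (p q : {poly int}) : pos p -> nonneg q -> pos (p + q).
Proof. by apply: ev2 => t; rewrite hornerD; exact: ltr_pwDl. Qed.

Lemma nonneg_sum (I : eqType) (r : seq I) (F : I -> {poly int}) :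
  (forall i, i \in r -> nonneg (F i)) -> nonneg (\sum_(i <- r) F i).
Proof.
move=> h; rewrite big_seq; apply: (big_ind nonneg) => //.
  exact: nonneg0.
exact: nonnegD.
Qed.

Lemma nonneg_sqr (p : {poly int}) : nonneg (p * p).
Proof. by apply: evT => t; rewrite hornerM -expr2 sqr_ge0. Qed.

Lemma pos_sqr (p : {poly int}) : p != 0 -> pos (p * p).
Proof.
case: (pos_trichotomy p) => [h _|->|h _].
- exact: posM.
- by rewrite eqxx.
by rewrite -mulrNN; exact: posM.
Qed.

Lemma pos_sum (I : eqType) (r : seq I) (F : I -> {poly int}) (j : I) :
  j \in r -> pos (F j) -> (forall i, i \in r -> nonneg (F i)) ->
  pos (\sum_(i <- r) F i).
Proof.
elim: r => // i r IH; rewrite inE big_cons => /orP[/eqP->|jr] pj hn.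
  apply: posD_nonneg => //; apply: nonneg_sum => k kr.
  by apply: hn; rewrite inE kr orbT.
rewrite addrC; apply: posD_nonneg.
  by apply: IH => // k kr; apply: hn; rewrite inE kr orbT.
by apply: hn; rewrite inE eqxx.
Qed.

Lemma poly_le_exp (p : {poly int}) : exists D : nat,
  ev (fun t => p.[t%:Z] < t%:Z ^+ D).
Proof.
exists (size p); have : pos ('X^(size p) - p).
  apply: lead_pos; rewrite lead_coefDl ?lead_coefXn //.
  by rewrite size_polyN size_polyXn.
by apply: ev_mono => t; rewrite hornerD hornerN hornerXn subr_gt0.
Qed.

Lemma rv_neq0 (R : nzRingType) n (v : 'rV[R]_n) : v != 0 -> exists k, v 0 k != 0.
Proof.
move=> v0; apply/existsP; apply: contraNT v0; rewrite negb_exists => /forallP h.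
by apply/eqP/rowP => k; rewrite mxE; apply/eqP; rewrite -[_ == _]negbK.
Qed.

Definition pdot (r : nat) (a y : 'rV[{poly int}]_r) : {poly int} :=
  \sum_k a 0 k * y 0 k.

Lemma pdotDl r (a b y : 'rV_r) : pdot (a + b) y = pdot a y + pdot b y.
Proof. by rewrite -big_split; apply: eq_bigr => k _; rewrite mxE mulrDl. Qed.

Lemma pdotZl r c (a y : 'rV_r) : pdot (c *: a) y = c * pdot a y.
Proof. by rewrite mulr_sumr; apply: eq_bigr => k _; rewrite mxE mulrA. Qed.

Lemma pdotC r (a y : 'rV_r) : pdot a y = pdot y a.
Proof. by apply: eq_bigr => k _; rewrite mulrC. Qed.

Lemma pdotDr r (a b y : 'rV_r) : pdot y (a + b) = pdot y a + pdot y b.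
Proof. by rewrite pdotC pdotDl !(pdotC y). Qed.

Lemma pdotZr r c (a y : 'rV_r) : pdot y (c *: a) = c * pdot y a.
Proof. by rewrite pdotC pdotZl (pdotC y). Qed.

(** Elimination of one vector [a j]. If [y] is positive on the others but [d], its value on [a j],
    is not positive, each [a i] is replaced by [- d * a i + e i * a j], which is orthogonal to [y].
    A relation among the new vectors expands to one among the old, the terms in [a j] being
    collected; a solution [y'] for the new vectors is repaired into one for the old. *)
Lemma gordan (I : eqType) (r : nat) (J : seq I) (a : I -> 'rV[{poly int}]_r) :
  uniq J ->
  (exists h : I -> {poly int},
    [/\ forall i, nonneg (h i), exists2 i, i \in J & pos (h i),
        forall i, i \notin J -> h i = 0 & \sum_(i <- J) h i *: a i = 0]) \/
  (exists y : 'rV_r, forall i, i \in J -> pos (pdot (a i) y)).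
Proof.
elim: J a => [|j J IH] a; first by right; exists 0.
move=> /= /andP[jJ uJ].
have [[h [hn [i iJ hi] h0 hs]]|[y hy]] := IH a uJ.
  left; exists h; split=> //.
  - by exists i => //; rewrite inE iJ orbT.
  - by move=> k; rewrite inE negb_or => /andP[_ /h0].
  - by rewrite big_cons h0 // scale0r add0r.
set d := pdot (a j) y.
have [dp|dn] : pos d \/ nonneg (- d).
  case: (pos_trichotomy d) => [|->|/pos_nonneg]; [by left| |by right].
  by right; rewrite oppr0; exact: nonneg0.
  right; exists y => i; rewrite inE => /orP[/eqP->|/hy] //.
pose e i := pdot (a i) y.
have [[h [hn [i iJ hi] h0 hs]]|[y' hy']] :=
  IH (fun i => (- d) *: a i + e i *: a j) uJ.
  left; exists (fun i => if i == j then \sum_(k <- J) h k * e k else - d * h i).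
  have hen k : k \in J -> nonneg (h k * e k).
    by move=> kJ; apply: nonnegM => //; apply: pos_nonneg; exact: hy.
  split.
  - by move=> k; case: ifP => _; [exact: nonneg_sum | exact: nonnegM].
  - exists j; rewrite ?inE ?eqxx //; apply: (pos_sum iJ) => //.
    by apply: posM => //; exact: hy.
  - move=> k; rewrite inE negb_or => /andP[/negPf-> /h0->].
    by rewrite mulr0.
  rewrite big_cons eqxx -[RHS]hs addrC scaler_suml -[RHS]addr0.
  under [in RHS]eq_bigr do rewrite scalerDr !scalerA.
  rewrite big_split /= addr0; congr (_ + _).
  apply: eq_big_seq => k kJ.
  have /negPf-> : k != j by apply: contraNneq jJ => <-.
  by rewrite mulrC.
have [aj0|aj0] := eqVneq (a j) 0.
  left; exists (fun i => if i == j then 1 else 0); split.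
  - move=> i; case: ifP => _; last exact: nonneg0.
    by apply: evT => t; rewrite hornerC.
  - exists j; rewrite ?inE ?eqxx //.
    by apply: evT => t; rewrite hornerC.
  - by move=> k; rewrite inE negb_or => /andP[/negPf->].
  rewrite big_cons aj0 scaler0 add0r big_seq big1 // => k kJ.
  have /negPf-> : k != j by apply: contraNneq jJ => <-.
  by rewrite scale0r.
(* [y2] is orthogonal to [a j], and its value on [a i] is that of [y'] on the modified vector, hence
   positive. *)
pose y2 := (- d) *: y' + pdot (a j) y' *: y.
(* Adding [a j] makes the value on [a j] positive but may disturb the others by [w], the product of
   [a i] and [a j]. As [1 + w * w] exceeds the absolute value of [w] and positive integer values are
   at least 1, the factor [N] on [y2] absorbs this. *)
pose N := 1 + \sum_(i <- J) pdot (a i) (a j) * pdot (a i) (a j).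
right; exists (N *: y2 + a j) => i; rewrite inE => /orP[/eqP->|iJ].
  have -> : pdot (a j) (N *: y2 + a j) = pdot (a j) (a j).
    by rewrite pdotDr pdotZr pdotDr !pdotZr -/d; ring.
  have [k ajk] := rv_neq0 aj0.
  rewrite /pdot -big_enum; apply: (pos_sum (j := k)); rewrite ?mem_enum //.
    exact: pos_sqr.
  by move=> l _; exact: nonneg_sqr.
have hN : nonneg (N - 1 - pdot (a i) (a j) * pdot (a i) (a j)).
  have -> : N - 1 - pdot (a i) (a j) * pdot (a i) (a j) =
      \sum_(k <- rem i J) pdot (a k) (a j) * pdot (a k) (a j).
    by rewrite /N (big_rem i) //=; ring.
  by apply: nonneg_sum => k _; exact: nonneg_sqr.
have := hy' i iJ; rewrite pdotDl !pdotZl -/(e i).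
have -> : - d * pdot (a i) y' + e i * pdot (a j) y' = pdot (a i) y2.
  by rewrite pdotDr !pdotZr -/(e i); ring.
move=> hp; rewrite pdotDr pdotZr.
move: (pdot _ y2) (pdot (a i) _) N hN hp => u v w hN hp.
apply: ev2 hp hN => t; rewrite !(hornerD, hornerM, hornerN, hornerC).
move: u.[_] v.[_] w.[_] => {}u {}v {}w u0 h.
have w0 : 0 <= w by nia.
have wu : w <= w * u by nia.
by nia.
Qed.

(** * Normal forms *)

Definition evm (t : nat) (m n : nat) (A : 'M[{poly int}]_(m, n)) :
  'M[int]_(m, n) := map_mx (horner_eval t%:Z) A.

Arguments evm t {m n} A.

Lemma evmE t m n (A : 'M_(m, n)) i j : evm t A i j = (A i j).[t%:Z].
Proof. by rewrite mxE. Qed.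

Lemma evmM t m n k (A : 'M_(m, n)) (B : 'M_(n, k)) :
  evm t (A *m B) = evm t A *m evm t B.
Proof. exact: map_mxM. Qed.

Lemma evmD t m n (A B : 'M_(m, n)) : evm t (A + B) = evm t A + evm t B.
Proof. exact: map_mxD. Qed.

Lemma evmN t m n (A : 'M_(m, n)) : evm t (- A) = - evm t A.
Proof. exact: map_mxN. Qed.

Lemma evm0 t m n : evm t (0 : 'M_(m, n)) = 0.
Proof. exact: map_mx0. Qed.

Lemma evm1 t n : evm t (1%:M : 'M_n) = 1%:M.
Proof. exact: map_mx1. Qed.

Lemma evmC t m n (A : 'M[int]_(m, n)) : evm t (map_mx polyC A) = A.
Proof. by apply/matrixP => i j; rewrite !mxE /horner_eval hornerC. Qed.

Fixpoint lc n (ms : seq nat) (ws : seq 'rV[int]_n) : 'rV[int]_n :=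
  match ms, ws with
  | m :: ms', w :: ws' => w *+ m + lc ms' ws'
  | _, _ => 0
  end.

(* ((base, simplex generators), free generators, size of the simplex) *)
Definition piece (R : nzRingType) (n : nat) : Type :=
  ('rV[R]_n * seq 'rV[R]_n * seq 'rV[R]_n * R)%type.

HB.instance Definition _ (R : nzRingType) (n : nat) :=
  Equality.on (piece R n).

Section PieceDefs.
Variables (R : nzRingType) (n : nat).
Definition base (p : piece R n) : 'rV[R]_n := p.1.1.1.
Definition simp (p : piece R n) : seq 'rV[R]_n := p.1.1.2.
Definition free (p : piece R n) : seq 'rV[R]_n := p.1.2.
Definition psize (p : piece R n) : R := p.2.
End PieceDefs.

Definition valid n (c : piece int n) (ms ns : seq nat) : Prop :=
  [/\ size ms = size (simp c), size ns = size (free c) &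
      (sumn ms)%:Z = psize c].

Definition ppoint n (c : piece int n) (ms ns : seq nat) : 'rV[int]_n :=
  base c + lc ms (simp c) + lc ns (free c).

Definition inp n (c : piece int n) : set 'rV[int]_n :=
  fun x => exists ms ns, valid c ms ns /\ x = ppoint c ms ns.

Definition pinj n (c : piece int n) : Prop :=
  forall ms ns ms' ns', valid c ms ns -> valid c ms' ns' ->
    ppoint c ms ns = ppoint c ms' ns' -> ms = ms' /\ ns = ns'.

(** The equation between indicators says covering and disjointness at once, and sums directly into
    cardinalities and generating functions. *)
Definition rep n (cs : seq (piece int n)) (A : set 'rV[int]_n) : Prop :=
  (forall x, `[<A x>] = \sum_(c <- cs) `[<inp c x>] :> nat)%N /\
  (forall c, c \in cs -> pinj c).

Section Rep.
Variable n : nat.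
Implicit Types (x y g : 'rV[int]_n) (A B : set 'rV[int]_n).
Implicit Types (c : piece int n) (cs : seq (piece int n)).

Lemma rep_in cs A c x : rep cs A -> c \in cs -> inp c x -> A x.
Proof.
move=> [hA _] ccs cx.
have := hA x; rewrite (big_rem c) //= (asboolT cx) /=.
by case: (asboolP (A x)) => // _; rewrite add1n.
Qed.

Lemma rep_ex cs A x : rep cs A -> A x -> exists2 c, c \in cs & inp c x.
Proof.
move=> [hA _] Ax; have := hA x; rewrite asboolT //= => h.
have : has (fun c => `[<inp c x>]) cs.
  rewrite has_count -sum1_count big_mkcond /=.
  rewrite (eq_bigr (fun c => nat_of_bool `[<inp c x>])) -?h //.
by case/hasP => c ccs /asboolP; exists c.
Qed.

Lemma rep_nil A : (forall x, ~ A x) -> rep [::] A.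
Proof. by move=> h; split=> // x; rewrite big_nil asboolF. Qed.

Lemma rep_cat cs cs' A A' B : rep cs A -> rep cs' A' ->
  (forall x, B x <-> A x \/ A' x) -> (forall x, A x -> A' x -> False) ->
  rep (cs ++ cs') B.
Proof.
move=> [hA iA] [hA' iA'] BE dis; split.
  move=> x; rewrite big_cat /= -hA -hA'.
  case: (asboolP (A x)) => a; case: (asboolP (A' x)) => a'.
  - by have := dis x a a'.
  - by rewrite asboolT // BE; left.
  - by rewrite asboolT // BE; right.
  - by rewrite asboolF // BE => -[].
by move=> c; rewrite mem_cat => /orP[/iA|/iA'].
Qed.

Lemma rep_ext cs A B : (forall x, A x <-> B x) -> rep cs A -> rep cs B.
Proof. by move=> h; have -> : A = B by apply/predeqP. Qed.

End Rep.

(** Common core of affine images and of adding a free generator. A point of [B] comes from a single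
    point of [A], so the indicators of the pieces at both points agree term by term. *)
Lemma rep_map n k (cs : seq (piece int n)) (A : set 'rV[int]_n)
    (B : set 'rV[int]_k) (F : piece int n -> piece int k)
    (r : 'rV[int]_n -> 'rV[int]_k -> Prop) :
  rep cs A ->
  (forall x, B x <-> exists2 y, A y & r y x) ->
  (forall y y' x, A y -> A y' -> r y x -> r y' x -> y = y') ->
  (forall c x, inp (F c) x <-> exists2 y, inp c y & r y x) ->
  (forall c, c \in cs -> pinj (F c)) ->
  rep (map F cs) B.
Proof.
move=> hr BE rinj FE Finj; split; last first.
  by move=> p /mapP[c ccs ->]; exact: Finj.
move=> x; rewrite big_map; case: (asboolP (B x)) => [/BE[y Ay ryx]|nBx].
  have := hr.1 y; rewrite asboolT // => ->.
  apply: eq_big_seq => c ccs; congr nat_of_bool; apply: asbool_equiv_eq.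
  rewrite FE; split=> [cy|[y' cy' ry']]; first by exists y.
  by rewrite (rinj y y' x) //; exact: rep_in hr ccs cy'.
rewrite big_seq big1 // => c ccs; rewrite asboolF // => /FE[y cy ryx].
by apply/nBx/BE; exists y => //; exact: rep_in hr ccs cy.
Qed.

Definition pimg (R : nzRingType) n k (q : 'rV[R]_k) (W : 'M[R]_(n, k))
    (p : piece R n) : piece R k :=
  (q + base p *m W, map (mulmx^~ W) (simp p), map (mulmx^~ W) (free p), psize p).

Definition pgen (R : nzRingType) n (g : 'rV[R]_n) (p : piece R n) : piece R n :=
  (base p, simp p, g :: free p, psize p).

Lemma mulmxMnl m n k (A : 'M[int]_(m, n)) (W : 'M[int]_(n, k)) i :
  (A *+ i) *m W = (A *m W) *+ i.
Proof. by elim: i => [|i IH]; rewrite ?mulr0n ?mul0mx // !mulrS mulmxDl IH. Qed.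

Lemma lc_mulmx n k (W : 'M[int]_(n, k)) ms ws :
  lc ms (map (mulmx^~ W) ws) = lc ms ws *m W.
Proof.
elim: ws ms => [|w ws IH] [|m ms] //=; rewrite ?mul0mx //.
by rewrite IH mulmxDl mulmxMnl.
Qed.

Lemma rep_img n k (cs : seq (piece int n)) A (B : set 'rV[int]_k) q W :
  rep cs A ->
  (forall x, B x <-> exists2 y, A y & x = q + y *m W) ->
  (forall y y', A y -> A y' -> y *m W = y' *m W -> y = y') ->
  rep (map (pimg q W) cs) B.
Proof.
move=> hr BE inj.
have vE c ms ns : valid (pimg q W c) ms ns <-> valid c ms ns.
  by rewrite /valid /= !size_map.
have pE c ms ns : ppoint (pimg q W c) ms ns = q + ppoint c ms ns *m W.
  by rewrite /ppoint /= !lc_mulmx !mulmxDl !addrA.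
apply: (rep_map (r := fun y x => x = q + y *m W) hr BE).
- move=> y y' x Ay Ay' -> /addrI h; exact: inj.
- move=> c x; split=> [[ms [ns [/vE v ->]]]|[y [ms [ns [v ->]]] ->]].
    by rewrite pE; exists (ppoint c ms ns) => //; exists ms, ns.
  by exists ms, ns; rewrite pE vE.
move=> c ccs ms ns ms' ns' /vE v /vE v'; rewrite !pE => /addrI h.
apply: (hr.2 c ccs _ _ _ _ v v'); apply: inj h; apply: (rep_in hr ccs).
  by exists ms, ns.
by exists ms', ns'.
Qed.

Lemma rep_gen n (cs : seq (piece int n)) A B g :
  rep cs A ->
  (forall x, B x <-> exists2 y, A y & exists k, x = y + g *+ k) ->
  (forall y y' k k', A y -> A y' -> y + g *+ k = y' + g *+ k' -> k = k') ->
  rep (map (pgen g) cs) B.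
Proof.
move=> hr BE inj.
have pE c ms k ns : ppoint (pgen g c) ms (k :: ns) = ppoint c ms ns + g *+ k.
  by rewrite /ppoint /=; rewrite -!addrA [g *+ k + _]addrC.
apply: (rep_map (r := fun y x => exists k, x = y + g *+ k) hr BE).
- move=> y y' x Ay Ay' [k ->] [k' h]; have kk := inj _ _ _ _ Ay Ay' h.
  by move: h; rewrite kk => /addIr.
- move=> c x; split.
    move=> [ms [[|k ns] [[//= v1 [v2] v3] ->]]].
    exists (ppoint c ms ns); first by exists ms, ns.
    by exists k; rewrite pE.
  move=> [y [ms [ns [[v1 v2 v3] ->]]] [k ->]].
  by exists ms, (k :: ns); rewrite pE /valid /= v2.
move=> c ccs ms [|k ns] ms' [|k' ns'] [//= v1 [v2] v3] [//= w1 [w2] w3].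
rewrite !pE => h.
have A1 : A (ppoint c ms ns) by apply: (rep_in hr ccs); exists ms, ns.
have A2 : A (ppoint c ms' ns') by apply: (rep_in hr ccs); exists ms', ns'.
have kk := inj _ _ _ _ A1 A2 h; move: h; rewrite kk => /addIr h.
have v : valid c ms ns by split.
have w : valid c ms' ns' by split.
by have [-> ->] := hr.2 c ccs _ _ _ _ v w h.
Qed.

Definition pev n (s : nat) (p : piece {poly int} n) : piece int n :=
  (evm s (base p), map (evm s) (simp p), map (evm s) (free p), (psize p).[s%:Z]).

(** A piece without simplex generators has total multiplicity 0, so it would be empty at every
    positive size; the two conditions together make the piece eventually inhabited. *)
Definition okp n (p : piece {poly int} n) : Prop :=
  (simp p != [::]) /\ forall C : int, ev (fun s => C <= (psize p).[s%:Z]).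

Definition NF1 n (S : nat -> set 'rV[int]_n) : Prop :=
  exists2 ps : seq (piece {poly int} n), forall p, p \in ps -> okp p &
    ev (fun s => rep (map (pev s) ps) (S s)).

Definition NF n (S : nat -> set 'rV[int]_n) : Prop :=
  exists2 V : nat, (0 < V)%N &
    forall c, (c < V)%N -> NF1 (fun s => S (V * s + c)%N).

Lemma pev_img n k s q (W : 'M_(n, k)) p :
  pev s (pimg q W p) = pimg (evm s q) (evm s W) (pev s p).
Proof.
rewrite /pev /pimg /=; congr (_, _, _, _).
- by rewrite evmD evmM.
- by rewrite -!map_comp; apply: eq_map => w /=; rewrite evmM.
- by rewrite -!map_comp; apply: eq_map => w /=; rewrite evmM.
Qed.

Lemma evm_comp s m n (A : 'M[{poly int}]_(m, n)) (p : {poly int}) (u : nat) :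
  p.[s%:Z] = u%:Z -> evm s (map_mx (fun r => r \Po p) A) = evm u A.
Proof.
by move=> h; apply/matrixP => i j; rewrite !mxE /horner_eval horner_comp h.
Qed.

Section NFclosure.
Variable n : nat.
Implicit Types (S : nat -> set 'rV[int]_n).

Lemma NF1_ext S S' : ev (fun s => forall x, S s x <-> S' s x) -> NF1 S -> NF1 S'.
Proof.
move=> hS [ps ok hr]; exists ps => //; apply: ev2 hS hr => s; exact: rep_ext.
Qed.

Lemma NF_ext S S' : ev (fun t => forall x, S t x <-> S' t x) -> NF S -> NF S'.
Proof.
move=> hS [V V0 h]; exists V => // c cV; apply: NF1_ext (h c cV).
exact: ev_affine V0 hS.
Qed.

Lemma NF1_affine S (a b : nat) : (0 < a)%N -> NF1 S ->
  NF1 (fun s => S (a * s + b)%N).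
Proof.
move=> a0 [ps ok hr].
pose l : {poly int} := a%:Z%:P * 'X + b%:Z%:P.
have lE s : l.[s%:Z] = (a * s + b)%N%:Z by rewrite !hornerE.
pose co m k (A : 'M[{poly int}]_(m, k)) := map_mx (fun r => r \Po l) A.
pose F (p : piece {poly int} n) : piece {poly int} n :=
  (co _ _ (base p), map (co _ _) (simp p), map (co _ _) (free p), psize p \Po l).
exists (map F ps).
  move=> _ /mapP[p /ok[p1 p2] ->]; split; first by rewrite -size_eq0 size_map size_eq0.
  move=> C; apply: ev_mono (ev_affine b a0 (p2 C)) => s.
  by rewrite /= horner_comp lE.
apply: ev_mono (ev_affine b a0 hr) => s; congr rep.
rewrite -map_comp; apply: eq_map => p.
rewrite /pev /F /=; congr (_, _, _, _).
- by rewrite (evm_comp _ (lE s)).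
- by rewrite -map_comp; apply: eq_map => w /=; rewrite (evm_comp _ (lE s)).
- by rewrite -map_comp; apply: eq_map => w /=; rewrite (evm_comp _ (lE s)).
- by rewrite horner_comp lE.
Qed.

Lemma NF_refine S : NF S -> exists2 V : nat, (0 < V)%N &
  forall W : nat, (0 < W)%N -> (V %| W)%N ->
  forall c, NF1 (fun s => S (W * s + c)%N).
Proof.
move=> [V V0 h]; exists V => // W W0 /dvdnP[k Wk] c.
have k0 : (0 < k)%N by move: W0; rewrite Wk muln_gt0 => /andP[].
have := NF1_affine (c %/ V) k0 (h (c %% V)%N (ltn_pmod _ V0)).
apply: NF1_ext; apply: evT => s x.
suff -> : (V * (k * s + c %/ V) + c %% V = W * s + c)%N by [].
by rewrite Wk mulnDr -addnA mulnC [(V * (_ %/ _))%N]mulnC -divn_eq; lia.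
Qed.

Lemma NF_empty S : ev (fun t => forall x, ~ S t x) -> NF S.
Proof.
move=> h; exists 1%N => // c _; exists [::] => //.
apply: ev_mono (ev_affine c (isT : (0 < 1)%N) h) => s; exact: rep_nil.
Qed.

Lemma NF_union S S1 S2 : NF S1 -> NF S2 ->
  ev (fun t => forall x, S t x <-> S1 t x \/ S2 t x) ->
  ev (fun t => forall x, S1 t x -> S2 t x -> False) -> NF S.
Proof.
move=> /NF_refine[V1 V10 h1] /NF_refine[V2 V20 h2] hS hd.
have W0 : (0 < V1 * V2)%N by rewrite muln_gt0 V10.
exists (V1 * V2)%N => // c _.
have [ps1 ok1 r1] := h1 _ W0 (dvdn_mulr _ (dvdnn _)) c.
have [ps2 ok2 r2] := h2 _ W0 (dvdn_mull _ (dvdnn _)) c.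
exists (ps1 ++ ps2); first by move=> p; rewrite mem_cat => /orP[/ok1|/ok2].
have hS' := ev_affine c W0 hS; have hd' := ev_affine c W0 hd.
apply: ev2 (ev_and r1 r2) (ev_and hS' hd') => s [a1 a2] [b1 b2].
by rewrite map_cat; exact: rep_cat a1 a2 b1 b2.
Qed.

End NFclosure.

Lemma NF_img n k (S : nat -> set 'rV[int]_n) (S' : nat -> set 'rV[int]_k) q W :
  NF S ->
  ev (fun t => forall x, S' t x <-> exists2 y, S t y & x = evm t q + y *m evm t W) ->
  ev (fun t => forall y y', S t y -> S t y' ->
                 y *m evm t W = y' *m evm t W -> y = y') ->
  NF S'.
Proof.
move=> [V V0 h] hS inj; exists V => // c cV; have [ps ok r] := h c cV.
(* Composition with [l] turns data polynomial in [t] into data polynomial in [s], where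
   [t = V s + c]. *)
pose l : {poly int} := V%:Z%:P * 'X + c%:Z%:P.
have lE s : l.[s%:Z] = (V * s + c)%N%:Z by rewrite !hornerE.
exists (map (pimg (map_mx (fun r => r \Po l) q) (map_mx (fun r => r \Po l) W)) ps).
  move=> _ /mapP[p /ok[p1 p2] ->]; split => //.
  by rewrite -size_eq0 size_map size_eq0.
have hS' := ev_affine c V0 hS; have inj' := ev_affine c V0 inj.
apply: ev2 r (ev_and hS' inj') => s a [b1 b2].
rewrite -map_comp (eq_map (g := pimg (evm (V * s + c) q) (evm (V * s + c) W) \o pev s)).
  by rewrite map_comp; exact: rep_img a b1 b2.
by move=> p /=; rewrite pev_img !(evm_comp _ (lE s)).
Qed.

Lemma NF_gen n (S S' : nat -> set 'rV[int]_n) g :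
  NF S ->
  ev (fun t => forall x, S' t x <->
                 exists2 y, S t y & exists k, x = y + evm t g *+ k) ->
  ev (fun t => forall y y' k k', S t y -> S t y' ->
                 y + evm t g *+ k = y' + evm t g *+ k' -> k = k') ->
  NF S'.
Proof.
move=> [V V0 h] hS inj; exists V => // c cV; have [ps ok r] := h c cV.
pose l : {poly int} := V%:Z%:P * 'X + c%:Z%:P.
have lE s : l.[s%:Z] = (V * s + c)%N%:Z by rewrite !hornerE.
exists (map (pgen (map_mx (fun r => r \Po l) g)) ps).
  by move=> _ /mapP[p /ok[p1 p2] ->].
have hS' := ev_affine c V0 hS; have inj' := ev_affine c V0 inj.
apply: ev2 r (ev_and hS' inj') => s a [b1 b2].
rewrite -map_comp (eq_map (g := pgen (evm (V * s + c) g) \o pev s)).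
  by rewrite map_comp; exact: rep_gen a b1 b2.
by move=> p /=; rewrite /pev /pgen /= !(evm_comp _ (lE s)).
Qed.

(** The fibres of [h] over the fixed finite list [r] are split off one at a time by disjoint unions.
    [Phi] is left abstract because the splitting of polyhedra below runs for two different classes
    of families. *)
Lemma fibers_ind n (Phi : (nat -> set 'rV[int]_n) -> Prop) (I : eqType)
    (S : nat -> set 'rV[int]_n) (h : nat -> 'rV[int]_n -> I) (r : seq I) :
  (forall S S1 S2, Phi S1 -> Phi S2 ->
     ev (fun t => forall x, S t x <-> S1 t x \/ S2 t x) ->
     ev (fun t => forall x, S1 t x -> S2 t x -> False) -> Phi S) ->
  (forall S, ev (fun t => forall x, ~ S t x) -> Phi S) ->
  ev (fun t => forall x, S t x -> h t x \in r) ->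
  (forall i, i \in r -> Phi (fun t x => S t x /\ h t x = i)) ->
  Phi S.
Proof.
move=> PU P0; elim: r S => [|i r IH] S hr hP.
  by apply: P0; apply: ev_mono hr => t ht x /ht.
have hi := hP i (mem_head _ _).
apply: (PU _ _ (fun t x => S t x /\ h t x <> i) hi).
- apply: IH.
    apply: ev_mono hr => t ht x [/ht]; rewrite inE => /orP[/eqP|] //.
  move=> j jr; have [ji|ji] := eqVneq j i.
    by apply: P0; apply: evT => t x [[_ h1 h2]]; apply: h1; rewrite h2.
  suff -> : (fun t x => (S t x /\ h t x <> i) /\ h t x = j) =
    (fun t x => S t x /\ h t x = j) by apply: hP; rewrite inE jr orbT.
  apply/funext => t; apply/predeqP => x /=; split=> [[[]]|[Sx hx]] //.
  by split=> //; split=> //; rewrite hx; exact/eqP.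
- apply: evT => t x; split=> [Sx|[[]|[]]] //.
  by have [|] := eqVneq (h t x) i; [left | right; split => //; exact/eqP].
- by apply: evT => t x [_ ->] [_].
Qed.

Lemma NF_fibers n (I : eqType) (S : nat -> set 'rV[int]_n)
    (h : nat -> 'rV[int]_n -> I) (r : seq I) :
  ev (fun t => forall x, S t x -> h t x \in r) ->
  (forall i, i \in r -> NF (fun t x => S t x /\ h t x = i)) ->
  NF S.
Proof. apply: fibers_ind; [exact: NF_union | exact: NF_empty]. Qed.

(** * Splitting off unbounded directions *)

Section Decomposition.
Variables (n r : nat) (A : 'M[{poly int}]_(n, r)) (b : 'rV[{poly int}]_r).

(* The coordinates outside [J] are bounded above. *)
Definition polyhedron (J : seq 'I_n) (lo up : 'rV[{poly int}]_n) (t : nat) :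
    set 'rV[int]_n :=
  fun x => [/\ forall i, evm t lo 0 i <= x 0 i, x *m evm t A = evm t b &
               forall i, i \notin J -> x 0 i < evm t up 0 i].

(** Pairing the equation [x A = b] with [y] gives [sum x_i e_i = b.y]. The coefficients are positive
    on [J], and the remaining coordinates are already bounded, so each coordinate in [J] is bounded
    too. *)
Lemma polyhedron_bounded (J : seq 'I_n) (lo up : 'rV[{poly int}]_n) (y : 'rV[{poly int}]_r) :
  (forall i, nonneg (lo 0 i)) ->
  (forall i, i \in J -> pos (pdot (row i A) y)) ->
  exists up' : 'rV_n, ev (fun t => forall x,
    polyhedron J lo up t x <-> polyhedron [::] lo up' t x).
Proof.
move=> lo0 hy; pose e i := pdot (row i A) y.
(* Off [J] the sign of [e] is unknown. Integers satisfy [0 <= e + e^2], so [up * e^2] compensates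
   [x * e] whenever [0 <= x < up]; the final 1 makes the bound strict. *)
pose B := pdot b y + \sum_(i | i \notin J) up 0 i * e i ^+ 2 + 1.
exists (\row_i if i \in J then B else up 0 i).
have ep : ev (fun t => forall i, i \in J -> 0 < (e i).[t%:Z]) by exact: ev_all.
have lop : ev (fun t => forall i, 0 <= (lo 0 i).[t%:Z]) by exact: ev_forall.
apply: ev2 ep lop => t ep lop x; split; last first.
  move=> [h1 h2 h3]; split=> // i iJ; have := h3 i isT.
  by rewrite !evmE mxE (negPf iJ).
move=> [h1 h2 h3]; split=> // j _.
have [jJ|jJ] := boolP (j \in J); last first.
  by rewrite evmE mxE (negPf jJ) -evmE; exact: h3.
rewrite evmE mxE jJ.
have xp i : 0 <= x 0 i by apply: le_trans (h1 i); rewrite evmE.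
have sE : \sum_i x 0 i * (e i).[t%:Z] = (pdot b y).[t%:Z].
  rewrite /pdot horner_sum.
  have bE k : (b 0 k).[t%:Z] = \sum_i x 0 i * (A i k).[t%:Z].
    by rewrite -evmE -h2 mxE; apply: eq_bigr => i _; rewrite evmE.
  under [RHS]eq_bigr do rewrite hornerM bE mulr_suml.
  rewrite exchange_big /=; apply: eq_bigr => i _.
  rewrite horner_sum mulr_sumr; apply: eq_bigr => k _.
  by rewrite hornerM mxE mulrA.
rewrite 2!hornerD hornerC -sE horner_sum [X in _ + X + _]big_mkcond -big_split /=.
rewrite ltzD1 (bigD1 j) //= jJ /= addr0.
have xe : x 0 j <= x 0 j * (e j).[t%:Z] by have := ep j jJ; have := xp j; nia.
apply: le_trans xe _; rewrite lerDl; apply: sumr_ge0 => i _.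
have [iJ|iJ] := boolP (i \in J) => /=.
  by rewrite addr0 mulr_ge0 // ltW // ep.
have := h3 i iJ; have := xp i; rewrite evmE hornerM horner_exp.
move: (x 0 i) (up 0 i).[_] (e i).[_] => u v w u0 uv.
have w2 : 0 <= w + w * w by nia.
have := mulr_ge0 u0 w2; rewrite expr2.
have : 0 <= (v - u) * (w * w) by rewrite mulr_ge0 -?expr2 ?sqr_ge0 // subr_ge0 ltW.
by lia.
Qed.

Variable Phi : (nat -> set 'rV[int]_n) -> Prop.
Hypothesis Phi_ext : forall S S' : nat -> set 'rV[int]_n,
  ev (fun t => forall x, S t x <-> S' t x) -> Phi S -> Phi S'.
Hypothesis Phi_union : forall S S1 S2 : nat -> set 'rV[int]_n, Phi S1 -> Phi S2 ->
  ev (fun t => forall x, S t x <-> S1 t x \/ S2 t x) ->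
  ev (fun t => forall x, S1 t x -> S2 t x -> False) -> Phi S.
Hypothesis Phi_empty : forall S : nat -> set 'rV[int]_n,
  ev (fun t => forall x, ~ S t x) -> Phi S.
Hypothesis Phi_gen : forall (S S' : nat -> set 'rV[int]_n) g, Phi S ->
  ev (fun t => forall x, S' t x <->
                 exists2 y, S t y & exists k, x = y + evm t g *+ k) ->
  ev (fun t => forall y y' k k', S t y -> S t y' ->
                 y + evm t g *+ k = y' + evm t g *+ k' -> k = k') ->
  Phi S'.
Hypothesis Phi_bounded : forall lo up : 'rV[{poly int}]_n, (forall i, nonneg (lo 0 i)) ->
  Phi (polyhedron [::] lo up).

(** Induction on the number of coordinates without upper bound. Given a direction [g], the set [Q]
    of solutions from which [g] cannot be subtracted is cut up according to the first coordinate of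
    [J] that forbids the subtraction; that coordinate is then bounded above and leaves [J]. [Phi] is
    instantiated with eventual semilinearity for constant systems and with [NF] in general. *)
Lemma polyhedron_ind (J : seq 'I_n) (lo up : 'rV[{poly int}]_n) :
  uniq J -> (forall i, nonneg (lo 0 i)) -> Phi (polyhedron J lo up).
Proof.
have [m] := ubnP (size J); elim: m J lo up => // m IH J lo up Jm uJ lo0.
have [[h [hn [i0 i0J hi0] h0 hs]]|[y hy]] := gordan (fun i => row i A) uJ; last first.
  have [up' hup] := polyhedron_bounded up lo0 hy.
  apply: Phi_ext (Phi_bounded up' lo0).
  by apply: ev_mono hup => t hx x; split=> /hx.
pose g : 'rV[{poly int}]_n := \row_i h i.
have gA : g *m A = 0.
  rewrite mulmx_sum_row -[RHS]hs [in RHS]big_uniq // [RHS]big_mkcond /=.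
  apply: eq_bigr => i _; rewrite mxE; case: ifPn => // /h0->.
  by rewrite scale0r.
have hnt : ev (fun t => (forall i, 0 <= (h i).[t%:Z]) /\ 0 < (h i0).[t%:Z]).
  by apply: ev_and => //; exact: ev_forall.
pose low t (x : 'rV[int]_n) i := x 0 i < (lo 0 i + h i).[t%:Z].
pose Q t x := polyhedron J lo up t x /\ has (low t x) J.
have PQ : Phi Q.
  apply: (@fibers_ind _ _ _ Q (fun t x => find (low t x) J) (iota 0 (size J))) => //.
    by apply: evT => t x [_]; rewrite has_find mem_iota.
  move=> k; rewrite mem_iota /= add0n => kJ; pose i := nth i0 J k.
  have iJ : i \in J by exact: mem_nth.
  (* For the obstruction to come first at position [k], the coordinates earlier in [J] must stay
     above [lo + h], their new lower bound, while [i] must lie below it. *)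
  apply: Phi_ext (IH (rem i J)
    (\row_j if j \in take k J then lo 0 j + h j else lo 0 j)
    (\row_j if j == i then lo 0 i + h i else up 0 j) _ _ _); last first.
  - by move=> j; rewrite mxE; case: ifP => // _; exact: nonnegD.
  - exact: rem_uniq.
  - by rewrite size_rem //; move: Jm kJ; case: (size J) => //= ?; lia.
  apply: ev_mono hnt => t [ht _] x; split.
    move=> [h1 h2 h3].
    have xi : low t x i.
      have := h3 i; rewrite mem_rem_uniq // inE eqxx /= => /(_ isT).
      by rewrite evmE mxE eqxx.
    have Pk : polyhedron J lo up t x.
      split=> // j.
        apply: le_trans (h1 j); rewrite !evmE mxE; case: ifP => // _.
        by rewrite hornerD lerDl.
      move=> jJ; have := h3 j; rewrite mem_rem_uniq // inE (negPf jJ) andbF.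
      move=> /(_ isT); rewrite !evmE mxE; case: eqP => // ji.
      by rewrite ji iJ in jJ.
    split; first by split=> //; apply/hasP; exists i.
    have hk : (find (low t x) J <= k)%N.
      by rewrite leqNgt; apply/negP => /(before_find i0); rewrite -/i xi.
    have hf : (find (low t x) J < size J)%N by exact: leq_ltn_trans hk kJ.
    apply/eqP; rewrite eqn_leq hk /= leqNgt; apply/negP => fk.
    have : nth i0 J (find (low t x) J) \in take k J.
      by rewrite -(nth_take i0 fk) mem_nth // size_take kJ.
    have := nth_find i0 (a := low t x) (s := J); rewrite has_find hf => /(_ isT).
    move: (nth _ _ _) => j lj jk; have := h1 j.
    by rewrite evmE mxE jk leNgt -/(low t x j) lj.
  move=> [[[h1 h2 h3] hh] fk]; split=> // j.
    rewrite evmE mxE; case: ifP => [jk|_]; last by rewrite -evmE.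
    have jJ : (index j J < k)%N by rewrite -in_take // (mem_take jk).
    have := @before_find _ i0 (low t x) J (index j J); rewrite fk => /(_ jJ).
    by rewrite nth_index ?(mem_take jk) // /low ltNge => /negbFE.
  rewrite mem_rem_uniq // inE negb_and negbK => hj.
  rewrite evmE mxE; case: eqP hj => [-> _|_ /= jJ].
    by rewrite -/(low t x i) /i -fk nth_find.
  by rewrite -evmE; exact: h3.
apply: (Phi_gen (S := Q) (g := g)) => //; apply: ev_mono hnt => t [ht ht0].
  have gAt : evm t g *m evm t A = 0 by rewrite -evmM gA evm0.
  have gE i : evm t g 0 i = (h i).[t%:Z] by rewrite evmE mxE.
  have gk (k : nat) i : (evm t g *+ k) 0 i = (h i).[t%:Z] *+ k.
    by elim: k => [|k IHk]; rewrite ?mulr0n ?mxE // mulrS mxE IHk gE mulrS.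
  move=> x; split; last first.
    move=> [y [[h1 h2 h3] _] [k ->]]; split.
    - move=> i; rewrite [leRHS]mxE gk; apply: le_trans (h1 i) _.
      by rewrite lerDl mulrn_wge0.
    - by rewrite mulmxDl mulmxMnl gAt mul0rn addr0.
    - by move=> i iJ; rewrite [ltLHS]mxE gk h0 // horner0 mul0rn addr0; exact: h3.
  (* Repeated subtraction of [g] ends because it lowers the coordinate [i0], where [g] is
     positive. *)
  have [N] := ubnP (absz (x 0 i0 - (lo 0 i0).[t%:Z])%R).
  elim: N x => // N IHN x xN Px.
  have [hx|hx] := boolP (has (low t x) J).
    by exists x => //; exists 0%N; rewrite mulr0n addr0.
  have {}hx j : j \in J -> (lo 0 j + h j).[t%:Z] <= x 0 j.
    by move=> jJ; rewrite leNgt; apply: contra hx => lj; apply/hasP; exists j.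
  have [h1 h2 h3] := Px.
  have xgE i : (x - evm t g) 0 i = x 0 i - (h i).[t%:Z] by rewrite 2!mxE gE.
  case: (IHN (x - evm t g)).
  - apply: leq_trans _ (xN : (_ <= N)%N).
    have := hx i0 i0J; rewrite xgE hornerD; move: ht0.
    by move: (h i0).[_] (lo 0 i0).[_] (x 0 i0) => u v w; lia.
  - split.
    + move=> i; rewrite xgE; have [iJ|iJ] := boolP (i \in J).
        by have := hx i iJ; rewrite hornerD evmE lerBrDr.
      by rewrite h0 // horner0 subr0.
    + by rewrite mulmxBl gAt subr0.
    + by move=> i iJ; rewrite xgE h0 // horner0 subr0; exact: h3.
  - move=> y Qy [k xk]; exists y => //; exists k.+1.
    by rewrite mulrS addrCA -xk addrC subrK.
have gk (k : nat) i : (evm t g *+ k) 0 i = (h i).[t%:Z] *+ k.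
  by elim: k => [|k IHk]; rewrite ?mulr0n ?mxE // mulrS mxE IHk !mxE mulrS.
(* If [k < k'], then [y] is [y'] plus a positive multiple of [g], so it lies above [lo + h] on all
   of [J], against [y] being in [Q]. *)
have key y y' k k' : Q t y -> Q t y' ->
    y + evm t g *+ k = y' + evm t g *+ k' -> ~ (k < k')%N.
  move=> [_ /hasP[i iJ li]] [[h1 _ _] _] E kk.
  have := congr1 (fun z : 'rV_n => z 0 i) E; rewrite !mxE !gk.
  have := h1 i; rewrite evmE; move: li (ht i); rewrite /low hornerD.
  by move: (h i).[_] (lo 0 i).[_] (y 0 i) (y' 0 i) => u v w z; nia.
move=> y y' k k' Qy Qy' E.
case: (ltngtP k k') => // kk; first by case: (key _ _ _ _ Qy Qy' E).
by case: (key _ _ _ _ Qy' Qy (esym E)).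
Qed.

End Decomposition.

(** * Semilinear sets and their fibres *)

Lemma box_seq (n : nat) (C : nat) : exists L : seq 'rV[int]_n,
  forall x : 'rV[int]_n, (forall i, `|x 0 i| <= C%:Z) -> x \in L.
Proof.
exists [seq map_mx (fun k : 'I_(2 * C).+1 => k%:Z - C%:Z) v |
        v <- enum {: 'rV['I_(2 * C).+1]_n}].
move=> x hx; apply/mapP.
exists (map_mx (fun z : int => inord (absz (z + C%:Z))) x); first by rewrite mem_enum.
apply/rowP => i; rewrite !mxE; have := hx i; move: (x 0 i) => z hz.
by rewrite inordK; lia.
Qed.

(** With no simplex generators the size has to be 0 for the piece to be inhabited; what remains is a
    cone freely generated over its base. *)
Definition semilinear n (X : set 'rV[int]_n) : Prop :=
  exists2 cs, forall c, c \in cs -> simp c = [::] /\ psize c = 0 & rep cs X.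

Lemma semilinear_finite n (X : set 'rV[int]_n) (L : seq 'rV[int]_n) :
  (forall x, X x -> x \in L) -> semilinear X.
Proof.
move=> hL; pose cs : seq (piece int n) :=
  [seq (x, [::], [::], 0) | x <- undup [seq x <- L | `[<X x>]]].
exists cs; first by move=> _ /mapP[x _ ->].
have ptE y x : inp (y, [::], [::], 0) x <-> x = y.
  split=> [[[|? ?] [[|? ?] [[//= _ _ _] ->]]]|->].
    by rewrite /ppoint /= !addr0.
  by exists [::], [::]; split; rewrite /ppoint /= ?addr0.
split; last first.
  by move=> _ /mapP[x _ ->] [|? ?] [|? ?] [|? ?] [|? ?] [//= _ _ _] [].
move=> x; rewrite big_map.
rewrite (eq_bigr (fun y => nat_of_bool (pred1 x y))); last first.
  move=> y _; congr nat_of_bool; apply/asboolP/eqP; first by move/ptE.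
  by move=> ->; apply/ptE.
rewrite -(big_map (fun y => nat_of_bool (pred1 x y)) predT id) -sumnE.
rewrite sumn_count count_uniq_mem ?undup_uniq //.
rewrite mem_undup mem_filter; congr nat_of_bool.
by case: asboolP => //= /hL ->.
Qed.

(** The set does not depend on [t], so the induction for families is run on constant polynomials and
    read at one large [T]. Its base case is a bounded polyhedron, which for each [t] is a finite
    set. *)
Lemma semilinear_system n r (A : 'M[int]_(n, r)) (b : 'rV[int]_r) :
  semilinear (fun x => (forall i, 0 <= x 0 i) /\ x *m A = b).
Proof.
pose Phi (S : nat -> set 'rV[int]_n) := ev (fun t => semilinear (S t)).
have [||||||T /(_ T (leqnn T)) [cs h1 h2]] :=
  @polyhedron_ind n r (map_mx polyC A) (map_mx polyC b) Phi _ _ _ _ _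
    (enum 'I_n) 0 0 (enum_uniq _).
- move=> S S' hS; apply: ev2 hS => t hS [cs h1 h2].
  by exists cs => //; exact: rep_ext h2.
- move=> S S1 S2 hS1 hS2 h h'.
  apply: ev2 (ev_and hS1 hS2) (ev_and h h') => t [[c1 p1 r1] [c2 p2 r2]] [u d].
  exists (c1 ++ c2); last exact: rep_cat r1 r2 u d.
  by move=> c; rewrite mem_cat => /orP[/p1|/p2].
- by move=> S; apply: ev_mono => t h; exists [::] => //; exact: rep_nil.
- move=> S S' g hS h h'; apply: ev2 hS (ev_and h h') => t [cs p1 r1] [u d].
  exists (map (pgen (evm t g)) cs); last exact: rep_gen r1 u d.
  by move=> _ /mapP[c /p1 [? ?] ->].
- move=> lo up lo0; have : ev (fun t => forall i, 0 <= (lo 0 i).[t%:Z]).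
    exact: ev_forall.
  apply: ev_mono => t lot.
  have [L hL] := box_seq n (\sum_i absz (evm t up 0 i)%R)%N.
  apply: (@semilinear_finite _ _ L) => x [h1 _ h3]; apply: hL => i.
  have := h1 i; have := h3 i isT; have := lot i; rewrite -evmE.
  rewrite (bigD1 i) //=; move: (x 0 i) (evm t lo 0 i) (evm t up 0 i) => u v w.
  by move: (bigop _ _ _) => ?; lia.
- by move=> i; rewrite mxE; exact: nonneg0.
exists cs => //; apply: rep_ext h2 => x.
split=> [[h1' h2' _]|[h1' h2']].
  by split=> [i|]; [have := h1' i; rewrite evmE mxE horner0 | rewrite !evmC in h2'].
split=> [i||i]; [by rewrite evmE mxE horner0|by rewrite !evmC|].
by rewrite mem_enum.
Qed.

Definition cone n (u : 'rV[int]_n) (gs : seq 'rV[int]_n) : set 'rV[int]_n :=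
  fun x => exists2 ns, size ns = size gs & x = u + lc ns gs.

Definition indep n (gs : seq 'rV[int]_n) : Prop :=
  forall ns ns', size ns = size gs -> size ns' = size gs ->
    lc ns gs = lc ns' gs -> ns = ns'.

Lemma lc_cat n ns1 ns2 (gs1 gs2 : seq 'rV[int]_n) : size ns1 = size gs1 ->
  lc (ns1 ++ ns2) (gs1 ++ gs2) = lc ns1 gs1 + lc ns2 gs2.
Proof.
elim: gs1 ns1 => [|g gs1 IH] [|m ns1] //=; first by rewrite add0r.
by case=> /IH ->; rewrite addrA.
Qed.

Lemma size_cat_cons n (ns : seq nat) (gs1 gs2 : seq 'rV[int]_n) g :
  size ns = size (gs1 ++ g :: gs2) ->
  exists ns1 m ns2, [/\ ns = ns1 ++ m :: ns2, size ns1 = size gs1 & size ns2 = size gs2].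
Proof.
elim: gs1 ns => [|h gs1 IH] [|m ns] //=; first by case=> h; exists [::], m, ns.
by case=> /IH[ns1 [m' [ns2 [-> h1 h2]]]]; exists (m :: ns1), m', ns2; rewrite /= h1.
Qed.

(** * Subdividing a cone along one generator *)

Section Split.
Variables (n : nat) (gs1 gs2 : seq 'rV[int]_n) (g : 'rV[int]_n) (k : nat).
Hypotheses (k0 : (0 < k)%N) (ind : indep (gs1 ++ g :: gs2)).

Lemma cone_split_in u (r : nat) x :
  cone (u + g *+ r) (gs1 ++ (g *+ k) :: gs2) x ->
  exists ns1 m ns2, [/\ size ns1 = size gs1, size ns2 = size gs2 &
    x = u + lc (ns1 ++ (m * k + r)%N :: ns2) (gs1 ++ g :: gs2)].
Proof.
move=> [ns /size_cat_cons[ns1 [m [ns2 [-> s1 s2]]]] ->].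
exists ns1, m, ns2; split=> //; rewrite !lc_cat //= mulrnDr mulnC mulrnA.
rewrite -!addrA; congr (_ + _); rewrite [LHS]addrCA; congr (_ + _); exact: addrCA.
Qed.

Lemma indep_split : indep (gs1 ++ (g *+ k) :: gs2).
Proof.
move=> ns ns' /size_cat_cons[ns1 [m [ns2 [-> s1 s2]]]].
move=> /size_cat_cons[ns1' [m' [ns2' [-> s1' s2']]]].
have E a (b1 b2 : seq nat) : size b1 = size gs1 ->
    lc (b1 ++ a :: b2) (gs1 ++ (g *+ k) :: gs2) =
    lc (b1 ++ (k * a)%N :: b2) (gs1 ++ g :: gs2).
  by move=> h; rewrite !lc_cat //= mulrnA.
rewrite !E // => /ind; rewrite !size_cat /= s1 s2 s1' s2' => /(_ erefl erefl).
move=> /eqP; rewrite eqseq_cat ?s1 ?s1' // eqseq_cons eqn_pmul2l //.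
by move=> /and3P[/eqP-> /eqP-> /eqP->].
Qed.

Lemma cone_split_uniq u r r' x : (r < k)%N -> (r' < k)%N ->
  cone (u + g *+ r) (gs1 ++ (g *+ k) :: gs2) x ->
  cone (u + g *+ r') (gs1 ++ (g *+ k) :: gs2) x -> r = r'.
Proof.
move=> rk rk' /cone_split_in[ns1 [m [ns2 [s1 s2 ->]]]].
move=> /cone_split_in[ns1' [m' [ns2' [s1' s2' /addrI/ind]]]].
rewrite !size_cat /= s1 s2 s1' s2' => /(_ erefl erefl).
move=> /eqP; rewrite eqseq_cat ?s1 ?s1' // eqseq_cons.
move=> /and3P[_ /eqP h _]; move: (congr1 (modn^~ k) h).
by rewrite !modnMDl !modn_small.
Qed.

(** Division with remainder by [k] of the coefficient of [g]. This allows a generator to be replaced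
    by a multiple of itself, at the price of [k] cones, disjoint by independence. *)
Lemma cone_split u x : cone u (gs1 ++ g :: gs2) x <->
  exists2 r, (r < k)%N & cone (u + g *+ r) (gs1 ++ (g *+ k) :: gs2) x.
Proof.
split.
  move=> [ns /size_cat_cons[ns1 [m [ns2 [-> s1 s2]]]] ->].
  exists (m %% k)%N; first exact: ltn_pmod.
  exists (ns1 ++ (m %/ k)%N :: ns2); first by rewrite !size_cat /= s1 s2.
  rewrite !lc_cat //= {1}(divn_eq m k) mulrnDr mulnC mulrnA.
  by rewrite -!addrA; congr (_ + _); rewrite [RHS]addrCA; congr (_ + _); exact: addrCA.
move=> [r _ /cone_split_in[ns1 [m [ns2 [s1 s2 ->]]]]].
by exists (ns1 ++ (m * k + r)%N :: ns2); rewrite // !size_cat /= s1 s2.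
Qed.

End Split.

Definition fiber n (X : set 'rV[int]_(1 + n)) (t : nat) : set 'rV[int]_n :=
  fun y => X (row_mx (const_mx t%:Z) y).

Definition weight n (g : 'rV[int]_(1 + n)) : int := lsubmx g 0 0.

Lemma weight_cone n (V : nat) (u : 'rV[int]_(1 + n)) gs ns :
  (forall g, g \in gs -> weight g = V%:Z) -> size ns = size gs ->
  weight (u + lc ns gs) = weight u + (sumn ns * V)%N%:Z.
Proof.
move=> hg sz; rewrite /weight [lsubmx (_ + _)]raddfD mxE; congr (_ + _).
elim: gs ns hg sz => [|g gs IH] [|m ns] //= hg; first by rewrite raddf0 mxE.
case=> sz; rewrite raddfD mxE IH // => [|h hh]; last by apply: hg; rewrite inE hh orbT.
rewrite mulnDl PoszD; congr (_ + _).
have := hg g (mem_head _ _); rewrite /weight => gV.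
elim: m => [|m IHm]; first by rewrite mulr0n raddf0 mxE.
by rewrite mulrS raddfD mxE IHm gV mulSn PoszD.
Qed.

Lemma rsubmx_lc n ns (gs : seq 'rV[int]_(1 + n)) :
  rsubmx (lc ns gs) = lc ns (map rsubmx gs).
Proof.
elim: gs ns => [|g gs IH] [|m ns] /=; rewrite ?raddf0 //.
by rewrite raddfD /= raddfMn IH.
Qed.

(** The origin of the simplices: when all generators have weight [V], lying at height [V s + c] says
    that the coefficients add up to [s + q] with [q = (c - weight u) / V], and that there is no
    point when this quotient is not integral. *)
Lemma NF_fiber_uniform n (V : nat) (u : 'rV[int]_(1 + n)) gs : (0 < V)%N ->
  (forall g, g \in gs -> weight g = V%:Z) -> indep gs ->
  NF (fiber (cone u gs)).
Proof.
(* Without generators the cone is one point at a fixed height, which large [t] avoid. *)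
move=> V0 hg ind; have [gs0|gs0] := eqVneq gs [::].
  apply: NF_empty; exists (absz (weight u)).+1 => t ht y [[|? ?]].
    rewrite gs0 //= addr0 => _ /(congr1 (@weight n)).
    by rewrite {1}/weight row_mxKl mxE; lia.
  by rewrite gs0.
exists V => // c cV.
have coneE s y : fiber (cone u gs) (V * s + c)%N y <-> exists ns,
    [/\ size ns = size gs, (V * s + c)%N%:Z = weight u + (sumn ns * V)%N%:Z &
        y = rsubmx u + lc ns (map rsubmx gs)].
  split=> [[ns sz E]|[ns [sz E ->]]]; exists ns => //.
    split=> //.
      by move: (congr1 (@weight n) E); rewrite (weight_cone _ hg sz) {1}/weight row_mxKl mxE.
    by move: (congr1 rsubmx E); rewrite row_mxKr raddfD /= rsubmx_lc.
  rewrite -[RHS]hsubmxK [rsubmx (_ + _)]raddfD /= rsubmx_lc; congr row_mx.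
  by apply/matrixP => i j; rewrite !ord1 [LHS]mxE E -(weight_cone u hg sz).

have [/dvdzP[q hq]|nd] := boolP ((V%:Z %| c%:Z - weight u)%Z); last first.
  exists [::] => //; apply: evT => s; apply: rep_nil => y /coneE[ns [_ h _]].
  case/negP: nd; apply/dvdzP; exists ((sumn ns)%:Z - s%:Z).
  by move: h; rewrite PoszD !PoszM; lia.
pose p0 : piece {poly int} n :=
  (map_mx polyC (rsubmx u), map (map_mx polyC \o rsubmx) gs, [::], 'X + q%:P).
exists [:: p0].
  move=> p; rewrite inE => /eqP->; split.
    by rewrite -size_eq0 size_map size_eq0.
  by move=> C; exists (absz (C - q)) => s hs; rewrite /= hornerD hornerX hornerC; lia.
apply: evT => s; have pE : pev s p0 = (rsubmx u, map rsubmx gs, [::], s%:Z + q).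
  rewrite /pev /= evmC hornerD hornerX hornerC -map_comp; congr (_, _, _, _).
  by apply: eq_map => g /=; rewrite evmC.
have sE ns : (V * s + c)%N%:Z = weight u + (sumn ns * V)%N%:Z <->
    (sumn ns)%:Z = s%:Z + q.
  rewrite PoszD !PoszM; split=> h; last by rewrite h mulrDl; lia.
  have : (sumn ns)%:Z * V%:Z = (s%:Z + q) * V%:Z by lia.
  by move=> /mulIf; apply; lia.
rewrite (_ : [seq pev s i | i <- [:: p0]] = [:: pev s p0]) // pE; split.
  move=> y; rewrite big_seq1; congr nat_of_bool; apply: asbool_equiv_eq.
  rewrite coneE; split.
    move=> [ns [sz /sE h ->]]; exists ns, [::].
    by rewrite /ppoint /= addr0; split=> //; split=> //=; rewrite size_map.
  move=> [ns [[|? ?] [[//= sz _ /sE h] ->]]]; exists ns.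
  by rewrite /ppoint /= addr0; split=> //; rewrite sz size_map.
move=> c'; rewrite inE => /eqP-> ms [|? ?] ms' [|? ?] [//= s1 _ h1] [//= s2 _ h2].
rewrite /ppoint /= !addr0 => /addrI; rewrite size_map in s1 s2 => E.
(* Dropping the height coordinate loses nothing: equal coefficient sums already force equal
   heights. *)
split=> //; apply: ind => //; rewrite -[LHS]hsubmxK -[RHS]hsubmxK !rsubmx_lc E.
congr row_mx; apply/matrixP => i j; rewrite !ord1.
have := weight_cone 0 hg s1; have := weight_cone 0 hg s2.
have /eqP := etrans h1 (esym h2); rewrite eqz_nat => /eqP->.
by rewrite !add0r => <- h; move: h; rewrite /weight.
Qed.

(** [gs1] collects the generators already scaled to weight [V]. The next generator [g] is scaled by
    [k], and the resulting [k] cones are separated by the remainder of its coefficient. *)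
Lemma NF_fiber_cone n (V : nat) (u : 'rV[int]_(1 + n)) gs1 gs2 : (0 < V)%N ->
  (forall g, g \in gs1 -> weight g = V%:Z) ->
  (forall g, g \in gs2 -> exists2 k, (0 < k)%N & weight g *+ k = V%:Z) ->
  indep (gs1 ++ gs2) -> NF (fiber (cone u (gs1 ++ gs2))).
Proof.
move=> V0; elim: gs2 gs1 u => [|g gs2 IH] gs1 u h1 h2 ind.
  by rewrite cats0 in ind *; exact: NF_fiber_uniform V0 h1 ind.
have [k k0 hk] := h2 g (mem_head _ _).
pose P y r := `[< cone (u + g *+ r) (gs1 ++ (g *+ k) :: gs2) y >].
pose h t (y : 'rV[int]_n) := find (P (row_mx (const_mx t%:Z) y)) (iota 0 k).
have hP y r : (r < k)%N -> P y r -> find (P y) (iota 0 k) = r.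
  move=> rk yr; have hh : has (P y) (iota 0 k).
    by apply/hasP; exists r; rewrite ?mem_iota.
  have := hh; rewrite has_find size_iota => fk.
  have := nth_find 0%N hh; rewrite nth_iota // add0n => /asboolP yf.
  by move/asboolP: yr => yr; exact: (cone_split_uniq ind fk rk yf yr).
apply: (@NF_fibers _ _ _ h (iota 0 k)).
  apply: evT => t y /(cone_split gs1 gs2 g k0)[r rk /asboolP yr].
  by rewrite /h (hP _ r) // mem_iota.
move=> r; rewrite mem_iota /= add0n => rk.
apply: NF_ext (IH (rcons gs1 (g *+ k)) (u + g *+ r) _ _ _).
- apply: evT => t y; rewrite cat_rcons; split.
    move=> yr; split; first by apply/(cone_split gs1 gs2 g k0); exists r.
    by apply: hP => //; apply/asboolP.
  move=> [/(cone_split gs1 gs2 g k0)[r' rk' yr] hr].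
  by move: hr; rewrite /h (hP _ r') //; [move=> <- | apply/asboolP].
- move=> f; rewrite mem_rcons inE => /orP[/eqP->|/h1//].
  rewrite -hk /weight; elim: (k) => [|j IHj]; first by rewrite !mulr0n raddf0 mxE.
  by rewrite !mulrS raddfD mxE IHj.
- by move=> f fg; apply: h2; rewrite inE fg orbT.
- by rewrite cat_rcons; exact: indep_split.
Qed.

Lemma lc_nseq0 n k (gs : seq 'rV[int]_n) : lc (nseq k 0%N) gs = 0.
Proof. by elim: gs k => [|g gs IH] [|k] //=; rewrite IH mulr0n addr0. Qed.

Lemma rep_cons n (c : piece int n) cs X : rep (c :: cs) X ->
  [/\ pinj c, forall x, inp c x -> X x & rep cs (fun x => X x /\ ~ inp c x)].
Proof.
move=> h; split.
- by apply: h.2; exact: mem_head.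
- by move=> x; apply: (rep_in h); exact: mem_head.
split=> [x|c' c'cs]; last by apply: h.2; rewrite inE c'cs orbT.
have := h.1 x; rewrite big_cons.
case: (asboolP (X x)) => Xx; case: (asboolP (inp c x)) => cx /=.
- by rewrite asboolF => [[]|[_]] //; rewrite add1n => -[<-].
- by rewrite add0n => <-; rewrite asboolT.
- by rewrite add1n.
- by rewrite add0n => <-; rewrite asboolF // => -[].
Qed.

(** The hypothesis on rays applies to each generator of each cone, since the cone contains the ray
    that the generator spans from its base. All weights are then positive and have a common
    multiple; their product is used. *)
Lemma NF_fiber n (X : set 'rV[int]_(1 + n)) : semilinear X ->
  (forall x g, g != 0 -> (forall k, X (x + g *+ k)) -> 0 < weight g) ->
  NF (fiber X).
Proof.
move=> [cs]; elim: cs X => [|c cs IH] X hcs hr hX.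
  by apply: NF_empty; apply: evT => t y /(rep_ex hr)[].
have [ci cX hr'] := rep_cons hr.
apply: (NF_union (S1 := fiber (inp c)) (S2 := fiber (fun x => X x /\ ~ inp c x))).
- have [sc pc] := hcs c (mem_head _ _).
  have vE ns : valid c [::] ns <-> size ns = size (free c).
    by rewrite /valid sc pc /=; split=> [[]|].
  have ind : indep (free c).
    move=> ns ns' /vE v /vE v' E; have [|_ ->] := ci _ _ _ _ v v' => //.
    by rewrite /ppoint E.
  have inpE : inp c = cone (base c) (free c).
    apply/predeqP => x; rewrite /ppoint; split.
      move=> [[|? ?] [ns [[/=]]]]; rewrite sc // => _ sz _ ->; exists ns => //.
      by rewrite /ppoint sc /= addr0.
    move=> [ns sz ->]; exists [::], ns; split; first exact/vE.
    by rewrite /ppoint sc /= addr0.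
  have wpos g : g \in free c -> 0 < weight g.
    move=> gc; have [gs1 [gs2 E]] : exists gs1 gs2, free c = gs1 ++ g :: gs2.
      by case/splitPr: gc => gs1 gs2; exists gs1, gs2.
    have lcE k : lc (nseq (size gs1) 0%N ++ k :: nseq (size gs2) 0%N) (free c) = g *+ k.
      by rewrite E lc_cat ?size_nseq //= !lc_nseq0 add0r addr0.
    have szE k : size (nseq (size gs1) 0%N ++ k :: nseq (size gs2) 0%N) = size (free c).
      by rewrite E !size_cat /= !size_nseq.
    apply: (hX (base c)) => [|k].
      apply/eqP => g0; have := ind _ _ (szE 0%N) (szE 1%N).
      rewrite !lcE g0 !mul0rn => /(_ erefl) /eqP.
      by rewrite eqseq_cat ?size_nseq // eqseq_cons andbF.
    by apply: cX; rewrite inpE; exists (nseq (size gs1) 0%N ++ k :: nseq (size gs2) 0%N);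
      rewrite ?lcE.
  rewrite inpE; apply: (@NF_fiber_cone n (\prod_(g <- free c) absz (weight g)) _ [::]) => //.
    rewrite big_seq; apply: (big_ind (fun z : nat => (0 < z)%N)) => //.
      by move=> ? ?; rewrite muln_gt0 => -> ->.
    by move=> g /wpos; lia.
  move=> g gc; have g0 := wpos g gc.
  have Vw : (absz (weight g) %| \prod_(g <- free c) absz (weight g))%N.
    by rewrite (big_rem g gc) /= dvdn_mulr.
  have /dvdnP[k hk] := Vw; exists k; last by rewrite hk; lia.
  have : (0 < \prod_(g <- free c) absz (weight g))%N.
    rewrite big_seq; apply: (big_ind (fun z : nat => (0 < z)%N)) => //.
      by move=> ? ?; rewrite muln_gt0 => -> ->.
    by move=> f /wpos; lia.
  by rewrite hk muln_gt0 => /andP[].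
- by apply: IH => // [c' c'cs|x g g0 hg]; [apply: hcs; rewrite inE c'cs orbT|
    apply: (hX x g g0) => k; case: (hg k)].
- apply: evT => t y; split=> [Xy|[/cX|[]]] //.
  by case: (pselect (inp c (row_mx (const_mx t%:Z) y))); [left|right].
- by apply: evT => t y h [].
Qed.

(** * Bounded systems in base t *)

Lemma mulmx_col1 m n k (x : 'rV[int]_(m + n)) (B : 'M[int]_(m, k))
    (C : 'M[int]_(n, k)) :
  x *m col_mx B C = lsubmx x *m B + rsubmx x *m C.
Proof. by rewrite -{1}[x]hsubmxK mul_row_col. Qed.

Lemma ray_ge0 (x g : int) : (forall k, 0 <= x + g *+ k) -> 0 <= g.
Proof.
move=> h; have := h (absz x).+1; have := h 0%N; rewrite mulr0n.
by rewrite -mulr_natr; nia.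
Qed.

Lemma mxrowMn n (g : 'rV[int]_n) (k : nat) i : (g *+ k) 0 i = g 0 i *+ k.
Proof. by elim: k => [|k IH]; rewrite ?mulr0n ?mxE // !mulrS mxE IH. Qed.

(** The parameter becomes coordinate 0 of a system that no longer mentions it, and a slack vector
    [z] with [y + z = t - 1] expresses [y < t]. Because of the slack, a nonnegative direction of
    weight 0 must vanish, which is the ray condition of [NF_fiber]. *)
Lemma NF_constant_system n r (A : 'M[int]_(n, r)) (b b' : 'rV[int]_r) :
  NF (fun t (y : 'rV[int]_n) =>
        (forall i, 0 <= y 0 i < t%:Z) /\ y *m A = b + t%:Z *: b').
Proof.
pose M : 'M[int]_(1 + (n + n), r + n) :=
  col_mx (row_mx (- b') (const_mx (-1))) (block_mx A 1%:M 0 1%:M).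
pose be : 'rV[int]_(r + n) := row_mx b (const_mx (-1)).
pose X : set 'rV[int]_(1 + (n + n)) := fun x => (forall i, 0 <= x 0 i) /\ x *m M = be.
have ME (x : 'rV_(1 + (n + n))) : x *m M =
    row_mx (lsubmx (rsubmx x) *m A - weight x *: b')
           (lsubmx (rsubmx x) + rsubmx (rsubmx x) - const_mx (weight x)).
  rewrite mulmx_col1 -{1}[rsubmx x]hsubmxK mul_row_block mulmx0 addr0 !mulmx1.
  rewrite [lsubmx x]mx11_scalar -/(weight x) mul_scalar_mx scale_row_mx add_row_mx.
  rewrite scalerN addrC [X in row_mx _ X]addrC; congr (row_mx _ (_ + _)).
  by apply/rowP => i; rewrite !mxE mulrN1.
have Xpos x g : g != 0 -> (forall k, X (x + g *+ k)) -> 0 < weight g.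
  move=> g0 hX; have gp i : 0 <= g 0 i.
    by apply: (@ray_ge0 (x 0 i)) => k; have := (hX k).1 i; rewrite mxE mxrowMn.
  have gM : g *m M = 0.
    have := (hX 1%N).2; have := (hX 0%N).2.
    by rewrite mulr0n addr0 mulr1n mulmxDl => -> /(canRL (addKr _)); rewrite addNr.
  have wp : 0 <= weight g by rewrite /weight mxE.
  rewrite lt_neqAle wp andbT eq_sym; apply: contra_neq g0 => w0.
  move: gM; rewrite ME w0 -row_mx0 => /eq_row_mx[_ /rowP h].
  rewrite -[g]hsubmxK -[rsubmx g]hsubmxK [lsubmx g]mx11_scalar -/(weight g) w0.
  have hz i : lsubmx (rsubmx g) 0 i = 0 /\ rsubmx (rsubmx g) 0 i = 0.
    have := h i; rewrite !mxE.
    have := gp (rshift 1 (lshift n i)); have := gp (rshift 1 (rshift n i)).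
    by move: (g _ _) (g _ _) => u v; lia.
  have -> : lsubmx (rsubmx g) = 0 by apply/rowP => i; rewrite (hz i).1 mxE.
  have -> : rsubmx (rsubmx g) = 0 by apply/rowP => i; rewrite (hz i).2 mxE.
  by rewrite row_mx0 -scalemx1 scale0r row_mx0.
apply: (NF_img (q := 0) (W := col_mx 1%:M 0) (NF_fiber (semilinear_system M be) Xpos)).
- apply: evT => t y; rewrite evm0.
  have WE (z : 'rV_(n + n)) : 0 + z *m evm t (col_mx 1%:M 0) = lsubmx z.
    by rewrite /evm map_col_mx -/(evm t _) evm1 -/(evm t _) evm0 mulmx_col1 mulmx1
               mulmx0 addr0 add0r.
  have XE (z : 'rV_(n + n)) : fiber X t z <-> (forall i, 0 <= z 0 i) /\
      (lsubmx z *m A = b + t%:Z *: b' /\ lsubmx z + rsubmx z = const_mx (t%:Z - 1)).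
    rewrite /fiber /X ME row_mxKr /weight row_mxKl mxE; split.
      move=> [hp /eq_row_mx[/eqP h1 /eqP h2]]; split.
        by move=> i; have := hp (rshift 1 i); rewrite row_mxEr.
      split; first by apply/eqP; rewrite -subr_eq.
      rewrite subr_eq in h2; rewrite (eqP h2).
      by apply/rowP => i; rewrite !mxE addrC.
    move=> [hp [h1 h2]]; split.
      by move=> i; case: (split_ordP i) => j ->; rewrite ?row_mxEl ?row_mxEr ?mxE.
    by rewrite h1 h2 addrK; congr row_mx; apply/rowP => i; rewrite !mxE; lia.
  split=> [[hy yA]|[z /XE[hz [h1 h2]] ->]].
    exists (row_mx y (\row_i (t%:Z - 1 - y 0 i))); last by rewrite WE row_mxKl.
    apply/XE; rewrite row_mxKl row_mxKr; split; last split=> //.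
      move=> i; case: (split_ordP i) => j ->; rewrite ?row_mxEl ?row_mxEr ?mxE.
        by case/andP: (hy j).
      by have := hy j; lia.
    by apply/rowP => i; rewrite !mxE addrC subrK.
  rewrite WE; split=> // i; have := congr1 (fun u : 'rV_n => u 0 i) h2.
  rewrite !mxE; have := hz (lshift n i); have := hz (rshift n i).
  by move: (z _ _) (z _ _) => u v; lia.
- apply: evT => t y y' [_ hy] [_ hy'].
  rewrite /evm map_col_mx -/(evm t _) evm1 -/(evm t _) evm0 !mulmx_col1 !mulmx1.
  rewrite !mulmx0 !addr0 => E.
  have := etrans hy (esym hy'); rewrite !ME !row_mxKr => /eq_row_mx[_].
  rewrite E /weight !row_mxKl => /addIr/addrI E'.
  by rewrite -[y]hsubmxK -[y']hsubmxK E E'.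
Qed.

Lemma horner_drop1 (p : {poly int}) (x : int) :
  p.[x] = p`_0 + x * (drop_poly 1 p).[x].
Proof.
rewrite -{1}[p](poly_take_drop 1) hornerD hornerM hornerXn expr1 mulrC; congr (_ + _).
have -> : take_poly 1 p = (p`_0)%:P by apply/polyP => -[|i]; rewrite coef_take_poly coefC.
by rewrite hornerC.
Qed.

Lemma evm_drop1 t m n (A : 'M[{poly int}]_(m, n)) :
  evm t A = map_mx (fun p : {poly int} => p`_0) A + t%:Z *: evm t (map_mx (drop_poly 1) A).
Proof. by apply/matrixP => i j; rewrite !mxE /horner_eval -horner_drop1. Qed.

(* The coefficient matrix is stripped of its constant term at each step; the
   carries take boundedly many values because the digits are smaller than [t]. *)
Lemma NF_digits n r rc (A : 'M[{poly int}]_(n, r)) (b : 'rV[{poly int}]_r)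
    (Ac : 'M[int]_(n, rc)) (bc bc' : 'rV[int]_rc) :
  NF (fun t (y : 'rV[int]_n) => [/\ forall i, 0 <= y 0 i < t%:Z,
        y *m Ac = bc + t%:Z *: bc' & y *m evm t A = evm t b]).
Proof.
have [N] : exists N, forall i j, (size (A i j) <= N)%N.
  exists (\max_i \max_j size (A i j))%N => i j.
  by apply: leq_trans (leq_bigmax i); exact: (leq_bigmax j).
elim: N rc A b Ac bc bc' => [|N IH] rc A b Ac bc bc' sA.
  have {sA} -> : A = 0.
    apply/matrixP => i j; rewrite mxE; apply/eqP; rewrite -size_poly_eq0.
    by rewrite -leqn0.
  (* With [A = 0] the equation reads [b(t) = 0]: always true, or false for all large [t]. *)
  have [->|b0] := eqVneq b 0.
    apply: NF_ext (NF_constant_system Ac bc bc'); apply: evT => t y.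
    by rewrite !evm0 mulmx0; split=> [[]|[]].
  have [k bk] := rv_neq0 b0.
  apply: NF_empty; apply: ev_mono (pos_sqr bk) => t; rewrite hornerM => h y [_ _].
  rewrite evm0 mulmx0 => /rowP/(_ k); rewrite mxE evmE => E.
  by rewrite -E mul0r ltxx in h.
pose A0 := map_mx (fun p : {poly int} => p`_0) A.
pose b0 := map_mx (fun p : {poly int} => p`_0) b.
pose A' := map_mx (drop_poly 1) A; pose b' := map_mx (drop_poly 1) b.
(* In each column the carry [u] satisfies [t |u| <= t * sum_i |A0 i k| + |b0 k|], and dividing by
   [t >= 1] gives a bound that does not depend on [t]. *)
pose C := (\sum_k (\sum_i absz (A0 i k) + absz (b0 0 k)%R))%N.
have [L hL] := box_seq r C.
have stepE t (y : 'rV_n) : y *m evm t A = evm t b ->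
    y *m A0 = b0 + t%:Z *: (evm t b' - y *m evm t A').
  rewrite (evm_drop1 t A) (evm_drop1 t b) mulmxDr -scalemxAr => E.
  by rewrite scalerBr addrA -E addrK.
apply: (@NF_fibers _ _ _ (fun t y => evm t b' - y *m evm t A') L).
  exists 1%N => t t1 y [hy _ /stepE]; set c := evm t b' - _ => E.
  apply: hL => k.
  have Ck : ((\sum_i absz (A0 i k) + absz (b0 0 k)%R) <= C)%N.
    by rewrite /C (bigD1 k) //= leq_addr.
  have h1 : `|(y *m A0) 0 k| <= t%:Z * (\sum_i absz (A0 i k))%N%:Z.
    rewrite mxE; apply: le_trans (ler_norm_sum _ _ _) _.
    rewrite (big_morph Posz (id1 := 0) (op1 := +%R)) // mulr_sumr.
    apply: ler_sum => i _; rewrite normrM abszE; apply: ler_wpM2r => //.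
    by have /andP[? ?] := hy i; rewrite ger0_norm // ltW.
  have E' : (y *m A0) 0 k = b0 0 k + t%:Z * c 0 k by rewrite E mxE [X in _ + X]mxE.
  move: h1 Ck; rewrite E'; move: (c 0 k) (b0 0 k) C (bigop _ _ _) => u v K s h1 h2.
  have : `|t%:Z * u| <= t%:Z * s%:Z + `|v| by lia.
  by rewrite normrM; nia.
move=> c _.
(* Once the carry [c] is fixed, the constant terms join the constant block with right-hand side
   [b0 + t c], and the same digits satisfy a system whose entries have one coefficient fewer. *)
apply: NF_ext (IH _ A' (b' - map_mx polyC c) (row_mx Ac A0) (row_mx bc b0)
                  (row_mx bc' c) _); last first.
  by move=> i j; rewrite mxE size_drop_poly; have := sA i j; lia.
apply: evT => t y; rewrite evmD evmN evmC mul_mx_row scale_row_mx add_row_mx.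
split.
  move=> [hy /eq_row_mx[h1 h2] h3]; split; last by rewrite h3 opprB addrCA subrr addr0.
  split=> //; rewrite (evm_drop1 t A) (evm_drop1 t b) mulmxDr -scalemxAr h2 h3.
  by rewrite -addrA -scalerDr [c + _]addrC subrK.
move=> [[hy h1 /stepE h2] h3]; split=> //; first by rewrite h1 h2 h3.
by rewrite -h3 opprB addrC subrK.
Qed.

Lemma rvD n (a b : 'rV[int]_n) i : (a + b) 0 i = a 0 i + b 0 i.
Proof. by rewrite mxE. Qed.

Lemma rvB n (a b : 'rV[int]_n) i : (a - b) 0 i = a 0 i - b 0 i.
Proof. by rewrite !mxE. Qed.

Lemma rvZ n c (a : 'rV[int]_n) i : (c *: a) 0 i = c * a 0 i.
Proof. by rewrite mxE. Qed.

Lemma rv_l m n (a : 'rV[int]_(m + n)) i : lsubmx a 0 i = a 0 (lshift n i).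
Proof. by rewrite mxE. Qed.

Lemma rv_r m n (a : 'rV[int]_(m + n)) i : rsubmx a 0 i = a 0 (rshift m i).
Proof. by rewrite mxE. Qed.

Lemma rv_const n c (i : 'I_n) : (const_mx c : 'rV[int]_n) 0 i = c.
Proof. by rewrite mxE. Qed.

Definition digit_box k n r D (A : 'M[{poly int}]_(k + n, r)) (b : 'rV_r) (t : nat) :
    set 'rV[int]_(k + n) :=
  fun v => [/\ forall i, 0 <= lsubmx v 0 i < t%:Z,
    forall i, 0 <= rsubmx v 0 i < t%:Z ^+ D.+1 & v *m evm t A = evm t b].

(** The first [k] coordinates are digits already. One step divides each of the other [n] by [t]: the
    remainders become [n] more digits, the quotients have a smaller bound, and [W] recomposes the
    original vector. *)
Lemma NF_digit_box D k n r (A : 'M[{poly int}]_(k + n, r)) b :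
  NF (digit_box D A b).
Proof.
elim: D k A => [|D IH] k A.
  apply: NF_ext (NF_digits A b (0 : 'M_(_, 0)) 0 0); apply: evT => t v.
  rewrite /digit_box expr1; split=> [[h _ h3]|[h1 h2 h3]].
    by split=> // i; rewrite mxE; exact: h.
  split=> //; last by apply/rowP => -[].
  move=> i; case: (split_ordP i) => j ->.
    by have := h1 j; rewrite mxE.
  by have := h2 j; rewrite mxE.
pose W : 'M[{poly int}]_(k + n + n, k + n) := col_mx 1%:M (row_mx 0 ('X%:M)).
have WE t (v : 'rV_(k + n + n)) : v *m evm t W =
    lsubmx v + row_mx 0 (t%:Z *: rsubmx v).
  have XE : evm t ('X%:M : 'M_n) = t%:Z%:M.
    by apply/matrixP => i j; rewrite !mxE /horner_eval hornerMn hornerX.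
  rewrite /evm map_col_mx map_row_mx -!/(evm t _) evm1 evm0 XE.
  by rewrite mulmx_col1 mulmx1 mul_mx_row mulmx0 mul_mx_scalar.
apply: (NF_img (q := 0) (W := W) (IH (k + n)%N (W *m A))); exists 1%N => t t1.
- move=> v; rewrite evm0.
  have tD : 0 < t%:Z ^+ D.+1 :> int by rewrite exprn_gt0.
  split.
    move=> [h1 h2 h3].
    pose z1 := map_mx (fun z => (z %/ t%:Z)%Z) (rsubmx v).
    pose z0 := map_mx (fun z => (z %% t%:Z)%Z) (rsubmx v).
    have vE : v = row_mx (row_mx (lsubmx v) z0) z1 *m evm t W.
      rewrite WE row_mxKl row_mxKr add_row_mx addr0 -{1}[v]hsubmxK; congr row_mx.
      by apply/rowP => i; rewrite !mxE addrC mulrC -divz_eq.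
    exists (row_mx (row_mx (lsubmx v) z0) z1); last by rewrite add0r.
    split; last by rewrite evmM mulmxA -vE.
      move=> i; rewrite row_mxKl; case: (split_ordP i) => j ->.
        by rewrite row_mxEl.
      by rewrite row_mxEr mxE modz_ge0 ?ltz_pmod //; lia.
    move=> i; rewrite row_mxKr mxE; have /andP[a1 a2] := h2 i.
    rewrite divz_ge0 ?a1 /=; last by lia.
    by rewrite ltz_divLR -?exprSr //; lia.
  move=> [u [h1 h2 h3] ->]; rewrite add0r; rewrite evmM mulmxA in h3; split=> //.
    move=> i; rewrite WE -[lsubmx u]hsubmxK add_row_mx addr0 row_mxKl.
    by rewrite mxE; exact: h1.
  move=> i; rewrite WE -[lsubmx u]hsubmxK add_row_mx addr0 row_mxKr.
  have := h1 (rshift k i); have := h2 i.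
  rewrite rvD rvZ [rsubmx (lsubmx u) 0 i]rv_r.
  rewrite [t%:Z ^+ D.+2]exprS.
  by move: (rsubmx u 0 i) (lsubmx u _ _) (t%:Z ^+ D.+1) tD => z y e; nia.
- move=> u u' [h1 h2 h3] [h1' h2' h3']; rewrite !WE => E.
  have /rowP Er : rsubmx (lsubmx u) + t%:Z *: rsubmx u =
      rsubmx (lsubmx u') + t%:Z *: rsubmx u'.
    move: E; rewrite -{1}[lsubmx u]hsubmxK -{1}[lsubmx u']hsubmxK !add_row_mx.
    by case/eq_row_mx.
  have Ez : rsubmx u = rsubmx u'.
    apply/rowP => i; have := Er i; have := h1 (rshift k i); have := h1' (rshift k i).
    rewrite !rvD !rvZ ![rsubmx (lsubmx _) 0 i]rv_r.
    move: (lsubmx u _ _) (lsubmx u' _ _) (rsubmx u 0 i) (rsubmx u' 0 i) => a a' z z'.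
    by nia.
  rewrite -[u]hsubmxK -[u']hsubmxK Ez; congr (row_mx _ _).
  by move: E; rewrite Ez => /addIr.
Qed.

(** Both [x - lo] and the slack [up - 1 - x] are nonnegative and below a fixed power of [t], so
    together they fill a digit box with no digits extracted yet. *)
Lemma NF_bounded_polyhedron n r (A : 'M[{poly int}]_(n, r)) b lo up :
  NF (polyhedron A b [::] lo up).
Proof.
have [D hD] : exists D, ev (fun t => forall i, (up 0 i - lo 0 i).[t%:Z] < t%:Z ^+ D.+1).
  have [d hd] := choice (fun i => poly_le_exp (up 0 i - lo 0 i)).
  exists (\max_i d i)%N; have := ev_and (ev_forall hd) (ev_ge 1).
  apply: ev_mono => t [h t1] i; apply: lt_le_trans (h i) _.
  rewrite ler_weXn2l //.
  by rewrite leqW // leq_bigmax.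
pose M : 'M[{poly int}]_(n + n, r + n) := block_mx A 1%:M 0 1%:M.
pose be : 'rV[{poly int}]_(r + n) := row_mx (b - lo *m A) (up - lo - const_mx 1).
have WE t (z : 'rV[int]_(n + n)) : z *m evm t (col_mx 1%:M 0) = lsubmx z.
  by rewrite /evm map_col_mx -/(evm t _) evm1 -/(evm t _) evm0 mulmx_col1 mulmx1
             mulmx0 addr0.
have ME t (z : 'rV[int]_(n + n)) : z *m evm t M =
    row_mx (lsubmx z *m evm t A) (lsubmx z + rsubmx z).
  rewrite /M /evm map_block_mx -!/(evm t _) evm1 evm0.
  by rewrite -{1}[z]hsubmxK mul_row_block mulmx0 addr0 !mulmx1.
have beE t : evm t be = row_mx (evm t b - evm t lo *m evm t A)
    (evm t up - evm t lo - const_mx 1).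
  rewrite /evm map_row_mx -!/(evm t _) !evmD !evmN evmM; congr (row_mx _ (_ - _)).
  by apply/rowP => i; rewrite !mxE /horner_eval hornerC.
have DE t (z : 'rV[int]_(n + n)) : @digit_box 0 (n + n) _ D M be t z <->
    [/\ forall i, 0 <= z 0 i < t%:Z ^+ D.+1,
      lsubmx z *m evm t A = evm t b - evm t lo *m evm t A &
      lsubmx z + rsubmx z =
        evm t up - evm t lo - const_mx 1].
  have rz i : @rsubmx _ 1 0 (n + n) z 0 i = z 0 i
    by rewrite mxE; congr (z 0 _); apply: val_inj.
  rewrite /digit_box ME beE; split=> [[_ h /eq_row_mx[h1 h2]]|[h1 h2 h3]].
    by split=> // i; rewrite -rz.
  split=> [[]//|i|]; first by rewrite rz.
  by rewrite h2 h3.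
apply: (NF_img (q := lo) (W := col_mx 1%:M 0) (@NF_digit_box D 0 (n + n) _ M be)).
- apply: ev_mono hD => t hD x; split.
    move=> [h1 h2 h3].
    exists (row_mx (x - evm t lo) (evm t up - x - const_mx 1)); last first.
      by rewrite WE row_mxKl addrC subrK.
    apply/DE; rewrite row_mxKl row_mxKr mulmxBl h2; split=> //.
      move=> i; case: (split_ordP i) => j -> {i};
        rewrite ?row_mxEl ?row_mxEr; have := h1 j; have := h3 j isT; have := hD j;
        rewrite hornerD hornerN -!evmE ?rvB ?rv_const;
        move: (x 0 j) (evm t lo 0 j) (evm t up 0 j) (t%:Z ^+ D.+1) => u v w e; lia.
    by rewrite !addrA; congr (_ - _); rewrite addrC -addrA addKr addrC.
  move=> [z /DE[h1 h2 h3] ->]; rewrite WE; split.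
  - move=> i; have := h1 (lshift n i); rewrite rvD rv_l.
    by move: (z _ _) (evm t lo 0 i) => u v; lia.
  - by rewrite mulmxDl h2 addrC subrK.
  - move=> i _; have := h1 (rshift n i).
    have : (lsubmx z + rsubmx z) 0 i = (evm t up - evm t lo - const_mx 1) 0 i.
      by rewrite h3.
    rewrite !rvB !rvD rv_r rv_const.
    by move: (lsubmx _ 0 i) (z _ _) (evm t lo 0 i) (evm t up 0 i) => p q u v; lia.
- apply: evT => t z z' /DE[_ _ h] /DE[_ _ h']; rewrite !WE => E.
  have := etrans h (esym h'); rewrite E => /addrI E'.
  by rewrite -[z]hsubmxK -[z']hsubmxK E E'.
Qed.

Lemma NF_system n r (A : 'M[{poly int}]_(n, r)) b :
  NF (fun t x => (forall i, 0 <= x 0 i) /\ x *m evm t A = evm t b).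
Proof.
apply: NF_ext (@polyhedron_ind n r A b (@NF n) _ _ _ _ _ (enum 'I_n) 0 0
                 (enum_uniq _) _).
- apply: evT => t x; split=> [[h1 h2 _]|[h1 h2]].
    by split=> // i; have := h1 i; rewrite evmE mxE horner0.
  by split=> // i; [rewrite evmE mxE horner0 | rewrite mem_enum].
- exact: NF_ext.
- exact: NF_union.
- exact: NF_empty.
- exact: NF_gen.
- by move=> lo up _; exact: NF_bounded_polyhedron.
- by move=> i; rewrite mxE; exact: nonneg0.
Qed.

(** * Boolean combinations *)

Definition lin n (t : nat) (x : 'rV[int]_n) (a : 'cV[{poly int}]_n) : int :=
  (x *m evm t a) 0 0.

(* [(None, a, b)] is the inequality x.a <= b, [(Some m, a, b)] the congruence
   x.a = b modulo m. *)
Definition literal (n : nat) : Type :=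
  (option nat * 'cV[{poly int}]_n * {poly int})%type.

HB.instance Definition _ (n : nat) := Equality.on (literal n).

Definition lit_holds n (t : nat) (l : literal n) (x : 'rV[int]_n) : bool :=
  if l.1.1 is Some m then (m%:Z %| lin t x l.1.2 - l.2.[t%:Z])%Z
  else lin t x l.1.2 <= l.2.[t%:Z].

Definition lit_ok n (l : literal n) : bool :=
  if l.1.1 is Some m then (0 < m)%N else true.

Definition literal_system n r (A : 'M[{poly int}]_(n, r)) (b : 'rV[{poly int}]_r)
    (ls : seq (literal n)) (t : nat) : set 'rV[int]_n :=
  fun x => [/\ forall i, 0 <= x 0 i, x *m evm t A = evm t b &
               {in ls, forall l, lit_holds t l x}].

(** As [k] is nonzero, the slack [y] is determined by [x], and the projection forgetting it is
    injective. The factor [k] is 1 for an inequality and minus the modulus for a congruence. *)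
Lemma NF_slack n r (A : 'M_(n, r)) b ls (a : 'cV_n) (k : int) (c : {poly int}) :
  k != 0 ->
  NF (literal_system (block_mx A a 0 (k%:P)%:M) (row_mx b (const_mx c : 'M_1))
        [seq (l.1.1, col_mx l.1.2 (0 : 'M_1), l.2) | l : literal n <- ls]) ->
  NF (fun t x => literal_system A b ls t x /\
        exists2 y, 0 <= y & lin t x a + k * y = c.[t%:Z]).
Proof.
move=> k0 hNF.
have WE t (z : 'rV[int]_(n + 1)) : z *m evm t (col_mx 1%:M 0) = lsubmx z.
  by rewrite /evm map_col_mx -/(evm t _) evm1 -/(evm t _) evm0 mulmx_col1 mulmx1
             mulmx0 addr0.
have linE t (z : 'rV[int]_(n + 1)) (a' : 'cV_n) :
    lin t z (col_mx a' (0 : 'M_1)) = lin t (lsubmx z) a'.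
  by rewrite /lin /evm map_col_mx -!/(evm t _) evm0 mulmx_col1 mulmx0 addr0.
have litE t (z : 'rV[int]_(n + 1)) (l : literal n) :
    lit_holds t (l.1.1, col_mx l.1.2 (0 : 'M_1), l.2) z = lit_holds t l (lsubmx z).
  by rewrite /lit_holds /= linE.
have LE t (z : 'rV[int]_(n + 1)) : literal_system
    (block_mx A a 0 (k%:P)%:M) (row_mx b (const_mx c : 'M_1))
    [seq (l.1.1, col_mx l.1.2 (0 : 'M_1), l.2) | l : literal n <- ls] t z <->
    [/\ literal_system A b ls t (lsubmx z), 0 <= rsubmx z 0 0 &
        lin t (lsubmx z) a + k * rsubmx z 0 0 = c.[t%:Z]].
  have zM : z *m evm t (block_mx A a 0 (k%:P)%:M) = row_mx (lsubmx z *m evm t A)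
      (lsubmx z *m evm t a + k *: rsubmx z).
    rewrite -{1}[z]hsubmxK /evm map_block_mx -!/(evm t _) evm0.
    have -> : evm t ((k%:P)%:M : 'M_1) = k%:M.
      by apply/matrixP => i j; rewrite !mxE /horner_eval hornerMn hornerC.
    by rewrite mul_row_block mulmx0 addr0 mul_mx_scalar.
  have bM : evm t (row_mx b (const_mx c : 'M_1)) = row_mx (evm t b) (const_mx c.[t%:Z] : 'M_1).
    rewrite /evm. rewrite map_row_mx; congr row_mx.
    by apply/matrixP => i j; rewrite !mxE.
  rewrite /literal_system zM bM; split.
    move=> [h1 /eq_row_mx[h2 h3] h4]; split.
    - split=> // [i|l lls]; first by rewrite rv_l.
      by rewrite -litE; apply: h4; exact: map_f.
    - by rewrite rv_r.
    - have := congr1 (fun w : 'M_1 => w 0 0) h3.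
      by rewrite [in X in X -> _]mxE [const_mx _ 0 0]mxE rvZ.
  move=> [[h1 h2 h4] h5 h3]; split.
  - move=> i; case: (split_ordP i) => j ->; first by rewrite -rv_l.
    by rewrite -rv_r (ord1 j).
  - rewrite h2; congr row_mx; apply/matrixP => i j; rewrite !ord1.
    by rewrite [const_mx _ 0 0]mxE -h3 rvD rvZ.
  - by move=> _ /mapP[l lls ->]; rewrite litE; exact: h4.
apply: (NF_img (q := 0) (W := col_mx 1%:M 0) hNF); apply: evT => t.
- move=> x; rewrite evm0; split.
    move=> [hx [y y0 xy]]; exists (row_mx x (const_mx y)).
      by apply/LE; rewrite row_mxKl row_mxKr [const_mx _ 0 0]mxE.
    by rewrite WE row_mxKl add0r.
  move=> [z /LE[h1 h2 h3] ->]; rewrite WE add0r; split=> //.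
  by exists (rsubmx z 0 0).
- move=> z z' /LE[_ _ h] /LE[_ _ h']; rewrite !WE => E.
  rewrite -[z]hsubmxK -[z']hsubmxK E; congr row_mx; apply/matrixP => i j.
  rewrite !ord1; apply: (mulfI k0); move: h; rewrite -h' E.
  exact: addrI.
Qed.

Lemma literal_system_cons n r (A : 'M_(n, r)) b l ls t x :
  literal_system A b (l :: ls) t x <->
  literal_system A b ls t x /\ lit_holds t l x.
Proof.
rewrite /literal_system; split.
  move=> [h1 h2 h3]; split; last by apply: h3; exact: mem_head.
  by split=> // l' l'ls; apply: h3; rewrite inE l'ls orbT.
move=> [[h1 h2 h3] h4]; split=> // l'; rewrite inE => /orP[/eqP->//|]; exact: h3.
Qed.

Lemma NF_literal_system n r (A : 'M_(n, r)) b ls :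
  all (@lit_ok n) ls -> NF (literal_system A b ls).
Proof.
have [N] := ubnP (size ls); elim: N n r A b ls => // N IH n r A b [|l ls] lN.
  move=> _; apply: NF_ext (NF_system A b); apply: evT => t x.
  by split=> [[]|[]].
move=> /= /andP[okl okls].
pose lift := [seq (l.1.1, col_mx l.1.2 (0 : 'M_1), l.2) | l : literal n <- ls].
have IHs (r' : nat) (A' : 'M_(n + 1, r')) b' : NF (literal_system A' b' lift).
  apply: IH; first by rewrite size_map.
  by rewrite all_map; apply: sub_all okls.
have slack := fun a k c k0 => @NF_slack n r A b ls a k c k0 (IHs _ _ _).
case: l okl lN => [[[m|] a] c] okl lN; last first.
  apply: NF_ext (slack a 1 c isT); apply: evT => t x; rewrite literal_system_cons.
  rewrite /lit_holds /=; split=> [[h [y y0 xy]]|[h xa]]; split=> //.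
    by lia.
  by exists (c.[t%:Z] - lin t x a); lia.
have m0 : (0 < m)%N := okl.
(* The quotient of [x.a - c] by [m] may have either sign, but a slack is nonnegative. The first
   system covers the quotients [y], the second the quotients [- (y + 1)]; the summand [m] keeps them
   disjoint. *)
apply: (NF_union (slack a (- m%:Z) c _) (slack (- a) (- m%:Z) (m%:Z%:P - c) _)).
- by lia.
- by lia.
- apply: evT => t x; rewrite literal_system_cons /lit_holds /=.
  have -> : lin t x (- a) = - lin t x a by rewrite /lin evmN mulmxN mxE.
  rewrite !hornerE; move: (lin t x a) (c.[_]) => u v; split.
    move=> [h /dvdzP[q E]]; have [q0|q0] := lerP 0 q.
      by left; split=> //; exists q; lia.
    by right; split=> //; exists (- q - 1); lia.
  move=> [[h [y y0 E]]|[h [y y0 E]]]; split=> //; apply/dvdzP.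
    by exists y; lia.
  by exists (- y - 1); lia.
- apply: evT => t x [_ [y y0 E]] [_ [y' y0' E']].
  move: E'; have -> : lin t x (- a) = - lin t x a by rewrite /lin evmN mulmxN mxE.
  rewrite !hornerE; move: (lin t x a) (c.[_]) E => u v E E'.
  have : 0 <= m%:Z * y by apply: mulr_ge0.
  have : 0 <= m%:Z * y' by apply: mulr_ge0.
  by lia.
Qed.

Inductive boolean_family (n : nat) : (nat -> 'rV[int]_n -> Prop) -> Prop :=
| BF_le a b : boolean_family (fun t x => lin t x a <= b.[t%:Z])
| BF_dvd (m : nat) a b : (0 < m)%N ->
    boolean_family (fun t x => (m%:Z %| lin t x a - b.[t%:Z])%Z)
| BF_not P : boolean_family P -> boolean_family (fun t x => ~ P t x)
| BF_and P Q : boolean_family P -> boolean_family Q ->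
    boolean_family (fun t x => P t x /\ Q t x).

(** An accumulator for the induction on formulas: [G] holds the conjuncts still to be treated, and
    quantifying over [ls] leaves room for the literals found meanwhile. The matrix without columns
    stands for no equation. *)
Definition closed_family n (G : nat -> 'rV[int]_n -> Prop) : Prop :=
  forall ls, all (@lit_ok n) ls ->
    NF (fun t x => literal_system (0 : 'M_(n, 0)) 0 ls t x /\ G t x).

(** Proving the claim for [P] and its negation together makes the case of a negation immediate. A
    negated conjunction is cut into the disjoint cases [~ P] and [P /\ ~ Q]. *)
Lemma closed_family_boolean n P (G : nat -> 'rV[int]_n -> Prop) :
  boolean_family P -> closed_family G ->
  closed_family (fun t x => P t x /\ G t x) /\
  closed_family (fun t x => ~ P t x /\ G t x).
Proof.
move=> hP; elim: hP G => {P} [a b|m a b m0|P _ IH|P Q _ IHP _ IHQ] G hG.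
- split=> ls ok.
    apply: NF_ext (hG ((None, a, b) :: ls) ok); apply: evT => t x.
    by rewrite literal_system_cons; exact: and_assoc.
  apply: NF_ext (hG ((None, - a, - b - 1) :: ls) ok); apply: evT => t x.
  rewrite literal_system_cons /lit_holds /= /lin evmN mulmxN mxE !hornerE.
  move: ((x *m _) 0 0) (b.[_]) => u v; split=> [[[h1 h2] h3]|[h1 [h2 h3]]].
    by split=> //; split=> //; lia.
  by split=> //; split=> //; lia.
- split=> ls ok.
    have ok' : all (@lit_ok n) ((Some m, a, b) :: ls) by apply/andP.
    apply: NF_ext (hG _ ok'); apply: evT => t x.
    by rewrite literal_system_cons; exact: and_assoc.
  (* Failure of a congruence is sorted by the nonzero residue, each of which is again a
     congruence. *)
  apply: (@NF_fibers _ _ _ (fun t x => absz ((lin t x a - b.[t%:Z]) %% m%:Z)%Z)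
                     (iota 1 m.-1)).
    apply: evT => t x [_ [h _]]; rewrite mem_iota.
    have := modz_ge0 (lin t x a - b.[t%:Z]) (_ : m%:Z != 0).
    have := ltz_pmod (lin t x a - b.[t%:Z]) (_ : 0 < m%:Z).
    move=> /(_ m0) h1; have mn : m%:Z != 0 by lia.
    move=> /(_ mn) h2; have : ((lin t x a - b.[t%:Z]) %% m%:Z)%Z <> 0.
      by move=> E; apply: h; exact/dvdz_mod0P.
    by move: (modz _ _) h1 h2 => u; lia.
  move=> i; rewrite mem_iota => hi.
  have ok' : all (@lit_ok n) ((Some m, a, b + i%:Z%:P) :: ls) by apply/andP.
  apply: NF_ext (hG _ ok'); apply: evT => t x.
  rewrite literal_system_cons /lit_holds /= hornerD hornerC.
  have im : (i%:Z %% m%:Z)%Z = i%:Z by rewrite modz_small //; lia.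
  rewrite opprD addrA -eqz_mod_dvd im; split.
    move=> [[h1 /eqP h2] h3]; split; last by rewrite h2.
    by split=> //; split=> // /dvdz_mod0P; rewrite h2; lia.
  move=> [[h1 [h2 h3]] h4]; split=> //; split=> //; apply/eqP; rewrite -h4.
  have : 0 <= ((lin t x a - b.[t%:Z]) %% m%:Z)%Z by apply: modz_ge0; lia.
  by move: (modz _ _) => u; lia.
- have [h1 h2] := IH G hG; split=> //.
  move=> ls ok; apply: NF_ext (h1 ls ok); apply: evT => t x.
  split=> -[g1 [g2 g3]]; split=> //; split=> //.
  exact: contrapT.
- have [hQ hnQ] := IHQ G hG; have [hP hnP] := IHP _ hQ.
  have [_ hnP'] := IHP _ hG; split=> ls ok.
    by apply: NF_ext (hP ls ok); apply: evT => t x; tauto.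
  have [hPnQ _] := IHP _ hnQ.
  apply: (NF_union (hnP' ls ok) (hPnQ ls ok)); apply: evT => t x.
    split=> [[h1 [h2 h3]]|[[h1 [h2 h3]]|[h1 [h2 [h3 h4]]]]].
    - have [p|p] := pselect (P t x); last by left.
      by right; do 3 (split=> //); move=> q; apply: h2.
    - by split=> //; split=> // -[].
    - by split=> //; split=> // -[].
  by move=> [_ [h _]] [_ [h' _]].
Qed.

Theorem NF_boolean n P : @boolean_family n P ->
  NF (fun t x => (forall i, 0 <= x 0 i) /\ P t x).
Proof.
move=> hP; have trueG : closed_family (fun _ (_ : 'rV[int]_n) => True).
  move=> ls ok; apply: NF_ext (NF_literal_system (0 : 'M_(n, 0)) 0 ok); apply: evT => t x.
  by split=> [h|[]].
have [h _] := closed_family_boolean hP trueG.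
apply: NF_ext (h [::] isT); apply: evT => t x; split=> [[[? _ _] []]|[? ?]] //.
split=> //; split=> //.
by apply/rowP => -[].
Qed.

(** * Quantifier elimination *)

Definition clin n (x : 'rV[int]_n) (a : 'cV[int]_n) : int := (x *m a) 0 0.

Inductive presburger_family (n : nat) : (nat -> 'rV[int]_n -> Prop) -> Prop :=
| PF_le (a : 'cV[int]_n) b : presburger_family (fun t x => clin x a <= b.[t%:Z])
| PF_dvd (m : nat) (a : 'cV[int]_n) b : (0 < m)%N ->
    presburger_family (fun t x => (m%:Z %| clin x a - b.[t%:Z])%Z)
| PF_not P : presburger_family P -> presburger_family (fun t x => ~ P t x)
| PF_and P Q : presburger_family P -> presburger_family Q ->
    presburger_family (fun t x => P t x /\ Q t x).

Lemma presburger_boolean n P : @presburger_family n P -> boolean_family P.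
Proof.
have linE t (x : 'rV[int]_n) a : clin x a = lin t x (map_mx polyC a).
  by rewrite /lin evmC.
have ext (F G : nat -> 'rV[int]_n -> Prop) : (forall t x, F t x = G t x) ->
    boolean_family G -> boolean_family F.
  by move=> h; have -> : F = G by apply/funext => t; apply/funext => x.
elim=> {P} [a b|m a b m0|P _|P Q _ hP _ hQ].
- by apply: ext (BF_le (map_mx polyC a) b) => t x; rewrite (linE t).
- by apply: ext (BF_dvd (map_mx polyC a) b m0) => t x; rewrite (linE t).
- exact: BF_not.
- exact: BF_and.
Qed.

Section Elimination.
Variable n : nat.
Local Notation cons_rv y x := (row_mx (const_mx y : 'M[int]_1) x).

Lemma PF_ext (P Q : nat -> 'rV[int]_n -> Prop) :
  (forall t x, P t x <-> Q t x) -> presburger_family P -> presburger_family Q.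
Proof.
by move=> h; have -> : P = Q by apply/funext => t; apply/funext => x; apply/propext.
Qed.

Lemma PF_exists_in (I : eqType) (r : seq I) (F : I -> nat -> 'rV[int]_n -> Prop) :
  (forall i, i \in r -> presburger_family (F i)) ->
  presburger_family (fun t x => exists2 i, i \in r & F i t x).
Proof.
elim: r => [_|i r IH hF].
  apply: (@PF_ext (fun t x => clin x 0 <= (- 1%:P : {poly int}).[t%:Z])).
    by move=> t x; rewrite /clin mulmx0 mxE !hornerE; split=> [|[]].
  exact: PF_le.
have hi := hF i (mem_head _ _).
have hr := IH (fun j jr => hF j (mem_behead (s := i :: r) jr)).
apply: PF_ext (PF_not (PF_and (PF_not hi) (PF_not hr))) => t x; split.
  move=> h; apply: contrapT => h'; apply: h; split=> h.
    by apply: h'; exists i; rewrite ?mem_head.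
  by case: h => j jr Fj; apply: h'; exists j; rewrite // inE jr orbT.
move=> [j]; rewrite inE => /orP[/eqP->|jr] Fj [h1 h2]; first exact: h1.
by apply: h2; exists j.
Qed.

Lemma clinBZ (x : 'rV[int]_n) c d (a a' : 'cV[int]_n) :
  clin x (c *: a - d *: a') = c * clin x a - d * clin x a'.
Proof. by rewrite /clin mulmxBr -!scalemxAr !mxE. Qed.

Lemma mul_cons_rv (y : int) (x : 'rV[int]_n) (a : 'cV[int]_(1 + n)) :
  clin (cons_rv y x) a = y * usubmx a 0 0 + clin x (dsubmx a).
Proof.
rewrite /clin -{1}[a]vsubmxK mul_row_col mxE; congr (_ + _).
by rewrite mxE big_ord1 mxE.
Qed.

(* Moving [y] by a multiple of all the moduli changes the truth value only
   close to one of finitely many boundaries c y = b(t) - x.a. *)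
Lemma PF_boundaries P : @presburger_family (1 + n) P ->
  exists M0 (bs : seq (int * 'cV[int]_n * {poly int})),
    [/\ (0 < M0)%N, {in bs, forall c, 0 < c.1.1} &
    forall M t x y, (0 < M)%N -> (M0 %| M)%N ->
      (P t (cons_rv y x) <-> P t (cons_rv (y - M%:Z) x)) \/
      exists2 c, c \in bs & exists2 j : nat, 0 < j%:Z <= c.1.1 * M%:Z &
        c.1.1 * y = c.2.[t%:Z] - clin x c.1.2 + j%:Z].
Proof.
elim=> {P} [a b|m a b m0|P _ [M [bs [M0 h1 h2]]]|P Q _ [M [bs [M0 h1 h2]]]
                                                _ [M' [bs' [M0' h1' h2']]]].
- exists 1%N; set a1 := usubmx a 0 0; set a2 := dsubmx a.
  have [a10|a10|a10] := ltgtP a1 0; last first.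
  + exists [::]; split=> // M t x y _ _; left.
    by rewrite !mul_cons_rv -/a1 a10 !mulr0.
  + exists [:: (a1, a2, b)]; split=> //; first by move=> c; rewrite inE => /eqP->.
    move=> M t x y M0 _; rewrite !mul_cons_rv -/a1 -/a2.
    set u := clin x a2; set v := b.[_].
    have aM : 0 < a1 * M%:Z by rewrite mulr_gt0.
    have [h|h] := boolP ((y * a1 + u <= v) == ((y - M%:Z) * a1 + u <= v)).
      by left; rewrite (eqP h).
    right; exists (a1, a2, b); rewrite ?mem_head //=.
    exists (absz (y * a1 + u - v)%R); rewrite -/u -/v; lia.
  (* For a negative coefficient the boundary is that of the negated inequality; the [- 1] puts the
     offset [j] in the same range, starting at 1, as for a positive coefficient. *)
  + exists [:: (- a1, - a2, - b - 1)]; split=> //.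
      by move=> c; rewrite inE => /eqP->; rewrite oppr_gt0.
    move=> M t x y M0 _; rewrite !mul_cons_rv -/a1 -/a2.
    set u := clin x a2; set v := b.[_].
    have aM : a1 * M%:Z < 0 by rewrite nmulr_rlt0.
    have [h|h] := boolP ((y * a1 + u <= v) == ((y - M%:Z) * a1 + u <= v)).
      by left; rewrite (eqP h).
    right; exists (- a1, - a2, - b - 1); rewrite ?mem_head //=.
    rewrite {1}/clin mulmxN mxE -/(clin x a2) -/u !hornerE -/v.
    exists (absz (v - y * a1 - u + 1)%R); lia.
- exists m, [::]; split=> // M t x y M0 /dvdnP[k ->]; left.
  rewrite !mul_cons_rv PoszM; set u := usubmx a 0 0.
  move: (clin _ _) (b.[_]) => v w.
  split=> /dvdzP[q E]; apply/dvdzP; [exists (q - k%:Z * u) | exists (q + k%:Z * u)].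
    by rewrite [RHS]mulrBl -E; ring.
  by rewrite [RHS]mulrDl -E; ring.
- exists M, bs; split=> // K t x y K0 /(h2 K t x y K0)[h|]; last by right.
  by left; split=> nP /h.
exists (M * M')%N, (bs ++ bs'); split; first by rewrite muln_gt0 M0.
  by move=> c; rewrite mem_cat => /orP[/h1|/h1'].
move=> K t x y K0 MK.
have [h|[c cb hc]] := h2 K t x y K0 (dvdn_trans (dvdn_mulr _ (dvdnn M)) MK); last first.
  by right; exists c; rewrite // mem_cat cb.
have [h'|[c cb hc]] := h2' K t x y K0 (dvdn_trans (dvdn_mull _ (dvdnn M')) MK); last first.
  by right; exists c; rewrite // mem_cat cb orbT.
by left; rewrite h h'.
Qed.

(** Each literal is multiplied by [c] before [c y] is replaced. A positive constant preserves
    inequalities, and a modulus [m] becomes the constant [c m]. *)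
Lemma PF_substitute P (c : nat) (al : 'cV[int]_n) be :
  @presburger_family (1 + n) P -> (0 < c)%N ->
  exists2 Q, presburger_family Q & forall t x y,
    c%:Z * y = be.[t%:Z] - clin x al -> (P t (cons_rv y x) <-> Q t x).
Proof.
move=> hP c0; elim: hP => {P} [a b|m a b m0|P _ [Q hQ h]|P P' _ [Q hQ h] _ [Q' hQ' h']].
- set a1 := usubmx a 0 0; set a2 := dsubmx a.
  exists (fun t x => clin x (c%:Z *: a2 - a1 *: al) <= (c%:Z *: b - a1 *: be).[t%:Z]).
    exact: PF_le.
  move=> t x y E; rewrite mul_cons_rv -/a1 -/a2 clinBZ !hornerE.
  have cy : c%:Z * (y * a1) = a1 * (be.[t%:Z] - clin x al) by rewrite -E; ring.
  have cp : 0 < c%:Z by [].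
  rewrite -(ler_pM2l cp) mulrDr cy.
  move: (clin x a2) (clin x al) (be.[_]) (b.[_]) => u v w z.
  by rewrite !mulrBr; split; lia.
- set a1 := usubmx a 0 0; set a2 := dsubmx a.
  exists (fun t x => ((c * m)%N%:Z %| clin x (c%:Z *: a2 - a1 *: al)
                        - (c%:Z *: b - a1 *: be).[t%:Z])%Z).
    by apply: PF_dvd; rewrite muln_gt0 c0.
  move=> t x y E; rewrite mul_cons_rv -/a1 -/a2 clinBZ !hornerE.
  have cy : c%:Z * (y * a1) = a1 * (be.[t%:Z] - clin x al) by rewrite -E; ring.
  have cp : c%:Z != 0 by lia.
  rewrite -(dvdz_mul2l cp) -PoszM mulrBr mulrDr cy.
  move: (clin x a2) (clin x al) (be.[_]) (b.[_]) => u v w z.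
  by have -> : a1 * (w - v) + c%:Z * u - c%:Z * z =
    c%:Z * u - a1 * v - (c%:Z * z - a1 * w) by ring.
- by exists (fun t x => ~ Q t x); [exact: PF_not | move=> t x y E; rewrite h].
exists (fun t x => Q t x /\ Q' t x); first exact: PF_and.
by move=> t x y E; rewrite h // h'.
Qed.

(** A witness is lowered by [M] as long as this preserves [P]. The descent stops below [M] or at a
    bounded distance from a boundary, so one of finitely many equations [c y = b(t) - x.a + j] holds
    for some witness, and [y] can be substituted. *)
Lemma PF_exists P : @presburger_family (1 + n) P ->
  presburger_family (fun t x => exists y : nat, P t (cons_rv y%:Z x)).
Proof.
move=> hP; have [M [bs [M0 bs0 hbs]]] := PF_boundaries hP.
(* This boundary reads [y = j - 1]; with [j] running from 1 to [M] it accounts for the witnesses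
   below [M]. *)
pose bs' := (1, 0, -1) :: bs.
pose D (c : int * 'cV[int]_n * {poly int}) (j : nat) t x :=
  exists y : nat, c.1.1 * y%:Z = c.2.[t%:Z] - clin x c.1.2 + j%:Z /\
    P t (cons_rv y%:Z x).
have hD c j : 0 < c.1.1 -> presburger_family (D c j).
  move=> c0; have c2 : (0 < absz c.1.1)%N by lia.
  have [Q hQ h] := PF_substitute c.1.2 (c.2 + j%:Z%:P) hP c2.
  have c1 : (absz c.1.1)%:Z = c.1.1 by lia.
  have E t x y : c.1.1 * y = (c.2 + j%:Z%:P).[t%:Z] - clin x c.1.2 <->
      c.1.1 * y = c.2.[t%:Z] - clin x c.1.2 + j%:Z.
    by rewrite hornerD hornerC addrAC.
  pose b' := c.2 + j%:Z%:P.
  (* The congruence makes the solution [y] of the equation an integer, the inequality makes it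
     nonnegative. *)
  apply: PF_ext (PF_and (PF_dvd c.1.2 b' c2) (PF_and (PF_le c.1.2 b') hQ)) => t x.
  rewrite c1; split.
    move=> [/dvdzP[q Eq] [b'0 Qt]].
    have q0 : 0 <= - q by move: Eq b'0; move: (clin _ _) (b'.[_]) => u v; nia.
    have Eq' : c.1.1 * (- q) = b'.[t%:Z] - clin x c.1.2.
      by rewrite mulrN mulrC -Eq opprB.
    exists (absz q); have -> : (absz q)%:Z = - q by lia.
    by split; [apply/E | apply/h; rewrite ?c1].
  move=> [y [/E Ey Py]]; split; last split.
  - by apply/dvdzP; exists (- y%:Z); rewrite mulNr mulrC Ey opprB.
  - by rewrite -subr_ge0 -Ey mulr_ge0 // ltW.
  - by apply/(h t x y%:Z); rewrite ?c1.
apply: (@PF_ext (fun t x => exists2 c, c \in bs' &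
    exists2 j, j \in iota 1 (absz (c.1.1 * M%:Z)) & D c j t x)).
  move=> t x; split; first by move=> [c _ [j _ [y [_ Py]]]]; exists y.
  move=> [y]; have [N] := ubnP y; elim: N y => // N IH y yN Py.
  have [yM|yM] := ltnP y M.
    exists (1, 0, -1); first exact: mem_head.
    exists y.+1; first by rewrite mem_iota /=; lia.
    by exists y; split=> //=; rewrite /clin mulmx0 mxE hornerN hornerC; lia.
  have [h|[c cb [j hj E]]] := hbs M t x y%:Z M0 (dvdnn M).
    apply: (IH (y - M)%N); first by lia.
    by rewrite -subzn //; apply/h.
  exists c; first by rewrite inE cb orbT.
  exists j; first by move: hj; rewrite mem_iota; move: (c.1.1 * M%:Z) => u; lia.
  by exists y.
apply: PF_exists_in => c; rewrite inE => cb; apply: PF_exists_in => j _; apply: hD.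
by case/orP: cb => [/eqP->|/bs0].
Qed.

End Elimination.

Lemma natZ_cons n (y : nat) (x : 'rV[nat]_n) :
  natZ (row_mx (const_mx y : 'M_1) x) = row_mx (const_mx y%:Z : 'M_1) (natZ x).
Proof. by rewrite /natZ map_row_mx map_const_mx. Qed.

Lemma clin_natZ n (x : 'rV[nat]_n) (c : 'rV[int]_n) :
  clin (natZ x) c^T = dot c x.
Proof. by rewrite /clin mxE; apply: eq_bigr => i _; rewrite !mxE mulrC. Qed.

Lemma presburger_formula n (f : formula n) : constant_coefficients f ->
  exists2 P, @presburger_family n P & forall t x, holds t f x <-> P t (natZ x).
Proof.
elim: f => {n} [n a b|n f IH|n f IHf g IHg|n f IHf g IHg|n f IH|n f IH] /=.
- move=> [c ->]; exists (fun t x => clin x c^T <= b.[t%:Z]); first exact: PF_le.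
  move=> t x; rewrite clin_natZ; suff -> : map_mx (fun p : {poly int} => p.[t%:Z])
      (map_mx polyC c) = c by [].
  by apply/matrixP => i j; rewrite !mxE hornerC.
- move=> /IH[P hP h]; exists (fun t x => ~ P t x); first exact: PF_not.
  by move=> t x; rewrite h.
- move=> [/IHf[P hP h] /IHg[Q hQ h']]; exists (fun t x => P t x /\ Q t x).
    exact: PF_and.
  by move=> t x; rewrite h h'.
- move=> [/IHf[P hP h] /IHg[Q hQ h']].
  exists (fun t x => ~ (~ P t x /\ ~ Q t x)).
    by apply: PF_not; apply: PF_and; exact: PF_not.
  move=> t x; rewrite h h'; split=> [[p|q] [] //|].
  by move=> np; apply: contrapT => h0; apply: np; split=> h1; apply: h0; [left|right].
- move=> /IH[P hP h].
  exists (fun t x => exists y : nat, P t (row_mx (const_mx y%:Z : 'M_1) x)).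
    exact: PF_exists.
  by move=> t x; split=> -[y]; [rewrite h natZ_cons|rewrite -natZ_cons -h] => hy; exists y.
- move=> /IH[P hP h].
  exists (fun t x => ~ exists y : nat, ~ P t (row_mx (const_mx y%:Z : 'M_1) x)).
    by apply: PF_not; apply: (PF_exists (P := fun t x => ~ P t x)); exact: PF_not.
  move=> t x; split.
    by move=> hy [y]; apply; rewrite -natZ_cons -h.
  move=> hy y; rewrite h natZ_cons; apply: contrapT => h0; apply: hy.
  by exists y.
Qed.

Lemma boolean_formula n (f : formula n) : quantifier_free f ->
  exists2 P, @boolean_family n P & forall t x, holds t f x <-> P t (natZ x).
Proof.
elim: f => {n} [n a b|n f IH|n f IHf g IHg|n f IHf g IHg|n f IH|n f IH] //=.
- move=> _; exists (fun t x => lin t x a^T <= b.[t%:Z]); first exact: BF_le.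
  move=> t x; rewrite /lin -/(clin _ _) (_ : evm t a^T = (evm t a)^T); last first.
    by apply/matrixP => i j; rewrite !mxE.
  by rewrite clin_natZ.
- move=> /IH[P hP h]; exists (fun t x => ~ P t x); first exact: BF_not.
  by move=> t x; rewrite h.
- move=> /andP[/IHf[P hP h] /IHg[Q hQ h']]; exists (fun t x => P t x /\ Q t x).
    exact: BF_and.
  by move=> t x; rewrite h h'.
- move=> /andP[/IHf[P hP h] /IHg[Q hQ h']].
  exists (fun t x => ~ (~ P t x /\ ~ Q t x)).
    by apply: BF_not; apply: BF_and; exact: BF_not.
  move=> t x; rewrite h h'; split=> [[p|q] [] //|].
  by move=> np; apply: contrapT => h0; apply: np; split=> h1; apply: h0; [left|right].
Qed.

Theorem NF_formula n (f : formula n) (S : nat -> set 'rV[nat]_n) :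
  defines f S -> quantifier_free f \/ constant_coefficients f ->
  NF (fun t => [set natZ x | x in S t]).
Proof.
move=> fS hf; have [P hP h] : exists2 P, @boolean_family n P &
    forall t x, holds t f x <-> P t (natZ x).
  case: hf => [/boolean_formula //|/presburger_formula[P hP h]].
  by exists P => //; exact: presburger_boolean.
apply: NF_ext (NF_boolean hP); apply: evT => t x; split.
  move=> [x0 Px]; have xE : x = natZ (map_mx absz x).
    by apply/rowP => i; have := x0 i; rewrite !mxE; lia.
  by exists (map_mx absz x); [apply/fS/h; rewrite -xE|].
by move=> [y /fS/h Py <-]; split=> // i; rewrite mxE.
Qed.

(** * Reading off the properties *)

Lemma ev_residues (V : nat) (P : nat -> Prop) : (0 < V)%N ->
  (forall c, (c < V)%N -> ev (fun s => P (V * s + c)%N)) -> ev P.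
Proof.
move=> V0 h; have /ev_forall[T hT] : forall c : 'I_V, ev (fun s => P (V * s + c)%N).
  by move=> c; exact: h.
exists (V * T)%N => t Tt; rewrite (divn_eq t V) mulnC.
apply: (hT _ _ (Ordinal (ltn_pmod t V0))).
by rewrite leq_divRL // mulnC.
Qed.

Lemma eventually_periodic_residues (V : nat) (A : set nat) : (0 < V)%N ->
  (forall c, (c < V)%N -> ev (fun s => A (V * s + c)%N) \/
                          ev (fun s => ~ A (V * s + c)%N)) ->
  eventually_periodic A.
Proof.
move=> V0 h; pose B c := ev (fun s => A (V * s + c)%N).
have [T hT] : ev (fun t => A t <-> B (t %% V)%N).
  apply: (ev_residues V0) => c cV; have cE s : ((V * s + c) %% V)%N = c.
    by rewrite mulnC modnMDl modn_small.
  have [hc|hc] := h c cV.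
    by apply: ev_mono (hc) => s As; rewrite cE; split.
  apply: ev_mono (hc) => s nAs; rewrite cE; split=> // Bc.
  by have [U /(_ U (leqnn U))[]] := ev_and hc Bc.
exists T, V; split=> // t Tt; rewrite hT // hT ?modnDr //.
exact: leq_trans Tt (leq_addr _ _).
Qed.

(** The values of the polynomials are admissible only for large [t]. Totality of [R] supplies the
    other values, and the choice is arranged to follow the polynomials whenever their values are
    natural and admissible. *)
Lemma eventually_quasi_polynomial_residues (V : nat) (J : finType)
    (R : nat -> (J -> nat) -> Prop) : (0 < V)%N ->
  (forall t, exists x, R t x) ->
  (forall c, (c < V)%N -> exists p : J -> {poly rat}, ev (fun s => exists x,
     (forall j, (x j)%:R = (p j).[s%:R]) /\ R (V * s + c)%N x)) ->
  exists2 x : nat -> J -> nat, forall t, R t (x t) &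
    forall j, eventually_quasi_polynomial (fun t => x t j).
Proof.
move=> V0 tot h.
have [p hp] : exists p : 'I_V -> J -> {poly rat}, forall c, ev (fun s => exists x,
    (forall j, (x j)%:R = (p c j).[s%:R]) /\ R (V * s + c)%N x).
  by have [p hp] := choice (fun c : 'I_V => h c (ltn_ord c)); exists p.
pose r t := Ordinal (ltn_pmod t V0).
pose good t (x : J -> nat) := forall j, (x j)%:R = (p (r t) j).[(t %/ V)%:R].
have [x hx] : exists x : nat -> J -> nat, forall t,
    R t (x t) /\ ((exists y, R t y /\ good t y) -> good t (x t)).
  have ex t : exists x, R t x /\ ((exists y, R t y /\ good t y) -> good t x).
    have [[y [Ry gy]]|ny] := pselect (exists y, R t y /\ good t y); first by exists y.
    by have [y Ry] := tot t; exists y.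
  by have [x hx] := choice ex; exists x.
exists x => [t|j]; first exact: (hx t).1.
(* Inverse of [s |-> V s + c], rewriting a polynomial in [s] as one in [t]. *)
pose q (c : nat) : {poly rat} := V%:R^-1 *: ('X - c%:R%:P).
have Vn0 : V%:R != 0 :> rat by rewrite pnatr_eq0 -lt0n.
have qE t : (q (t %% V)%N).[t%:R] = (t %/ V)%:R.
  rewrite !hornerE {1}(divn_eq t V) natrD natrM addrK.
  by rewrite mulrC mulfK.
exists (fun t => (p (r t) j \Po q (t %% V)%N).[t%:R]).
  exists V => //; exists (fun i : 'I_V => p i j \Po q i) => i t ti.
  have E : (t %% V)%N = i by rewrite ti modn_small.
  by rewrite E; congr (_ \Po _).[_]; congr (p _ j); apply: val_inj.
have [T hT] : ev (fun t => exists y, R t y /\ good t y).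
  apply: (ev_residues V0) => c cV; apply: ev_mono (hp (Ordinal cV)) => s [y [hy Ry]].
  exists y; split=> // i; rewrite hy /good.
  rewrite mulnC divnMDl // divn_small // addn0; congr (p _ i).[_].
  by apply: val_inj; rewrite /= modnMDl modn_small.
exists T => t /hT /(hx t).2 /(_ j) ->.
by rewrite horner_comp qE.
Qed.

Lemma horner_intr (p : {poly int}) (s : nat) :
  (map_poly intr p).[s%:R] = (p.[s%:Z])%:~R :> rat.
Proof. by rewrite -[s%:R]/((s%:Z)%:~R) horner_map. Qed.

(** * Corners and directions of a piece *)

Section Corners.
Variable R : nzRingType.

(** The vertex of the dilated simplex at which the whole multiplicity is placed on one generator
    [w]. *)
Definition corner n (p : piece R n) (w : 'rV[R]_n) : 'rV[R]_n :=
  base p + psize p *: w.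

Definition first_corner n (p : piece R n) : 'rV[R]_n := corner p (head 0 (simp p)).

(* A direction along which a piece with more than one point extends. *)
Definition direction n (p : piece R n) : 'rV[R]_n :=
  if free p is v :: _ then v else
  if simp p is w :: w' :: _ then w' - w else 0.

Definition single n (p : piece R n) : bool := (size (simp p) == 1%N) && nilp (free p).

End Corners.

Lemma evmZ s m n c (A : 'M_(m, n)) : evm s (c *: A) = c.[s%:Z] *: evm s A.
Proof. by apply/matrixP => i j; rewrite !mxE /horner_eval hornerM. Qed.

Lemma evmMn s m n k (A : 'M_(m, n)) : evm s (A *+ k) = evm s A *+ k.
Proof. by elim: k => [|k IH]; rewrite ?mulr0n ?evm0 // !mulrS evmD IH. Qed.

Lemma evm_corner s n (p : piece {poly int} n) w :
  evm s (corner p w) = corner (pev s p) (evm s w).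
Proof. by rewrite evmD evmZ. Qed.

Lemma evm_first_corner s n (p : piece {poly int} n) :
  evm s (first_corner p) = first_corner (pev s p).
Proof.
by rewrite evm_corner; congr corner; case: p => [[[? [|? ?]] ?] ?] //=; rewrite evm0.
Qed.

Lemma evm_direction s n (p : piece {poly int} n) :
  evm s (direction p) = direction (pev s p).
Proof.
by case: p => [[[? [|? [|? ?]]] [|? ?]] ?] //=; rewrite /direction /= ?evm0 // evmD evmN.
Qed.

Lemma single_pev s n (p : piece {poly int} n) : single (pev s p) = single p.
Proof. by rewrite /single /= /nilp !size_map. Qed.

Section PiecePoints.
Variable n : nat.
Implicit Types (c : piece int n) (x w v : 'rV[int]_n).

Lemma scale_absz (z : int) w : 0 <= z -> z *: w = w *+ absz z.
Proof. by move=> z0; rewrite -[in LHS](gez0_abs z0) -scaler_nat; congr (_ *: _); lia. Qed.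

Lemma inp_corner c w : 0 <= psize c -> w \in simp c -> inp c (corner c w).
Proof.
move=> M0 wc; have [ws1 [ws2 E]] : exists ws1 ws2, simp c = ws1 ++ w :: ws2.
  by case/splitPr: wc => ws1 ws2; exists ws1, ws2.
exists (nseq (size ws1) 0%N ++ absz (psize c) :: nseq (size ws2) 0%N).
exists (nseq (size (free c)) 0%N); split.
  split; first by rewrite E !size_cat /= !size_nseq.
    by rewrite size_nseq.
  by rewrite sumn_cat /= !sumn_nseq; lia.
rewrite /ppoint E lc_cat ?size_nseq //= !lc_nseq0 addr0 add0r addr0.
by rewrite -scale_absz.
Qed.

Lemma inp_free c x v k : v \in free c -> inp c x -> inp c (x + v *+ k).
Proof.
move=> vc; have [vs1 [vs2 E]] : exists vs1 vs2, free c = vs1 ++ v :: vs2.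
  by case/splitPr: vc => vs1 vs2; exists vs1, vs2.
move=> [ms [ns [[h1 h2 h3] ->]]]; rewrite E in h2.
have [ns1 [m [ns2 [nsE s1 s2]]]] := size_cat_cons h2.
exists ms, (ns1 ++ (m + k)%N :: ns2); split.
  by split=> //; rewrite E !size_cat /= s1 s2.
by rewrite /ppoint E nsE !lc_cat //= mulrnDr -!addrA [_ + v *+ k]addrC.
Qed.

(** Without a free generator, [i] units of multiplicity move from the first simplex generator to the
    second, which is possible while [i] does not exceed the size. *)
Lemma inp_direction c i : simp c != [::] -> ~~ single c ->
  i%:Z <= psize c -> inp c (first_corner c + direction c *+ i).
Proof.
case: c => [[[b [|w ws]] [|v vs]] M] // _; last first.
  move=> _ iM; apply: inp_free; first by rewrite /= mem_head.
  apply: inp_corner; last by rewrite /= mem_head.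
  by apply: le_trans iM.
case: ws => [|w' ws] // _ /= iM.
exists (absz (M - i%:Z) :: i :: nseq (size ws) 0%N), [::]; split.
  by split; rewrite /= ?size_nseq // sumn_nseq; lia.
rewrite /ppoint /first_corner /corner /direction /= lc_nseq0 !addr0 -addrA.
congr (_ + _); rewrite -scale_absz; last by lia.
rewrite scalerBl.
have -> : i%:Z *: w = w *+ i by rewrite -scaler_nat natz.
by rewrite mulrnBl -addrA [- _ + _]addrC.
Qed.

(** A zero direction would give one point two parameters: two coefficients of a zero free generator,
    or the full multiplicity on either of two equal simplex generators. *)
Lemma direction_neq0 c : pinj c -> simp c != [::] -> ~~ single c ->
  1 <= psize c -> direction c != 0.
Proof.
move=> ci; case: c ci => [[[b [|w ws]] [|v vs]] M] // ci _; last first.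
  move=> _ /= M1; apply/eqP => v0; rewrite /direction /= in v0.
  have vd k : valid (b, w :: ws, v :: vs, M) (absz M :: nseq (size ws) 0%N)
      (k :: nseq (size vs) 0%N).
    by split; rewrite /= ?size_nseq // sumn_nseq; lia.
  suff E : ppoint (b, w :: ws, v :: vs, M) (absz M :: nseq (size ws) 0%N)
      (0%N :: nseq (size vs) 0%N) = ppoint (b, w :: ws, v :: vs, M)
      (absz M :: nseq (size ws) 0%N) (1%N :: nseq (size vs) 0%N).
    by have [_ /eqP] := ci _ _ _ _ (vd 0%N) (vd 1%N) E; rewrite eqseq_cons.
  by rewrite /ppoint /= v0 !mul0rn.
case: ws ci => [|w' ws] ci // _ /= M1; apply/eqP => d0.
rewrite /direction /= in d0; have {d0} ww : w' = w by apply/eqP; rewrite -subr_eq0 d0.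
have v1 : valid (b, w :: w' :: ws, [::], M) [:: absz M, 0%N & nseq (size ws) 0%N] [::].
  by split; rewrite /= ?size_nseq // sumn_nseq; lia.
have v2 : valid (b, w :: w' :: ws, [::], M) [:: 0%N, absz M & nseq (size ws) 0%N] [::].
  by split; rewrite /= ?size_nseq // sumn_nseq; lia.
suff E : ppoint (b, w :: w' :: ws, [::], M) [:: absz M, 0%N & nseq (size ws) 0%N] [::] =
    ppoint (b, w :: w' :: ws, [::], M) [:: 0%N, absz M & nseq (size ws) 0%N] [::].
  by have [/eqP] := ci _ _ _ _ v1 v2 E; rewrite eqseq_cons; lia.
by rewrite /ppoint /= ww !mulr0n !add0r.
Qed.

Lemma ray_inj v i j : v != 0 -> v *+ i = v *+ j -> i = j.
Proof.
move=> v0 E; have [k vk] := rv_neq0 v0.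
have : (v *+ i) 0 k = (v *+ j) 0 k by rewrite E.
rewrite (mxrowMn v i k) (mxrowMn v j k).
exact: mulrIn.
Qed.

Lemma inp_single c x : single c -> 0 <= psize c -> inp c x <-> x = first_corner c.
Proof.
case: c => [[[b [|w [|w' ws]]] [|v vs]] M] // _ /= M0; split.
  move=> [[|m [|? ?]] [[|? ?] [[//= _ _ mM] ->]]].
  rewrite /ppoint /first_corner /corner /= !addr0; congr (_ + _).
  by rewrite scale_absz //; congr (_ *+ _); lia.
by move=> ->; apply: inp_corner; rewrite ?inE //=.
Qed.

End PiecePoints.

(** * Enumerating and counting the points of a dilated simplex *)

Section SimplexPoints.
Variable n : nat.
Implicit Types (x w : 'rV[int]_n) (ws : seq 'rV[int]_n).

(** The exponents, with multiplicity, of the complete homogeneous sum of degree [M] in the monomials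
    [x^w], listed by the recursion [h_M(w, ws) = h_M(ws) + x^w h_(M-1)(w, ws)]. The inner [fix] is
    needed because the second summand keeps the list of generators. *)
Fixpoint simplex ws : nat -> seq 'rV[int]_n :=
  match ws with
  | [::] => fun M => if M is 0%N then [:: 0] else [::]
  | w :: ws' => fix aux M :=
      if M is M'.+1 then simplex ws' M ++ [seq w + x | x <- aux M'] else [:: 0]
  end.

Lemma simplex0 ws : simplex ws 0 = [:: 0].
Proof. by case: ws. Qed.

Lemma simplexS w ws M : simplex (w :: ws) M.+1 =
  simplex ws M.+1 ++ [seq w + x | x <- simplex (w :: ws) M].
Proof. by []. Qed.

Lemma mem_simplex ws M x : x \in simplex ws M <->
  exists ms, [/\ size ms = size ws, sumn ms = M & x = lc ms ws].
Proof.
elim: ws M x => [|w ws IH] M x.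
  case: M => [|M] /=; split=> //.
  - by rewrite inE => /eqP->; exists [::].
  - by move=> [[|? ?] [//= _ _ ->]]; rewrite mem_head.
  - by move=> [[|? ?] [//= _]].
elim: M x => [|M IHM] x.
  rewrite simplex0 inE; split=> [/eqP->|[[|m ms] [//= [sz] mM ->]]].
    exists (nseq (size ws).+1 0%N); rewrite size_nseq sumn_nseq; split=> //.
    by rewrite /= lc_nseq0 addr0.
  move: mM; case: m => // /=; rewrite add0n mulr0n add0r => mM.
  have : lc ms ws \in simplex ws 0 by apply/IH; exists ms.
  by rewrite simplex0 inE.
rewrite simplexS mem_cat; split.
  move=> /orP[/IH[ms [sz sM ->]]|/mapP[y /IHM[[|m ms] [//= [sz] sM ->]] ->]].
    by exists (0%N :: ms); rewrite /= sz sM mulr0n add0r.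
  by exists (m.+1 :: ms); rewrite /= sz addSn sM mulrS addrA.
move=> [[|[|m] ms] [//= [sz] sM ->]]; apply/orP.
  by left; apply/IH; exists ms; rewrite mulr0n add0r -sM.
right; apply/mapP; exists (lc (m :: ms) (w :: ws)); last by rewrite /= mulrS addrA.
by apply/IHM; exists (m :: ms); split=> //=; [rewrite sz | move: sM; rewrite addSn => -[]].
Qed.

Definition injective_simplex ws M : Prop := forall ms ms',
  size ms = size ws -> size ms' = size ws -> sumn ms = M -> sumn ms' = M ->
  lc ms ws = lc ms' ws -> ms = ms'.

Lemma simplex_uniq ws M : injective_simplex ws M -> uniq (simplex ws M).
Proof.
elim: ws M => [|w ws IH] M; first by case: M.
elim: M => [|M IHM] inj //.
have inj1 : injective_simplex ws M.+1.
  move=> ms ms' sz sz' sM sM' E.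
  have [] : 0%N :: ms = 0%N :: ms' by apply: inj; rewrite /= ?sz ?sz' //= !mulr0n !add0r.
  by [].
have inj2 : injective_simplex (w :: ws) M.
  move=> [|m ms] [|m' ms'] //= [sz] [sz'] sM sM' E.
  have [] : m.+1 :: ms = m'.+1 :: ms'.
    apply: inj; rewrite /= ?sz ?sz' ?addSn ?sM ?sM' //.
    by rewrite !mulrS -!addrA E.
  by move=> -> ->.
rewrite simplexS cat_uniq IH // (map_inj_uniq (addrI w)) ?IHM ?andbT //.
apply/hasPn => _ /mapP[x /mem_simplex[[|m ms] [//= [sz] sM ->]] ->].
apply/negP => /mem_simplex[ms' [sz' sM' E]].
have : m.+1 :: ms = 0%N :: ms'.
  apply: inj; rewrite /= ?sz ?sz' ?addSn ?sM //.
  by rewrite mulr0n add0r -E mulrS addrA.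
by [].
Qed.

Lemma size_simplex w ws M : size (simplex (w :: ws) M) = 'C(M + size ws, size ws).
Proof.
elim: ws w M => [|w' ws IH] w M.
  rewrite bin0; elim: M => [|M IHM] //.
  by rewrite simplexS size_cat size_map IHM.
elim: M => [|M IHM]; first by rewrite simplex0 add0n binn.
by rewrite simplexS size_cat size_map IH IHM /= addSnnS addSn binS addnC.
Qed.

End SimplexPoints.

Fixpoint binomial_poly (k : nat) : {poly rat} :=
  if k is k'.+1 then k%:R^-1 *: (binomial_poly k' * ('X + k%:R%:P)) else 1.

Lemma horner_binomial_poly k M : (binomial_poly k).[M%:R] = ('C(M + k, k))%:R.
Proof.
elim: k => [|k IH]; first by rewrite bin0 hornerC.
rewrite [binomial_poly _]/= hornerZ hornerM hornerD hornerX hornerC IH -natrD -natrM addnS mulnC.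
rewrite (mul_bin_diag (M + k).+1 k) natrM mulrA mulVf ?mul1r //.
by rewrite pnatr_eq0.
Qed.

Section Counting.
Variable n : nat.

Definition piece_points (c : piece int n) : seq 'rV[int]_n :=
  [seq base c + x | x <- simplex (simp c) (absz (psize c))].

Lemma mem_piece_points c x : free c = [::] -> 0 <= psize c ->
  x \in piece_points c <-> inp c x.
Proof.
move=> fc M0; split.
  move=> /mapP[y /mem_simplex[ms [sz sM ->]] ->]; exists ms, [::].
  by rewrite /valid /ppoint fc /= addr0; split=> //; split=> //; rewrite sM gez0_abs.
move=> [ms [[|? ?] [[]]]]; rewrite fc // => sz _ sM ->.
rewrite /ppoint fc /= addr0; apply/mapP; exists (lc ms (simp c)) => //.
by apply/mem_simplex; exists ms; rewrite -sM.
Qed.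

Lemma piece_points_uniq c : free c = [::] -> 0 <= psize c -> pinj c ->
  uniq (piece_points c).
Proof.
move=> fc M0 ci; rewrite (map_inj_uniq (addrI (base c))).
apply: simplex_uniq => ms ms' sz sz' sM sM' E.
have v : valid c ms [::] by rewrite /valid fc; split=> //; rewrite sM gez0_abs.
have v' : valid c ms' [::] by rewrite /valid fc; split=> //; rewrite sM' gez0_abs.
by have [|-> _] := ci _ _ _ _ v v' => //; rewrite /ppoint E.
Qed.

Lemma rep_finite cs A : @rep n cs A ->
  (forall c, c \in cs -> free c = [::] /\ 0 <= psize c) ->
  exists L, [/\ uniq L, A = [set` L] &
    size L = \sum_(c <- cs) size (piece_points c)]%N.
Proof.
move=> hr hc; exists (flatten [seq piece_points c | c <- cs]).
have cE x : count_mem x (flatten [seq piece_points c | c <- cs]) = `[<A x>].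
  rewrite (hr.1 x) count_flatten -map_comp sumnE big_map.
  apply: eq_big_seq => c ccs /=; have [fc M0] := hc c ccs.
  rewrite count_uniq_mem ?piece_points_uniq //; last exact: hr.2.
  by congr nat_of_bool; apply/idP/asboolP => /(mem_piece_points _ fc M0).
have mE x : (x \in flatten [seq piece_points c | c <- cs]) = `[<A x>].
  by rewrite -has_pred1 has_count cE; case: asbool.
split.
- by apply: count_mem_uniq => x; rewrite cE mE.
- by apply/predeqP => x /=; rewrite mE; split=> /asboolP.
by rewrite size_flatten /shape -map_comp sumnE big_map.
Qed.

End Counting.

Lemma card_seq (T : choiceType) (L : seq T) : uniq L -> [set` L] #= `I_(size L).
Proof.
case: L => [|x0 L] uL.
  by rewrite (_ : [set` [::]] = set0) ?II0 // predeqE => x; rewrite /= in_nil.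
have -> : [set` x0 :: L] = nth x0 (x0 :: L) @` `I_(size (x0 :: L)).
  rewrite predeqE => x; split=> [xL|[i /= iL <-]]; last exact: mem_nth.
  by exists (index x (x0 :: L)); rewrite /mkset ?index_mem ?nth_index.
apply: inj_card_eq => i j; rewrite !inE /= => iL jL /eqP.
by rewrite nth_uniq // => /eqP.
Qed.

Lemma natZ_inj n : injective (@natZ n).
Proof. by move=> x y /matrixP E; apply/matrixP => i j; have := E i j; rewrite !mxE => -[]. Qed.

Lemma card_natZ n (S : set 'rV[nat]_n) : [set natZ x | x in S] #= S.
Proof. by apply: inj_card_eq => x y _ _; exact: natZ_inj. Qed.

Section Properties.
Variables (d : nat) (S : nat -> set 'rV[nat]_d).
Hypothesis S_NF : NF (fun t => [set natZ x | x in S t]).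

Lemma NF1_pieces (ps : seq (piece {poly int} d)) : (forall p, p \in ps -> okp p) -> forall C : nat,
  ev (fun s => forall p, p \in ps -> C%:Z <= psize (pev s p)).
Proof. by move=> ok C; apply: ev_all => p /ok[_ h]; exact: h. Qed.

(** A piece that is not [single] supplies any number of points along its direction. If all pieces
    are [single], the set consists of their first corners, pairwise distinct by disjointness, and
    its cardinality is the number of pieces whatever [s] is. *)
Lemma many_points (ps : seq (piece {poly int} d)) (A : nat -> set 'rV[int]_d) k :
  (forall p, p \in ps -> okp p) -> ev (fun s => rep (map (pev s) ps) (A s)) ->
  (exists ys : 'I_k -> 'rV[{poly int}]_d,
     ev (fun s => injective (fun i => evm s (ys i)) /\ forall i, A s (evm s (ys i)))) \/
  ev (fun s => exists L, [/\ uniq L, A s = [set` L] & (size L < k)%N]).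
Proof.
move=> ok hr; have [/hasP[p pps np]|/hasPn sing] := boolP (has (fun p => ~~ single p) ps).
  left; exists (fun i => first_corner p + direction p *+ i).
  apply: ev2 hr (NF1_pieces ok k.+1) => s r hM.
  have cps : pev s p \in map (pev s) ps by exact: map_f.
  have nc : ~~ single (pev s p) by rewrite single_pev.
  have sc : simp (pev s p) != [::].
    by rewrite -size_eq0 size_map size_eq0; case: (ok p pps).
  have Mk := hM p pps.
  have eE i : evm s (first_corner p + direction p *+ i) =
      first_corner (pev s p) + direction (pev s p) *+ i.
    by rewrite evmD evmMn evm_first_corner evm_direction.
  split=> [i j|i]; rewrite !eE.
    move=> /addrI /ray_inj E; apply: val_inj; apply: E.
    by apply: direction_neq0 => //; [exact: r.2 | lia].
  by apply: (rep_in r cps); apply: inp_direction => //; have := ltn_ord i; lia.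
have sE : ev (fun s => rep (map (pev s) ps) (A s) /\
    forall x p, p \in ps -> inp (pev s p) x <-> x = evm s (first_corner p)).
  apply: ev2 hr (NF1_pieces ok 0) => s r hM; split=> // x p pps.
  rewrite evm_first_corner; apply: inp_single; last exact: hM.
  by rewrite single_pev; have := sing p pps; rewrite negbK.
pose ys := map (@first_corner _ d) ps.
have {}sE : ev (fun s => uniq (map (evm s) ys) /\ A s = [set` map (evm s) ys]).
  apply: ev_mono sE => s [r hx].
  have cE x : count_mem x (map (evm s) ys) = `[<A s x>].
    rewrite (r.1 x) big_map -sum1_count big_map big_map big_mkcond /=.
    apply: eq_big_seq => p pps; case: eqP => [<-|ne].
      by rewrite asboolT //; exact/(hx _ _ pps).
    by rewrite asboolF // => /(hx _ _ pps) E; apply: ne.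
  have mE x : (x \in map (evm s) ys) = `[<A s x>].
    by rewrite -has_pred1 has_count cE; case: asbool.
  split; first by apply: count_mem_uniq => x; rewrite cE mE.
  by apply/predeqP => x /=; rewrite mE; split=> /asboolP.
have [kp|kp] := leqP k (size ps).
  left; exists (fun i => nth 0 ys i); apply: ev_mono sE => s [us AE].
  have iE (i : 'I_k) : evm s (nth 0 ys i) = nth 0 (map (evm s) ys) i.
    by rewrite (nth_map 0) // size_map (leq_trans (ltn_ord i)).
  have il (i : 'I_k) : (i < size (map (evm s) ys))%N.
    by rewrite !size_map (leq_trans (ltn_ord i)).
  split=> [i j|i]; last by rewrite AE iE /=; exact: mem_nth.
  by rewrite !iE => /eqP; rewrite nth_uniq // => /eqP; exact: val_inj.
by right; apply: ev_mono sE => s [us AE]; exists (map (evm s) ys); rewrite !size_map.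
Qed.

Lemma image_natZ (t : nat) x : [set natZ y | y in S t] x ->
  exists2 y, S t y & natZ y = x.
Proof. by []. Qed.

Lemma NF_property3b : property3b S.
Proof.
move=> k; have [V V0 h] := S_NF.
have cardE t (L : seq 'rV[int]_d) : uniq L -> [set natZ y | y in S t] = [set` L] ->
    (`I_k #<= S t) = (k <= size L)%N.
  move=> uL E; rewrite -(card_le_eqr (card_natZ (S t))) E.
  by rewrite (card_le_eqr (card_seq uL)) card_le_II.
have points t (x : 'I_k -> 'rV[nat]_d) : injective x -> (forall i, S t (x i)) ->
    `I_k #<= S t.
  move=> xinj xS; have uL : uniq (map x (enum 'I_k)) by rewrite map_inj_uniq ?enum_uniq.
  have sL : size (map x (enum 'I_k)) = k by rewrite size_map size_enum_ord.
  have := card_seq uL; rewrite sL => /card_le_eql <-.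
  by apply: subset_card_le => y /mapP[i _ ->]; exact: xS.
pose J := ('I_k * 'I_d)%type.
pose pt (x : J -> nat) (i : 'I_k) : 'rV[nat]_d := \row_j x (i, j).
pose R t (x : J -> nat) := `I_k #<= S t ->
  injective (pt x) /\ forall i, S t (pt x i).
split.
  have ex t : `I_k #<= S t ->
      exists y : 'I_k -> 'rV[nat]_d, injective y /\ forall i, S t (y i).
    move=> /pcard_leP[f]; exists (fun i => f i); split=> [i j E|i].
      by apply: val_inj; apply: (@inj _ _ _ f) E; rewrite inE /= ltn_ord.
    by apply: funS; rewrite /= ltn_ord.
  have tot t : exists x, R t x.
    have [/ex[y [yinj yS]]|nle] := pselect (`I_k #<= S t); last by exists (fun=> 0%N).
    exists (fun ij => y ij.1 0 ij.2) => _.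
    have E i : pt (fun ij => y ij.1 0 ij.2) i = y i by apply/rowP => j; rewrite mxE.
    by split=> [i j|i]; rewrite !E //; exact: yinj.
  have [|x hx xq] := eventually_quasi_polynomial_residues V0 tot.
    move=> c cV; have [ps ok r] := h c cV.
    have [[ys hys]|hL] := many_points k ok r.
      exists (fun ij => map_poly intr (ys ij.1 0 ij.2)); apply: ev_mono hys => s [ui yA].
      have /choice[y hy] : forall i, exists y, S (V * s + c)%N y /\ natZ y = evm s (ys i).
        by move=> i; have [y] := image_natZ (yA i); exists y.
      exists (fun ij => y ij.1 0 ij.2); split.
        move=> [i j] /=; by rewrite horner_intr -evmE -(hy i).2 mxE.

      have E i : pt (fun ij => y ij.1 0 ij.2) i = y i by apply/rowP => j; rewrite mxE.
      move=> _; split=> [i j|i]; rewrite !E; last by case: (hy i).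
      by move=> yij; apply: ui; rewrite -(hy i).2 -(hy j).2 yij.
    exists (fun=> 0); apply: ev_mono hL => s [L [uL AE sL]].
    exists (fun=> 0%N); split=> [j|]; first by rewrite horner0.
    by rewrite /R (cardE _ L uL AE) leqNgt sL.
  exists (fun i t => pt (x t) i); first exact: hx.
  by move=> i j; have := xq (i, j); congr eventually_quasi_polynomial;
    apply/funext => t; rewrite mxE.
apply: (eventually_periodic_residues V0) => c cV; have [ps ok r] := h c cV.
have [[ys hys]|hL] := many_points k ok r.
  left; apply: ev_mono hys => s [ui yA].
  have /choice[y hy] : forall i, exists y, S (V * s + c)%N y /\ natZ y = evm s (ys i).
    by move=> i; have [y] := image_natZ (yA i); exists y.
  apply: (points _ y) => [i j yij|i]; last by case: (hy i).
  by apply: ui; rewrite -(hy i).2 -(hy j).2 yij.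
right; apply: ev_mono hL => s [L [uL AE sL]] /=.
by rewrite (cardE _ L uL AE) leqNgt sL.
Qed.
End Properties.

Lemma card_ge1 (T : choiceType) (A : set T) : (`I_1 #<= A) <-> A !=set0.
Proof.
split=> [le1|[x Ax]].
  apply/set0P; apply/eqP => A0; move: le1; rewrite A0 card_le0 => /eqP E.
  have : `I_1 0%N by [].
  by rewrite E.
rewrite -(card_le_eql (card_seq (_ : uniq [:: x]))) //.
by apply: subset_card_le => y /=; rewrite inE => /eqP ->.
Qed.

Section NormalFormProperties.
Variables (d : nat) (S : nat -> set 'rV[nat]_d).
Hypothesis S_NF : NF (fun t => [set natZ x | x in S t]).

Lemma NF_property3 : property3 S.
Proof.
have [[x hx xq] hp] := NF_property3b S_NF 1.
have E : [set t | `I_1 #<= S t] = [set t | S t !=set0].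
  by apply/predeqP => t; exact: card_ge1.
split; last by rewrite -E.
exists (x ord0) => [t /card_ge1 /hx[_]|j]; [exact | exact: xq].
Qed.

Lemma NF_property1 : property1 S.
Proof. by case: NF_property3. Qed.

Lemma infinite_free (ps : seq (piece {poly int} d)) s (A : set 'rV[int]_d) p :
  rep (map (pev s) ps) A -> p \in ps -> simp p != [::] -> free p != [::] ->
  1 <= psize (pev s p) -> ~ finite_set A.
Proof.
move=> r pps sp fp M1 /finite_seqP[L AL].
have cps : pev s p \in map (pev s) ps by exact: map_f.
have sc : simp (pev s p) != [::] by rewrite -size_eq0 size_map size_eq0.
have nc : ~~ single (pev s p).
  by rewrite single_pev /single negb_and /nilp size_eq0 fp orbT.
have [v vf] : exists v, v \in free (pev s p).
  by case: (p) fp => [[? [|v vs]] ?] // _; exists (evm s v); rewrite mem_head.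
have v0 : direction (pev s p) != 0 by apply: direction_neq0 => //; exact: r.2.
have dE : direction (pev s p) \in free (pev s p).
  by case: (p) fp => [[? [|w ws]] ?] // _; rewrite mem_head.
have inA i : first_corner (pev s p) + direction (pev s p) *+ i \in L.
  have : A (first_corner (pev s p) + direction (pev s p) *+ i).
    apply: (rep_in r cps); apply: inp_free => //; apply: inp_corner; first by lia.
    by case: (simp _) sc => // w ws _; rewrite mem_head.
  by rewrite AL.
pose f i := first_corner (pev s p) + direction (pev s p) *+ i.
have uf : uniq (map f (iota 0 (size L).+1)).
  by rewrite map_inj_uniq ?iota_uniq // => i j /addrI; exact: ray_inj.
have : (size (map f (iota 0 (size L).+1)) <= size L)%N.
  by apply: uniq_leq_size uf _ => _ /mapP[i _ ->]; exact: inA.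
by rewrite size_map size_iota ltnn.
Qed.

Lemma finite_natZ t : finite_set [set natZ x | x in S t] = finite_set (S t).
Proof. exact: eq_finite_set (card_natZ (S t)). Qed.

(** A free generator in one piece makes the set infinite. Otherwise a piece of size [M] with [k + 1]
    simplex generators has ['C(M + k, k)] points, a polynomial in [M] and hence in [s]. *)
Lemma NF_property2 : property2 S.
Proof.
have [V V0 h] := S_NF.
have key c : (c < V)%N -> ev (fun s => ~ finite_set (S (V * s + c)%N)) \/
    exists p : {poly rat}, ev (fun s => exists2 g : nat, g%:R = p.[s%:R] &
      S (V * s + c)%N #= `I_g).
  move=> cV; have [ps ok r] := h c cV.
  have [/hasP[p pps fp]|/hasPn fr] := boolP (has (fun p => free p != [::]) ps).
    left; apply: ev2 r (NF1_pieces ok 1) => s rs hM; rewrite -finite_natZ.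
    by apply: (infinite_free rs pps _ fp (hM p pps)); case: (ok p pps).
  right; exists (\sum_(p <- ps) (binomial_poly (size (simp p)).-1 \Po
                                 map_poly intr (psize p))).
  apply: ev2 r (NF1_pieces ok 0) => s rs hM.
  have [|L [uL AL sL]] := rep_finite rs.
    move=> _ /mapP[p pps ->]; split; last exact: hM.
    by have := fr p pps; rewrite negbK => /eqP E; rewrite /pev /free /= -/(free p) E.
  exists (size L).
    rewrite sL big_map natr_sum horner_sum; apply: eq_big_seq => p pps.
    have [sp _] := ok p pps; have Mp := hM p pps.
    rewrite horner_comp horner_intr /piece_points size_map.
    have -> : simp (pev s p) = map (evm s) (simp p) by [].
    case: (simp p) sp => // w ws _; rewrite map_cons.
    rewrite size_simplex size_map -horner_binomial_poly.
    by congr _.[_]; rewrite -[(psize p).[_]](gez0_abs Mp).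
  by rewrite card_eq_sym -(card_eqr (card_natZ _)) AL card_eq_sym; exact: card_seq.
split.
  have [||x hx xq] := @eventually_quasi_polynomial_residues V unit
    (fun t g => finite_set (S t) -> S t #= `I_(g tt)) V0.
  - move=> t; have [[g hg]|nf] := pselect (finite_set (S t)); last by exists (fun=> 0%N).
    by exists (fun=> g).
  - move=> c /key[inf|[p hp]].
      exists (fun=> 0); apply: ev_mono inf => s nf; exists (fun=> 0%N).
      by split=> // j; rewrite horner0.
    by exists (fun=> p); apply: ev_mono hp => s [g gE hg]; exists (fun=> g).
  by exists (fun t => x t tt).
apply: (eventually_periodic_residues V0) => c /key[inf|[p hp]]; [by right|left].
by apply: ev_mono hp => s [g _ hg]; exists g.
Qed.

(** * Maximizing a linear form over pieces *)

Section Maximum.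
Variable c : 'rV[int]_d.

Definition cost (x : 'rV[int]_d) : int := clin x c^T.
Definition cost_poly (w : 'rV[{poly int}]_d) : {poly int} :=
  (w *m map_mx polyC c^T) 0 0.

Lemma horner_cost s w : (cost_poly w).[s%:Z] = cost (evm s w).
Proof. by rewrite -evmE evmM evmC. Qed.

Lemma costD x y : cost (x + y) = cost x + cost y.
Proof. by rewrite /cost /clin mulmxDl mxE. Qed.

Lemma costZ z x : cost (z *: x) = z * cost x.
Proof. by rewrite /cost /clin -scalemxAl mxE. Qed.

Lemma costMn x k : cost (x *+ k) = cost x *+ k.
Proof.
elim: k => [|k IH]; last by rewrite !mulrS costD IH.
by rewrite !mulr0n /cost /clin mul0mx mxE.
Qed.

Lemma cost_lc_le ms ws (mu : int) : (forall w, w \in ws -> cost w <= mu) ->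
  size ms = size ws -> cost (lc ms ws) <= (sumn ms)%:Z * mu.
Proof.
elim: ws ms => [|w ws IH] [|m ms] //= hw; first by rewrite /cost /clin mul0mx mxE mul0r.
case=> sz; rewrite costD costMn PoszD mulrDl; apply: lerD.
  by rewrite -mulr_natl natz ler_wpM2l // hw ?mem_head.
by apply: IH => // w' w'ws; apply: hw; rewrite inE w'ws orbT.
Qed.

Lemma max_poly (K : seq 'rV[{poly int}]_d) : K != [::] ->
  exists2 k, k \in K & forall k', k' \in K -> nonneg (cost_poly k - cost_poly k').
Proof.
elim: K => // k K IH _; have [->|/IH[k1 k1K hk1]] := eqVneq K [::].
  exists k; rewrite ?mem_head // => k'; rewrite inE => /eqP->.
  by rewrite subrr; exact: nonneg0.
have [h|h] : nonneg (cost_poly k - cost_poly k1) \/ nonneg (cost_poly k1 - cost_poly k).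
  case: (pos_trichotomy (cost_poly k - cost_poly k1)) => [/pos_nonneg|E|/pos_nonneg].
  - by left.
  - by left; rewrite E; exact: nonneg0.
  - by rewrite opprB; right.
  exists k; rewrite ?mem_head // => k'; rewrite inE => /orP[/eqP->|k'K].
    by rewrite subrr; exact: nonneg0.
  by have := nonnegD h (hk1 k' k'K); rewrite addrA subrK.
exists k1; rewrite ?inE ?k1K ?orbT // => k'; rewrite inE => /orP[/eqP->|] //.
exact: hk1.
Qed.

Lemma max_list (ws : seq 'rV[int]_d) : ws != [::] ->
  exists2 w, w \in ws & forall w', w' \in ws -> cost w' <= cost w.
Proof.
elim: ws => // w ws IH _; have [->|/IH[w1 w1s h]] := eqVneq ws [::].
  by exists w; rewrite ?mem_head // => w'; rewrite inE => /eqP->.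
have [le|/ltW le] := lerP (cost w1) (cost w).
  exists w; rewrite ?mem_head // => w'; rewrite inE => /orP[/eqP->//|/h].
  by move=> /le_trans; apply.
by exists w1; rewrite ?inE ?w1s ?orbT // => w'; rewrite inE => /orP[/eqP->//|/h].
Qed.

(** A free generator of eventually positive cost rules out a maximum. Otherwise the cost on each
    piece is largest at a corner, and among the finitely many corners of all pieces one is
    eventually the best, since polynomial costs are totally ordered as germs. *)
Lemma maximum_residue (ps : seq (piece {poly int} d)) (A : nat -> set 'rV[int]_d) :
  (forall p, p \in ps -> okp p) -> ev (fun s => rep (map (pev s) ps) (A s)) ->
  (exists k : 'rV[{poly int}]_d,
     ev (fun s => A s (evm s k) /\ forall x, A s x -> cost x <= cost (evm s k))) \/
  ev (fun s => ~ exists2 x, A s x & forall y, A s y -> cost y <= cost x).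
Proof.
move=> ok hr.
have [[p pps [v vp vpos]]|nv] := pselect (exists2 p, p \in ps &
    exists2 v, v \in free p & pos (cost_poly v)).
  right; apply: ev2 (ev_and hr (NF1_pieces ok 0)) vpos => s [r hM] v0 [x Ax hx].
  have cps : pev s p \in map (pev s) ps by exact: map_f.
  have vf : evm s v \in free (pev s p) by exact: map_f.
  have : inp (pev s p) (first_corner (pev s p)).
    apply: inp_corner; first exact: hM.
    have sc : simp (pev s p) != [::].
      by rewrite -size_eq0 size_map size_eq0; case: (ok p pps).
    by case: (simp _) sc => // w ws _; rewrite mem_head.
  move=> /(inp_free (absz (cost x - cost (first_corner (pev s p)))%R).+1 vf).
  move=> /(rep_in r cps)/hx; rewrite costD costMn.
  rewrite horner_cost in v0; rewrite -mulr_natl natz.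
  by move: (cost (evm s v)) v0 (cost x) (cost _) => u u0 a b; nia.
have [ps0|ps0] := eqVneq ps [::].
  by right; apply: ev_mono hr => s; rewrite ps0 => r [x /(rep_ex r)[]].
pose K := flatten [seq [seq corner p w | w <- simp p] | p <- ps].
have KP k : k \in K -> exists2 p, p \in ps & exists2 w, w \in simp p & k = corner p w.
  by move=> /flatten_mapP[p pps /mapP[w wp ->]]; exists p => //; exists w.
have inK p w : p \in ps -> w \in simp p -> corner p w \in K.
  by move=> pps wp; apply/flatten_mapP; exists p => //; exact: map_f.
have K0 : K != [::].
  have [p pps] : exists p, p \in ps.
    by case: (ps) ps0 => // p ps' _; exists p; rewrite mem_head.
  have [w wp] : exists w, w \in simp p.
    have [sp _] := ok p pps.
    by case: (simp p) sp => // w ws _; exists w; rewrite mem_head.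
  by apply/eqP => K0; have := inK p w pps wp; rewrite K0.
have [k kK hk] := max_poly K0; left; exists k.
have free_le : ev (fun s => forall p, p \in ps -> forall v, v \in free p ->
    cost (evm s v) <= 0).
  apply: ev_all => p pps; apply: ev_all => v vp.
  have : nonneg (- cost_poly v).
    case: (pos_trichotomy (cost_poly v)) => [h|->|/pos_nonneg //].
      by case: nv; exists p => //; exists v.
    by rewrite oppr0; exact: nonneg0.
  by apply: ev_mono => s; rewrite hornerN horner_cost oppr_ge0.
have hkE : ev (fun s => forall k', k' \in K -> cost (evm s k') <= cost (evm s k)).
  apply: ev_all => k' k'K; apply: ev_mono (hk k' k'K) => s.
  by rewrite hornerD hornerN !horner_cost subr_ge0.
apply: ev2 (ev_and hr (NF1_pieces ok 0)) (ev_and free_le hkE) => s [r hM] [fl hK].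
split.
  have [p pps [w wp ->]] := KP k kK.
  apply: (rep_in r (map_f (pev s) pps)); rewrite evm_corner.
  by apply: inp_corner; [exact: hM | exact: map_f].
move=> x /(rep_ex r)[_ /mapP[p pps ->] [ms [ns [[sz1 sz2 sM] ->]]]].
have [sp _] := ok p pps.
have [|w1 /mapP[w wp ->] hw] := @max_list (simp (pev s p)).
  by rewrite -size_eq0 size_map size_eq0.
have kw := hK _ (inK p w pps wp); apply: le_trans kw.
rewrite evm_corner /ppoint /corner !costD costZ.
have h1 := cost_lc_le hw sz1; have h2 : cost (lc ns (free (pev s p))) <= 0.
  rewrite -[X in _ <= X](mulr0 (sumn ns)%:Z); apply: cost_lc_le => // _ /mapP[v vp ->].
  exact: fl p pps v vp.
rewrite sM in h1; rewrite -[leRHS]addr0; apply: lerD => //.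
by rewrite lerD2l.
Qed.

End Maximum.

Lemma dot_cost c x : dot c x = cost c (natZ x).
Proof. by rewrite /cost clin_natZ. Qed.

Lemma NF_property3a : property3a S.
Proof.
move=> c _; have [V V0 h] := S_NF.
have maxE t y : is_max_at c (S t) y <-> [set natZ x | x in S t] (natZ y) /\
    forall x, [set natZ x | x in S t] x -> cost c x <= cost c (natZ y).
  rewrite /is_max_at; split=> [[Sy hy]|[[z Sz /natZ_inj zy] hx]].
    split; first by exists y.
    by move=> _ [x Sx <-]; rewrite -!dot_cost; exact: hy.
  rewrite -zy; split=> // x Sx; rewrite !dot_cost zy; apply: hx; by exists x.
have key r : (r < V)%N -> ev (fun s => ~ exists y, is_max_at c (S (V * s + r)%N) y) \/
    exists k : 'rV[{poly int}]_d, ev (fun s => exists2 y : 'rV[nat]_d,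
      natZ y = evm s k & is_max_at c (S (V * s + r)%N) y).
  move=> rV; have [ps ok hr] := h r rV.
  have [[k hk]|nk] := maximum_residue c ok hr.
    right; exists k; apply: ev_mono hk => s [[y Sy yk] hx]; exists y => //.
    by apply/maxE; rewrite yk; split=> //; exists y.
  left; apply: ev_mono nk => s nk [y /maxE[Ay hy]]; apply: nk.
  by exists (natZ y).
split.
  have [||x hx xq] := @eventually_quasi_polynomial_residues V 'I_d
    (fun t x => (exists y, is_max_at c (S t) y) -> is_max_at c (S t) (\row_j x j)) V0.
  - move=> t; have [[y hy]|ny] := pselect (exists y, is_max_at c (S t) y).
      exists (fun j => y 0 j) => _; suff -> : \row_j y 0 j = y by [].
      by apply/rowP => j; rewrite mxE.
    by exists (fun=> 0%N).
  - move=> r /key[no|[k hk]].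
      exists (fun=> 0); apply: ev_mono no => s ny; exists (fun=> 0%N).
      by split=> // j; rewrite horner0.
    exists (fun j => map_poly intr (k 0 j)); apply: ev_mono hk => s [y yk hy].
    exists (fun j => y 0 j); split.
      by move=> j; rewrite horner_intr -evmE -yk mxE.
    move=> _; suff -> : \row_j y 0 j = y by [].
    by apply/rowP => j; rewrite mxE.
  exists (fun t => \row_j x t j); first exact: hx.
  by move=> j; have := xq j; congr eventually_quasi_polynomial;
    apply/funext => t; rewrite mxE.
apply: (eventually_periodic_residues V0) => r /key[no|[k hk]]; [by right | left].
by apply: ev_mono hk => s [y _ hy]; exists y.
Qed.

End NormalFormProperties.

(** * Generating functions *)

Section Differences.
Variable d : nat.
Implicit Types (b q x : 'rV[int]_d) (F G : laurent d) (bs : seq 'rV[int]_d).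
Implicit Types (L : seq (rat * 'rV[int]_d)).

(* Multiplication by 1 - x^b. *)
Definition diff b F : laurent d := fun x => F x - F (x - b).
Definition diffs bs F : laurent d := foldr diff F bs.
Definition shift q F : laurent d := fun x => F (x - q).
Definition laurent_poly L : laurent d :=
  fun x => \sum_(a <- L) a.1 * monomial a.2 x.
Definition ladd F G : laurent d := fun x => F x + G x.
Definition lscale (a : rat) F : laurent d := fun x => a * F x.

Lemma diffC b b' F : diff b (diff b' F) = diff b' (diff b F).
Proof. by apply/funext => x; rewrite /diff [x - b - b']addrAC; ring. Qed.

Lemma diffs_diff bs b F : diffs bs (diff b F) = diff b (diffs bs F).
Proof. by elim: bs => //= b' bs ->; exact: diffC. Qed.

Lemma diffs_cat bs bs' F : diffs (bs ++ bs') F = diffs bs (diffs bs' F).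
Proof. exact: foldr_cat. Qed.

Lemma diffsC bs bs' F : diffs bs (diffs bs' F) = diffs bs' (diffs bs F).
Proof. by elim: bs' => //= b bs' IH; rewrite diffs_diff IH. Qed.

Lemma diffs_add bs F G : diffs bs (ladd F G) = ladd (diffs bs F) (diffs bs G).
Proof. by elim: bs => //= b bs ->; apply/funext => x; rewrite /diff /ladd; ring. Qed.

Lemma diffs_scale bs a F : diffs bs (lscale a F) = lscale a (diffs bs F).
Proof. by elim: bs => //= b bs ->; apply/funext => x; rewrite /diff /lscale; ring. Qed.

Lemma diffs_shift bs q F : diffs bs (shift q F) = shift q (diffs bs F).
Proof.
by elim: bs => //= b bs ->; apply/funext => x; rewrite /diff /shift addrAC.
Qed.

Lemma laurent_poly_cat L L' : laurent_poly (L ++ L') = ladd (laurent_poly L) (laurent_poly L').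
Proof. by apply/funext => x; rewrite /laurent_poly big_cat. Qed.

Lemma laurent_poly_scale a L :
  lscale a (laurent_poly L) = laurent_poly [seq (a * u.1, u.2) | u <- L].
Proof.
by apply/funext => x; rewrite /laurent_poly /lscale big_map mulr_sumr;
  apply: eq_bigr => u _; rewrite mulrA.
Qed.

Lemma laurent_poly_shift q L :
  shift q (laurent_poly L) = laurent_poly [seq (u.1, u.2 + q) | u <- L].
Proof.
apply/funext => x; rewrite /laurent_poly /shift big_map.
by apply: eq_bigr => u _; rewrite /monomial /= subr_eq.
Qed.

Lemma diff_laurent_poly b L : diff b (laurent_poly L) =
  laurent_poly (L ++ [seq (- u.1, u.2 + b) | u <- L]).
Proof.
have -> : [seq (- u.1, u.2 + b) | u <- L] =
    [seq (-1 * u.1, u.2) | u <- [seq (u.1, u.2 + b) | u <- L]].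
  by rewrite -map_comp; apply: eq_map => u /=; rewrite mulN1r.
rewrite laurent_poly_cat -laurent_poly_scale -laurent_poly_shift.
by apply/funext => x; rewrite /diff /ladd /lscale mulN1r.
Qed.

End Differences.

Lemma lex_sign d (b : 'rV[{poly int}]_d) : b != 0 ->
  ev (fun s => lex_positive (evm s b)) \/ ev (fun s => lex_positive (evm s (- b))).
Proof.
move=> b0; have [i0 bi0] := rv_neq0 b0.
case: (@arg_minnP _ i0 (fun i => b 0 i != 0) (fun i : 'I_d => i : nat) bi0) => i bi hi.
have h0 (j : 'I_d) : (j < i)%N -> b 0 j = 0.
  by move=> ji; apply/eqP; apply: contraTT ji; rewrite -leqNgt; exact: hi.
case: (pos_trichotomy (b 0 i)) => [h|/eqP|h]; [left| by rewrite (negPf bi)|right];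
  apply: ev_mono h => s hs; exists i => [|j ji]; rewrite ?evmE //.
- by rewrite h0 // horner0.
- by rewrite mxE.
- by rewrite mxE h0 // oppr0 horner0.
Qed.

(** * Series turned into Laurent polynomials by finitely many operators *)

Section Annihilated.
Variable d : nat.
Implicit Types (F G : nat -> laurent d) (b q : 'rV[{poly int}]_d).

Definition evc s (L : seq (rat * 'rV[{poly int}]_d)) : seq (rat * 'rV[int]_d) :=
  [seq (a.1, evm s a.2) | a <- L].

(** [bs] and [L] are chosen before [s]: this is the uniformity that Property 4 demands of
    denominator and numerator. *)
Definition annihilated F : Prop :=
  exists (bs : seq 'rV[{poly int}]_d) (L : seq (rat * 'rV[{poly int}]_d)),
    (forall b, b \in bs -> ev (fun s => lex_positive (evm s b))) /\
    ev (fun s => diffs (map (evm s) bs) (F s) = laurent_poly (evc s L)).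

Lemma annihilated_ext F G : ev (fun s => F s = G s) -> annihilated F -> annihilated G.
Proof.
move=> h [bs [L [pb hL]]]; exists bs, L; split=> //.
by apply: ev2 h hL => s ->.
Qed.

Lemma annihilated_poly L : annihilated (fun s => laurent_poly (evc s L)).
Proof. by exists [::], L; split=> //; exact: evT. Qed.

Lemma annihilated_shift F q : annihilated F -> annihilated (fun s => shift (evm s q) (F s)).
Proof.
move=> [bs [L [pb hL]]]; exists bs, [seq (u.1, u.2 + q) | u <- L]; split=> //.
apply: ev_mono hL => s h; rewrite diffs_shift h laurent_poly_shift /evc -!map_comp.
by congr laurent_poly; apply: eq_map => u /=; rewrite evmD.
Qed.

Lemma annihilated_scale F a : annihilated F -> annihilated (fun s => lscale a (F s)).
Proof.
move=> [bs [L [pb hL]]]; exists bs, [seq (a * u.1, u.2) | u <- L]; split=> //.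
apply: ev_mono hL => s h; rewrite diffs_scale h laurent_poly_scale /evc -!map_comp.
by congr laurent_poly; apply: eq_map => u.
Qed.

Lemma diffs_evc bs L : exists L', forall s,
  diffs (map (evm s) bs) (laurent_poly (evc s L)) = laurent_poly (evc s L').
Proof.
elim: bs => [|b bs [L' h]]; first by exists L.
exists (L' ++ [seq (- u.1, u.2 + b) | u <- L']) => s /=.
rewrite h diff_laurent_poly /evc map_cat -!map_comp.
by congr (laurent_poly (_ ++ _)); apply: eq_map => u /=; rewrite evmD.
Qed.

Lemma annihilated_add F G : annihilated F -> annihilated G ->
  annihilated (fun s => ladd (F s) (G s)).
Proof.
move=> [bs [L [pb hL]]] [bs' [L' [pb' hL']]].
have [K hK] := diffs_evc bs' L; have [K' hK'] := diffs_evc bs L'.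
exists (bs ++ bs'), (K ++ K'); split.
  by move=> b; rewrite mem_cat => /orP[/pb|/pb'].
apply: ev2 hL hL' => s h h'.
rewrite map_cat diffs_cat !diffs_add h' hK' diffsC h hK.
by rewrite /evc map_cat laurent_poly_cat.
Qed.

(** If [- b] is the lexicographically positive one, [1 - x^(-b) = - x^(-b) (1 - x^b)] exchanges the
    operators up to a shift and a sign. *)
Lemma annihilated_diff F b : b != 0 ->
  annihilated (fun s => diff (evm s b) (F s)) -> annihilated F.
Proof.
have lexp b' : ev (fun s => lex_positive (evm s b')) ->
    annihilated (fun s => diff (evm s b') (F s)) -> annihilated F.
  move=> hb [bs [L [pb hL]]]; exists (rcons bs b'), L; split.
    by move=> b2; rewrite mem_rcons inE => /orP[/eqP->//|/pb].
  by apply: ev_mono hL => s <-; rewrite map_rcons -cats1 diffs_cat.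
move=> b0 hF; have [hb|hb] := lex_sign b0; first exact: lexp hb hF.
apply: (lexp _ hb).
apply: annihilated_ext (annihilated_shift (- b) (annihilated_scale (-1) hF)).
apply: evT => s; apply/funext => x; rewrite evmN /shift /lscale /diff !opprK addrK.
by rewrite mulN1r opprB.
Qed.

Lemma annihilated_sum (I : eqType) (r : seq I) (Fs : I -> nat -> laurent d) :
  (forall i, i \in r -> annihilated (Fs i)) ->
  annihilated (fun s x => \sum_(i <- r) Fs i s x).
Proof.
elim: r => [|i r IH] h.
  apply: annihilated_ext (annihilated_poly [::]); apply: evT => s.
  by apply/funext => x; rewrite /laurent_poly !big_nil.
apply: annihilated_ext (annihilated_add (h i (mem_head _ _))
  (IH (fun j jr => h j (mem_behead (s := i :: r) jr)))).
by apply: evT => s; apply/funext => x; rewrite big_cons.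
Qed.

End Annihilated.

Section SimplexSeries.
Variable d : nat.
Implicit Types (x w : 'rV[int]_d) (ws : seq 'rV[int]_d).

Definition simplex_count ws M x : nat := count_mem x (simplex ws M).

Lemma simplex_countS w ws M x : simplex_count (w :: ws) M.+1 x =
  (simplex_count ws M.+1 x + simplex_count (w :: ws) M (x - w)%R)%N.
Proof.
rewrite /simplex_count simplexS count_cat count_map; congr (_ + _)%N.
by apply: eq_count => y /=; rewrite -subr_eq opprK addrC.
Qed.

(** Complete homogeneous sums are symmetric, so the recursion defining [simplex] on the first
    generator is also valid on the last. *)
Lemma simplex_count_rcons ws w M x : simplex_count (rcons ws w) M.+1 x =
  (simplex_count ws M.+1 x + simplex_count (rcons ws w) M (x - w)%R)%N.
Proof.
elim: ws M x => [|u ws IH] M x /=; first exact: simplex_countS.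
elim: M x => [|M IHM] x.
  rewrite !simplex_countS IH /simplex_count !simplex0; lia.
rewrite (simplex_countS u (rcons ws w)) IH (IHM (x - u)) (simplex_countS u ws _ x).
rewrite (simplex_countS u (rcons ws w) M (x - w)) [x - u - w]addrAC.
by rewrite -!addnA; congr addn; rewrite addnCA; congr addn; exact: addnCA.
Qed.

End SimplexSeries.

Section PieceSeries.
Variable d : nat.

(** The identity comes from expanding [h_(M+1)(w0, ..., wk)] at its first and at its last generator
    and comparing. It raises the degree to [M + 1] while removing a generator, so the induction on
    the number of generators is over all [M]. A single generator gives the monomial [x^(M w0)]. *)
Lemma annihilated_simplex (ws : seq 'rV[{poly int}]_d) (M : {poly int}) :
  uniq ws -> ws != [::] -> nonneg M ->
  annihilated (fun s x => (simplex_count (map (evm s) ws) (absz M.[s%:Z]) x)%:R).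
Proof.
have [N] := ubnP (size ws); elim: N ws M => // N IH ws M.
case: ws => // w0 ws; case/lastP: ws => [|ws wk].
  move=> _ _ _ M0; apply: annihilated_ext (annihilated_poly [:: (1, M *: w0)]).
  apply: ev_mono M0 => s M0; apply/funext => x.
  rewrite /laurent_poly big_seq1 mul1r /monomial /=; congr (_%:R).
  rewrite evmZ -[in LHS](gez0_abs M0); elim: (absz _) x => [|K IHK] x.
    by rewrite /simplex_count simplex0 /= addn0 scale0r eq_sym.
  rewrite simplex_countS -IHK /simplex_count /= add0n.
  by congr nat_of_bool; rewrite subr_eq intS scalerDl scale1r addrC.
rewrite -rcons_cons => Nw uw _ M0.
have M1 : nonneg (M + 1).
  by apply: ev_mono M0 => s; rewrite hornerD hornerC; lia.
have b0 : wk - w0 != 0.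
  by move: uw; rewrite rcons_uniq inE negb_or subr_eq0 => /andP[/andP[]].
apply: (annihilated_diff b0).
have sN : (size (w0 :: ws) < N)%N by move: Nw; rewrite size_rcons.
have u1 : uniq (w0 :: ws) by move: uw; rewrite rcons_uniq => /andP[].
have u2 : uniq (rcons ws wk) by move: uw; rewrite rcons_cons => /andP[].
have A1 := IH (w0 :: ws) _ sN u1 isT M1.
have A2 : annihilated (fun s x =>
    (simplex_count (map (evm s) (rcons ws wk)) (absz (M + 1).[s%:Z]) x)%:R).
  by apply: IH => //; rewrite ?size_rcons // -size_eq0 size_rcons.
apply: annihilated_ext (annihilated_shift (- w0)
  (annihilated_add A1 (annihilated_scale (-1) A2))).
apply: ev_mono M0 => s M0; apply/funext => y.
rewrite /shift /ladd /lscale /diff mulN1r evmN opprK.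
have -> : absz (M + 1).[s%:Z] = (absz M.[s%:Z]).+1 by rewrite hornerD hornerC; lia.
move: (absz M.[_]) => K; rewrite evmD evmN.
pose G := simplex_count (map (evm s) (w0 :: rcons ws wk)) K.
have e1 : simplex_count (map (evm s) (w0 :: rcons ws wk)) K.+1 (y + evm s w0) =
    (simplex_count (map (evm s) (rcons ws wk)) K.+1 (y + evm s w0) + G y)%N.
  by rewrite [LHS](simplex_countS _ (map (evm s) (rcons ws wk))) addrK.
have e2 : simplex_count (map (evm s) (w0 :: rcons ws wk)) K.+1 (y + evm s w0) =
    (simplex_count (map (evm s) (w0 :: ws)) K.+1 (y + evm s w0) +
     G (y - (evm s wk - evm s w0))%R)%N.
  have := simplex_count_rcons (map (evm s) (w0 :: ws)) (evm s wk) K (y + evm s w0).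
  by rewrite -map_rcons rcons_cons opprB [y + (_ - _)]addrA.
have : (simplex_count (map (evm s) (rcons ws wk)) K.+1 (y + evm s w0) + G y)%N%:R =
    (simplex_count (map (evm s) (w0 :: ws)) K.+1 (y + evm s w0) +
     G (y - (evm s wk - evm s w0))%R)%N%:R :> rat by rewrite -e1 e2.
rewrite rcons_cons !natrD -/G => E.
by apply/eqP; rewrite subr_eq addrAC [(G y)%:R + _]addrC E addrK.
Qed.

(** Putting the multiplicity [M] on either of two equal generators would give the same point.
    Distinctness makes the exponent [wk - w0] of the operators nonzero. *)
Lemma simplex_gens_uniq (ws : seq 'rV[int]_d) M : (0 < M)%N ->
  injective_simplex ws M -> uniq ws.
Proof.
move=> M0; elim: ws => //= w ws IH inj; apply/andP; split; last first.
  apply: IH => ms ms' sz sz' sM sM' E.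
  have [] : 0%N :: ms = 0%N :: ms' by apply: inj; rewrite /= ?sz ?sz' //= !mulr0n !add0r.
  by [].
apply/negP => wws; have [a [c E]] : exists a c, ws = a ++ w :: c.
  by case/splitPr: wws => a c; exists a, c.
have : M :: nseq (size ws) 0%N = 0%N :: nseq (size a) 0%N ++ M :: nseq (size c) 0%N.
  apply: inj; rewrite /= ?size_nseq ?E ?size_cat /= ?size_nseq ?sumn_cat //=
    ?sumn_nseq ?mul0n ?addn0 //.
  by rewrite lc_cat ?size_nseq //= !lc_nseq0 !addr0 mulr0n !add0r.
by case=> M00; rewrite M00 in M0.
Qed.

Definition pind s (p : piece {poly int} d) : laurent d :=
  fun x => (`[<inp (pev s p) x>] : bool)%:R.

(** For a free generator [v], the operator [1 - x^v] leaves the points whose coefficient of [v] is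
    0, that is the piece with [v] removed; the simplex remains at the end. *)
Lemma annihilated_piece p : okp p -> ev (fun s => pinj (pev s p)) ->
  annihilated (fun s => pind s p).
Proof.
case: p => [[[b ws] vs] M] [ws0 unb].
have {}ws0 : ws != [::] := ws0.
have {}unb : forall C : int, ev (fun s => C <= M.[s%:Z]) := unb.
elim: vs => [|v vs IH] inj.
  have M0 : nonneg M := unb 0.
  (* Polynomial vectors are distinct as soon as their values at one [T] are. *)
  have [T hT] := ev_and inj (unb 1).
  have uw : uniq ws.
    have [ci M1] := hT T (leqnn T); apply: (@map_uniq _ _ (evm T)).
    have M1' : (0 < absz M.[T%:Z])%N by lia.
    apply: (simplex_gens_uniq M1') => ms ms' sz sz' sM sM' E.
    have val m : size m = size (map (evm T) ws) -> sumn m = absz M.[T%:Z] ->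
        valid (pev T (b, ws, [::], M)) m [::].
      by move=> h1 h2; split=> //; rewrite h2 gez0_abs //; lia.
    have [|-> _] := ci _ _ _ _ (val _ sz sM) (val _ sz' sM') => //.
    by rewrite /ppoint E.
  apply: annihilated_ext (annihilated_shift b (annihilated_simplex uw ws0 M0)).
  apply: ev2 inj M0 => s ci M0; apply/funext => x; rewrite /shift /pind; congr (_%:R).
  have fr : free (pev s (b, ws, [::], M)) = [::] by [].
  have := piece_points_uniq fr M0 ci; rewrite /piece_points.
  rewrite (map_inj_uniq (addrI _)) => us; rewrite /simplex_count count_uniq_mem //.
  congr nat_of_bool; apply/idP/asboolP => [h|/(mem_piece_points x fr M0)].
    apply/(mem_piece_points x fr M0); apply/mapP; exists (x - evm s b) => //.
    by rewrite /= addrC subrK.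
  by move=> /mapP[y hy ->]; rewrite /= addrC addKr.
have inj' : ev (fun s => pinj (pev s (b, ws, vs, M))).
  apply: ev_mono inj => s ci ms ns ms' ns' [h1 h2 h3] [h1' h2' h3'] E.
  have v1 : valid (pev s (b, ws, v :: vs, M)) ms (0%N :: ns).
    by split=> //=; rewrite h2.
  have v2 : valid (pev s (b, ws, v :: vs, M)) ms' (0%N :: ns').
    by split=> //=; rewrite h2'.
  have [|-> [->]] := ci _ _ _ _ v1 v2 => //.
  by move: E; rewrite /ppoint /= !mulr0n !add0r.
have v0 : v != 0.
  have [T hT] := ev_and inj (unb 1); have [ci M1] := hT T (leqnn T).
  have nc : ~~ single (pev T (b, ws, v :: vs, M)) by rewrite /single andbF.
  have sc : simp (pev T (b, ws, v :: vs, M)) != [::].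
    by rewrite -size_eq0 size_map size_eq0.
  have := direction_neq0 ci sc nc M1; apply: contra_neq => v0.
  by rewrite /direction /= v0 evm0.
apply: (annihilated_diff v0); apply: annihilated_ext (IH inj').
apply: ev_mono inj => s ci; apply/funext => x; rewrite /diff /pind.
have pE ms k ns : ppoint (pev s (b, ws, v :: vs, M)) ms (k :: ns) =
    ppoint (pev s (b, ws, vs, M)) ms ns + evm s v *+ k.
  by rewrite /ppoint /= -!addrA [evm s v *+ k + _]addrC.
have vE ms k ns : valid (pev s (b, ws, v :: vs, M)) ms (k :: ns) <->
    valid (pev s (b, ws, vs, M)) ms ns.
  rewrite /valid /=; split=> [[h1 [h2] h3]|[h1 h2 h3]] //.
  by split=> //; rewrite h2.
have xE : inp (pev s (b, ws, v :: vs, M)) x <->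
    inp (pev s (b, ws, vs, M)) x \/ inp (pev s (b, ws, v :: vs, M)) (x - evm s v).
  split.
    move=> [ms [[|k ns] [hv ->]]]; first by case: hv.
    case: k hv => [|k] hv.
      by left; exists ms, ns; rewrite pE mulr0n addr0; split=> //; exact/vE/hv.
    right; exists ms, (k :: ns); split; first exact/vE/(vE _ k.+1).
    by rewrite !pE mulrSr addrA addrK.
  move=> [[ms [ns [hv ->]]]|].
    by exists ms, (0%N :: ns); rewrite pE mulr0n addr0; split=> //; exact/vE.
  move=> [ms [[|k ns] [hv E]]]; first by case: hv.
  exists ms, (k.+1 :: ns); split; first exact/vE/(vE _ k).
  by rewrite pE mulrSr addrA -pE -E subrK.
have dis : inp (pev s (b, ws, vs, M)) x ->
    inp (pev s (b, ws, v :: vs, M)) (x - evm s v) -> False.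
  move=> [ms [ns [hv xv]]] [ms' [[|k ns'] [hv' E]]]; first by case: hv'.
  have v1 : valid (pev s (b, ws, v :: vs, M)) ms (0%N :: ns) by exact/vE.
  have v2 : valid (pev s (b, ws, v :: vs, M)) ms' (k.+1 :: ns') by exact/vE/(vE _ k).
  have [|_ //] := ci _ _ _ _ v1 v2.
  by rewrite !pE mulr0n addr0 -xv mulrSr addrA -pE -E subrK.
case: (asboolP (inp (pev s (b, ws, vs, M)) x)) => h1;
  case: (asboolP (inp (pev s (b, ws, v :: vs, M)) (x - evm s v))) => h2.
- by case: (dis h1 h2).
- by rewrite asboolT ?subr0 //; apply/xE; left.
- by rewrite asboolT ?subrr //; apply/xE; right.
- by rewrite asboolF ?subr0 // => /xE[].
Qed.

Lemma annihilated_rep ps (A : nat -> set 'rV[int]_d) :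
  (forall p, p \in ps -> okp p) -> ev (fun s => rep (map (pev s) ps) (A s)) ->
  annihilated (fun s x => (`[<A s x>] : bool)%:R).
Proof.
move=> ok hr; apply: annihilated_ext (@annihilated_sum d _ ps (fun p s => pind s p) _).
  apply: ev_mono hr => s r; apply/funext => x.
  by rewrite (r.1 x) big_map natr_sum.
move=> p pps; apply: annihilated_piece; first exact: ok.
by apply: ev_mono hr => s r; apply: r.2; exact: map_f.
Qed.

End PieceSeries.

Lemma fsbigT_seq (T : choiceType) (r : seq T) (f : T -> rat) : uniq r ->
  (forall i, i \notin r -> f i = 0) -> \sum_(i \in [set: T]) f i = \sum_(i <- r) f i.
Proof.
move=> ur h; rewrite (fsbig_seq _ f ur); apply/esym/fsbig_widen => // i [_ /= ir].
by apply: h; exact/negP.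
Qed.

Lemma generating_functionE d (A : set 'rV[nat]_d) s :
  generating_function A s = (`[<[set natZ x | x in A] s>] : bool)%:R.
Proof.
rewrite /generating_function; case: asboolP => [[y Ay <-]|nA]; last first.
  rewrite fsbig1 // => y Ay; rewrite /monomial; case: eqP => // sy.
  by case: nA; exists y.
rewrite -(fsbig_widen [set y]) ?fsbig_set1 /monomial ?eqxx //.
  by move=> z /= ->.
move=> z [_ /= zy]; case: eqP => // /natZ_inj yz; by case: zy.
Qed.

(** * Uniqueness of expansions in a half-space *)

Section HalfSpace.
Variables (d : nat) (la : 'cV[int]_d).
Implicit Types (F G E : laurent d) (b q : 'rV[int]_d) (bs : seq 'rV[int]_d).

(** The algebraic substitute for convergence: going back along any [b] on which [la] is positive
    leaves the support after finitely many steps, so products with [geometric b] are finite sums. *)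
Definition bounded_below F : Prop := exists C : nat, forall x, F x != 0 -> - C%:Z <= clin x la.

Lemma clinD x y : clin (x + y) la = clin x la + clin y la.
Proof. by rewrite /clin mulmxDl mxE. Qed.

Lemma clinN x : clin (- x) la = - clin x la.
Proof. by rewrite /clin mulNmx mxE. Qed.

Lemma clinMn x k : clin (x *+ k) la = clin x la *+ k.
Proof.
elim: k => [|k IH]; last by rewrite !mulrS clinD IH.
by rewrite !mulr0n /clin mul0mx mxE.
Qed.

Lemma bounded_below_vanish F b x : bounded_below F -> 0 < clin b la ->
  exists N, forall n, (N <= n)%N -> F (x - b *+ n) = 0.
Proof.
move=> [C hC] b0; exists (absz (clin x la) + C).+1 => n hn.
apply/eqP; apply: contraTT isT => /hC; rewrite clinD clinN clinMn -mulr_natr natz.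
by move: (clin x la) (clin b la) b0 hn => u v; nia.
Qed.

Lemma geometric_mulE b G x N : b != 0 -> (forall n, (N <= n)%N -> G (x - b *+ n) = 0) ->
  laurent_mul (geometric b) G x = \sum_(n < N) G (x - b *+ n).
Proof.
move=> b0 hN; pose r := [seq b *+ n | n <- iota 0 N].
have ur : uniq r by rewrite map_inj_uniq ?iota_uniq // => i j; exact: ray_inj.
have gE n : geometric b (b *+ n) = 1.
  rewrite /geometric (@fsbigT_seq _ [:: n]) // => [|i ni].
    by rewrite big_seq1 /monomial eqxx.
  rewrite /monomial; case: eqP => // /(ray_inj b0) E.
  by rewrite E inE eqxx in ni.
rewrite /laurent_mul (fsbigT_seq ur) => [|u ur'].
  rewrite big_map -(big_mkord xpredT (fun n => G (x - b *+ n))) /index_iota subn0.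
  by apply: eq_bigr => n _; rewrite gE mul1r.
have [[n un]|nn] := pselect (exists n, u = b *+ n).
  rewrite un hN ?mulr0 // leqNgt; apply: contra ur' => nN.
  by rewrite un; apply/mapP; exists n; rewrite ?mem_iota.
rewrite /geometric fsbig1 ?mul0r // => n _; rewrite /monomial; case: eqP => // un.
by case: nn; exists n.
Qed.

Lemma pos_neq0 b : 0 < clin b la -> b != 0.
Proof. by apply: contraTneq => ->; rewrite /clin mul0mx mxE ltxx. Qed.

Lemma bounded_below_geometric b G : 0 < clin b la -> bounded_below G ->
  bounded_below (laurent_mul (geometric b) G).
Proof.
move=> b0 bG; have [C hC] := bG; exists C => x.
have [N hN] := bounded_below_vanish x bG b0.
rewrite (geometric_mulE (pos_neq0 b0) hN) => nz.
have [n Gn] : exists n : 'I_N, G (x - b *+ n) != 0.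
  apply/existsP; apply: contraNT nz; rewrite negb_exists => /forallP h.
  by rewrite big1 // => n _; apply/eqP; rewrite -[_ == _]negbK.
have := hC _ Gn; rewrite clinD clinN clinMn -mulr_natr natz => h.
have : 0 <= clin b la * n%:Z by rewrite mulr_ge0 // ltW.
by move: h; move: (clin x la) (clin b la * _) => u v; lia.
Qed.

Lemma diff_geometric b G : 0 < clin b la -> bounded_below G ->
  diff b (laurent_mul (geometric b) G) = G.
Proof.
move=> b0 bG; apply/funext => x; rewrite /diff.
have [N hN] := bounded_below_vanish (x - b) bG b0.
have b1 := pos_neq0 b0.
rewrite (geometric_mulE b1 hN) (@geometric_mulE _ _ _ N.+1 b1); last first.
  by move=> [//|n] nN; rewrite mulrS opprD addrA; exact: hN.
rewrite big_ord_recl mulr0n subr0.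
under eq_bigr do rewrite lift0 mulrS opprD addrA.
by rewrite addrK.
Qed.

Lemma bounded_below_diff b F : 0 < clin b la -> bounded_below F -> bounded_below (diff b F).
Proof.
move=> b0 [C hC]; exists C => x; rewrite /diff.
have [F0|/hC //] := eqVneq (F x) 0.
rewrite F0 sub0r oppr_eq0 => /hC; rewrite clinD clinN.
by move: (clin x la) (clin b la) b0 => u v; lia.
Qed.

Lemma bounded_below_diffs bs F : (forall b, b \in bs -> 0 < clin b la) ->
  bounded_below F -> bounded_below (diffs bs F).
Proof.
elim: bs => //= b bs IH h bF; apply: bounded_below_diff; first by rewrite h ?mem_head.
by apply: IH => // b' b'bs; apply: h; rewrite inE b'bs orbT.
Qed.

(** Equality of the differences makes [F - G] invariant under translation by [b], and far enough
    back both series vanish. *)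
Lemma diff_inj b F G : 0 < clin b la -> bounded_below F -> bounded_below G ->
  diff b F = diff b G -> F = G.
Proof.
move=> b0 bF bG E; apply/funext => x.
have step y : F y - G y = F (y - b) - G (y - b).
  have := congr1 (fun H : laurent d => H y) E; rewrite /diff => h.
  apply/eqP; rewrite -subr_eq0; apply/eqP; rewrite -[RHS](subrr (F y - F (y - b))).
  by rewrite {2}h; ring.
have stepn n : F x - G x = F (x - b *+ n) - G (x - b *+ n).
  elim: n => [|n ->]; first by rewrite mulr0n subr0.
  by rewrite step mulrSr opprD addrA.
have [N hN] := bounded_below_vanish x bF b0.
have [N' hN'] := bounded_below_vanish x bG b0.
apply/eqP; rewrite -subr_eq0 (stepn (maxn N N')) hN ?leq_maxl //.
by rewrite hN' ?leq_maxr // subrr.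
Qed.

Lemma diffs_inj bs F G : (forall b, b \in bs -> 0 < clin b la) ->
  bounded_below F -> bounded_below G -> diffs bs F = diffs bs G -> F = G.
Proof.
elim: bs => //= b bs IH h bF bG E.
have hbs b' : b' \in bs -> 0 < clin b' la by move=> ?; apply: h; rewrite inE orbC; apply/orP; left.
apply: IH => //; apply: (diff_inj (h b (mem_head _ _)) _ _ E);
  exact: bounded_below_diffs.
Qed.

Lemma bounded_below_product bs : (forall b, b \in bs -> 0 < clin b la) ->
  bounded_below (\big[@laurent_mul d/monomial 0]_(b <- bs) geometric b) /\
  diffs bs (\big[@laurent_mul d/monomial 0]_(b <- bs) geometric b) = monomial 0.
Proof.
elim: bs => [|b bs IH] h.
  rewrite big_nil; split=> //; exists 0%N => x; rewrite /monomial.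
  have [-> _|_] := eqVneq x 0; last by rewrite eqxx.
  by rewrite /clin mul0mx mxE.
have [b1 b2] := IH (fun b' b'bs => h b' (mem_behead (s := b :: bs) b'bs)).
have b0 := h b (mem_head _ _); rewrite big_cons; split.
  exact: bounded_below_geometric.
by rewrite /= -diffs_diff diff_geometric.
Qed.

Lemma laurent_poly_mulE (L : seq (rat * 'rV[int]_d)) E :
  laurent_mul (laurent_poly L) E = fun x => \sum_(a <- L) a.1 * shift a.2 E x.
Proof.
apply/funext => x; rewrite /laurent_mul.
rewrite (@fsbigT_seq _ (undup (map snd L))) ?undup_uniq // => [|u]; last first.
  rewrite mem_undup => uL; rewrite /laurent_poly big_seq big1 ?mul0r // => a aL.
  rewrite /monomial; case: eqP => [ua|]; last by rewrite mulr0.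
  by case/negP: uL; rewrite ua; exact: map_f.
under eq_bigr do rewrite /laurent_poly mulr_suml.
rewrite exchange_big /=; apply: eq_big_seq => a aL.
rewrite (bigD1_seq a.2) ?undup_uniq //=; last by rewrite mem_undup; exact: map_f.
rewrite /monomial eqxx mulr1 big1 ?addr0 // => u /negPf ua.
by rewrite ua mulr0 mul0r.
Qed.

Lemma bounded_below_shift q F : bounded_below F -> bounded_below (shift q F).
Proof.
move=> [C hC]; exists (C + absz (clin q la))%N => x /hC; rewrite clinD clinN.
by move: (clin x la) (clin q la) => u v; lia.
Qed.

(** Both sides are bounded below and become [laurent_poly L] under the same operators, which are
    injective on such series. *)
Lemma expansion_unique bs L F : (forall b, b \in bs -> 0 < clin b la) ->
  bounded_below F -> diffs bs F = laurent_poly L ->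
  F = laurent_mul (laurent_poly L)
        (\big[@laurent_mul d/monomial 0]_(b <- bs) geometric b).
Proof.
move=> h bF FL; have [bE dE] := bounded_below_product h.
set E := \big[_/_]_(b <- bs) _ in bE dE *; rewrite laurent_poly_mulE.
apply: (diffs_inj h bF).
  elim: (L) => [|a L' [C hC]].
    by exists 0%N => x; rewrite big_nil eqxx.
  have [C' hC'] := bounded_below_shift a.2 bE; exists (C + C')%N => x.
  rewrite big_cons; have [F0|F0] := eqVneq (\sum_(j <- L') j.1 * shift j.2 E x) 0.
    rewrite F0 addr0 mulf_eq0 negb_or => /andP[_ /hC'].
    by move: (clin x la) => u; lia.
  by move=> _; have := hC x F0; move: (clin x la) => u; lia.
rewrite FL; elim: (L) => [|a L' IH].
  have -> : (fun x => \sum_(a <- [::]) a.1 * shift a.2 E x) = lscale 0 E.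
    by apply/funext => x; rewrite big_nil /lscale mul0r.
  by rewrite diffs_scale; apply/funext => x; rewrite /lscale mul0r /laurent_poly big_nil.
have -> : (fun x => \sum_(j <- a :: L') j.1 * shift j.2 E x) =
    ladd (lscale a.1 (shift a.2 E)) (fun x => \sum_(j <- L') j.1 * shift j.2 E x).
  by apply/funext => x; rewrite big_cons.
rewrite diffs_add diffs_scale diffs_shift dE -IH -cat1s laurent_poly_cat.
congr ladd; apply/funext => x; rewrite /laurent_poly big_seq1 /lscale /shift /monomial.
by rewrite subr_eq0.
Qed.

End HalfSpace.

(** Induction on the dimension: vectors with first coordinate 0 are handled by a functional on the
    tails, and a large weight on the first coordinate settles the others. Nonnegative entries are
    required so that series supported on natural vectors are bounded below. *)
Lemma lex_functional d (bs : seq 'rV[int]_d) : (forall b, b \in bs -> lex_positive b) ->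
  exists la : 'cV[int]_d, (forall i, 0 <= la i 0) /\
    forall b, b \in bs -> 0 < clin b la.
Proof.
elim: d bs => [|d IH] bs h.
  by exists 0; split=> [[]|b /h[[]]].
pose tl (b : 'rV[int]_d.+1) : 'rV[int]_d := @rsubmx _ 1 1 d b.
pose hd (b : 'rV[int]_d.+1) : int := @lsubmx _ 1 1 d b 0 0.
have hdE b : hd b = b 0 ord0 by rewrite /hd mxE; congr (b 0 _); apply: val_inj.
have tlE b i : tl b 0 i = b 0 (lift ord0 i).
  by rewrite /tl mxE; congr (b 0 _); apply: val_inj.
have [|la' [la0 hla]] := IH [seq tl b | b <- bs & hd b == 0].
  move=> _ /mapP[b + ->]; rewrite mem_filter => /andP[/eqP b0 /h[i bi hi]].
  case: (unliftP ord0 i) bi hi => [j ->|->] bi hi; last by rewrite -hdE b0 in bi.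
  by exists j => [|k kj]; rewrite tlE // hi.
(* [K] exceeds every tail value, and a nonzero first coordinate of a lexicographically positive
   vector is at least 1. *)
pose K := (\sum_(b <- bs) absz (clin (tl b) la')).+1.
pose la : 'cV[int]_(1 + d) := col_mx (const_mx K%:Z : 'M_1) la'.
have laE b : clin b la = hd b * K%:Z + clin (tl b) la'.
  rewrite /clin -[b in LHS](@hsubmxK _ 1 1 d) mul_row_col mxE; congr (_ + _).
  by rewrite mxE big_ord1 [const_mx _ 0 0]mxE.
have la_ge0 (i : 'I_(1 + d)) : 0 <= la i 0.
  by case: (split_ordP i) => j ->; rewrite /la ?col_mxEu ?col_mxEd ?la0 // mxE.
exists la; split; first exact: la_ge0.
move=> b bb; rewrite laE; have [b0|b0] := eqVneq (hd b) 0.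
  rewrite b0 mul0r add0r; apply: hla; apply: map_f.
  by rewrite mem_filter b0 eqxx.
have hp : 0 < hd b.
  have [i bi hi] := h b bb; case: (unliftP ord0 i) bi hi => [j ->|->] bi hi.
    by case/eqP: b0; rewrite hdE hi.
  by rewrite hdE.
have : (absz (clin (tl b) la') < K)%N by rewrite /K (big_rem b) //= ltnS leq_addr.
by move: (clin (tl b) la') (hd b) hp => u v v0; nia.
Qed.

Section Property4.
Variables (d : nat) (S : nat -> set 'rV[nat]_d).
Hypothesis S_NF : NF (fun t => [set natZ x | x in S t]).

Lemma NF_property4 : property4 S.
Proof.
have [V V0 h] := S_NF; exists V => // i.
have [ps ok hr] := h i (ltn_ord i).
have [bs [L [pb hL]]] := annihilated_rep ok hr.
pose l : {poly rat} := V%:R^-1 *: ('X - (i : nat)%:R%:P).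
pose co (w : 'rV[{poly int}]_d) : 'rV[{poly rat}]_d :=
  map_mx (fun r => map_poly intr r \Po l) w.
have Vn0 : V%:R != 0 :> rat by rewrite pnatr_eq0 -lt0n.
have coE s w : has_value (co w) (V * s + i)%N (evm s w).
  apply/rowP => j; rewrite !mxE horner_comp /horner_eval.
  have -> : l.[(V * s + i)%N%:R] = s%:R.
    by rewrite /l hornerZ hornerD hornerN hornerX hornerC natrD natrM addrK mulKf.
  by rewrite horner_intr.
have [T hT] := ev_and hL (ev_all pb).
exists (size L), (size bs), (fun j => (nth (0, 0) L j).1),
  (fun j => co (nth (0, 0) L j).2), (fun j => co (nth 0 bs j)), (V * T)%N.
move=> t Tt ti; have tE : t = (V * (t %/ V) + i)%N.
  by rewrite {1}(divn_eq t V) ti modn_small // mulnC.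
have Ts : (T <= t %/ V)%N by rewrite leq_divRL // mulnC.
move: tE Ts; move: (t %/ V)%N => s -> {ti Tt} Ts; have [hs hp] := hT s Ts.
exists (fun j => evm s (nth (0, 0) L j).2), (fun j => evm s (nth 0 bs j)); split.
- by move=> j; exact: coE.
- by move=> j; exact: coE.
- by move=> j; apply: hp; exact: mem_nth.
(* The functional may vary with [s]: it only serves to prove the identity of series at this [s]. *)
have [la [la0 hla]] : exists la : 'cV[int]_d, (forall i, 0 <= la i 0) /\
    forall b, b \in map (evm s) bs -> 0 < clin b la.
  by apply: lex_functional => _ /mapP[b bbs ->]; exact: hp.
move=> x; rewrite generating_functionE.
have bF : bounded_below la
    (fun x => (`[<[set natZ y | y in S (V * s + i)%N] x>] : bool)%:R : rat).
  exists 0%N => z; case: asboolP => [[y _ <-] _|]; last by rewrite eqxx.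
  rewrite oppr0 /clin mxE; apply: sumr_ge0 => j _.
  by rewrite mulr_ge0 // mxE.
have := expansion_unique hla bF hs => /(congr1 (fun G : laurent d => G x)) ->.
rewrite /rational_expansion; congr (laurent_mul _ _ x).
  apply/funext => z; rewrite /laurent_poly /evc big_map.
  by rewrite (big_nth (0, 0)) big_mkord.
by rewrite big_map (big_nth 0) big_mkord.
Qed.

End Property4.

Theorem theorem3p5 (d : nat) (S : nat -> set 'rV[nat]_d) (phi : formula d)
    (d_gt0 : (0 < d)%N)
    (phi_S : defines phi S)
    (phi_ab : quantifier_free phi \/ constant_coefficients phi) :
  [/\ property1 S, property2 S & property3 S] /\
  [/\ property3a S, property3b S & property4 S].
Proof.
have hS := NF_formula phi_S phi_ab; split; split.
- exact: NF_property1.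
- exact: NF_property2.
- exact: NF_property3.
- exact: NF_property3a.
- exact: NF_property3b.
- exact: NF_property4.
Qed.
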